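(* Let $U:\mathbb Z\to\mathbb R$ be a convex annealed Gaussian interaction. For every $\varepsilon>0$ there is a constant $C_{\varepsilon,U}\in(0,\infty)$, depending only on $\varepsilon$ and $U$, such that for every integer $1\le L<\infty$, with $\mathcal G_L=\mathbb Z^2\cap[-L,L]^2$, $$\sum_{j=1}^4\ \sum_{(x,y)\in\widetilde Q_j}\Big(\mathbb E^{O(2),U,\mathcal G_L}\big[\cos(\theta_x-\theta_y)\big]\Big)^{1-\varepsilon}\ \ge\ C_{\varepsilon,U}\,\mathbb E^{U,\mathcal G_L^*}\big[\mathcal N^{+,+}(f_0)+\mathcal N^{-,-}(f_0)\big]\ \ge\ C_{\varepsilon,U}\,\mathbb E^{U,\mathcal G_L^*}\big[|n(f_0)|\big].$$
   Context: Annealed Gaussian interaction: a function $U:\mathbb Z\to\mathbb R$ for which there is a finite non-negative Borel measure $\mu_U$ on $[0,\infty)$ with $e^{-U(q)}=\int_{[0,\infty)}e^{-\frac12\lambda q^2}\,d\mu_U(\lambda)$ for all $q\in\mathbb Z$. It is assumed that $\sum_{m\in\mathbb Z}e^{-U(m)}<\infty$, so that the measures below are well defined. $\mathcal G_L$ is the nearest-neighbor graph on $\mathbb Z^2\cap[-L,L]^2$. Height function: the vertices of $\mathcal G_L^*$ are the faces of $\mathcal G_L$ (including the outer face), and each edge of $\mathcal G_L$ gives a dual edge joining the two faces it borders. $\mathbb E^{U,\mathcal G_L^*}$ is expectation for the probability measure on functions $n$ from faces to $\mathbb Z$ vanishing on the outer face, with weights proportional to $\prod e^{-U(n_f-n_{f'})}$,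 the product being over dual edges. Dual spin model: $\mathbb E^{O(2),U,\mathcal G_L}$ is expectation for the probability measure on angles $\theta_x\in[-\pi,\pi)$, $x\in\mathcal G_L$, with density proportional to $\prod_{\{u,v\}}G_U(\theta_u-\theta_v)$ over edges of $\mathcal G_L$, where $G_U(\varphi)=\sum_{m\in\mathbb Z}\exp(-im\varphi-U(m))>0$. Level lines: for $q\in\mathbb Z+\frac12$, an oriented edge of $\mathcal G_L$ is a $q$-edge if $n<q$ on the face to its right and $n>q$ on the face to its left. At each vertex the incoming and outgoing $q$-edges alternate in the cyclic order; each incoming $q$-edge is continued by the first outgoing $q$-edge met when rotating counterclockwise about the vertex starting from the incoming edge, i.e. starting on its right side. This decomposes the $q$-edges into oriented non-crossing closed contours ($q$-loops); counterclockwise loops have orientation $+$ and clockwise loops orientation $-$. For a face $f$ and $\eta=\pm$, $\mathcal N_q^\eta(f)$ is the number of $q$-loops of orientation $\eta$ surrounding $f$, and $\mathcal N^{\eta,r}(f)=\sum_{q\in\mathbb Z+1/2,\ \mathrm{sgn}(q)=r}\mathcal N_q^\eta(f)$. $f_0$ is the face centered at $(1/2,1/2)$. $Q_1,\dots,Q_4$ are the four standard quadrants translated so that their corners are the four vertices of $f_0$ and their intersection is $f_0$: $Q_1=\{a\ge0,b\ge0\}$, $Q_2=\{a\le1,b\ge0\}$, $Q_3=\{a\le1,b\le1\}$, $Q_4=\{a\ge0,b\le1\}$. $\widetilde Q_j$ is the collection of pairs of distinct sites $\{x,y\}$ of $\mathcal G_L$, one on the vertical and the other on the horizontal part of the boundary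 of $Q_j$. *)

(* Defs.v *)
From HB Require Import structures.
From mathcomp Require Import all_boot all_order all_algebra.
From mathcomp Require Import all_classical all_reals all_analysis.

Set Implicit Arguments.
Unset Strict Implicit.
Unset Printing Implicit Defensive.

Import Order.TTheory GRing.Theory Num.Theory.
Import numFieldNormedType.Exports.

Local Open Scope classical_set_scope.
Local Open Scope ring_scope.

Section Interaction.
Context {R : realType}.
Implicit Types U : int -> R.

Definition convex_interaction U : Prop :=
  forall (a b c : int) (t : R), 0 <= t <= 1 ->
    b%:~R = t * a%:~R + (1 - t) * c%:~R ->
    U b <= t * U a + (1 - t) * U c.

(* A finite measure on [0, +oo[ is given here as a finite Borel measure on R
   of which only the restriction to [0, +oo[ is used. *)
Definition annealed_gaussian U : Prop :=
  exists mu : {finite_measure set (measurableTypeR R) -> \bar R},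
    forall q : int,
      ((expR (- U q))%:E =
       \int[mu]_(l in `[0%R, +oo[) (expR (- (l * q%:~R ^+ 2 / 2)))%:E)%E.

Definition summable_interaction U : Prop :=
  (\esum_(m in [set: int]) (expR (- U m))%:E < +oo)%E.

Lemma annealed_gaussian_even U (m : int) :
  annealed_gaussian U -> U (- m) = U m.
Proof.
case=> mu muU; apply: oppr_inj; apply: expR_inj; apply: EFin_inj.
by rewrite !muU rmorphN /= sqrrN.
Qed.

(* \sum_{m in Z} exp(-i m phi - U(m)).  An annealed Gaussian U is even, so the
   imaginary parts of the terms m and - m cancel, and only the real parts
   cos(m phi) exp(-U(m)) are summed.  The series converges absolutely; it is
   the limit of the sums over -N <= m <= N. *)
Definition G_ U (phi : R) : R :=
  limn (fun N : nat => \sum_(k < N.*2.+1)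
    let m : int := (k : nat)%:Z - N%:Z in cos (m%:~R * phi) * expR (- U m)).

End Interaction.

Section Lattice.
Variable L : nat.

Definition vertex : finType := ('I_L.*2.+1 * 'I_L.*2.+1)%type.

Definition pos (v : vertex) : int * int :=
  ((v.1 : nat)%:Z - L%:Z, (v.2 : nat)%:Z - L%:Z).

(* [Some s] is a unit square, [None] the outer face. *)
Definition square : finType := ('I_L.*2 * 'I_L.*2)%type.
Definition face : finType := option square.

Definition corner (s : square) : int * int :=
  ((s.1 : nat)%:Z - L%:Z, (s.2 : nat)%:Z - L%:Z).

(* The face containing the unit square of Z^2 with lower left corner p. *)
Definition face_at (p : int * int) : face := [pick s | corner s == p].

Definition f0 : face := face_at (0, 0).

(* 0 = east, 1 = north, 2 = west, 3 = south: adding 1 is a counterclockwise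
   quarter turn. *)
Definition dvec (d : 'Z_4) : int * int :=
  match val d with
  | 0%N => (1, 0) | 1%N => (0, 1) | 2%N => (-1, 0) | _ => (0, -1)
  end.

(* Lower left corner, relative to a lattice point, of the unit square at that
   point in the sector between the directions d and d + 1. *)
Definition sector (d : 'Z_4) : int * int :=
  match val d with
  | 0%N => (0, 0) | 1%N => (-1, 0) | 2%N => (-1, -1) | _ => (0, -1)
  end.

(* An oriented edge is a tail and a direction; [is_edge] says that the edge
   does not leave the box. *)
Definition dart : finType := (vertex * 'Z_4)%type.

Definition dhead (e : dart) : vertex :=
  odflt e.1 [pick v | pos v == pos e.1 + dvec e.2].

Definition is_edge (e : dart) : bool := pos (dhead e) == pos e.1 + dvec e.2.

Definition left_face (e : dart) : face := face_at (pos e.1 + sector e.2).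
Definition right_face (e : dart) : face := face_at (pos e.1 + sector (e.2 - 1)).

(* Each unoriented edge, oriented to the east or to the north. *)
Definition uedge (e : dart) : bool :=
  is_edge e && ((e.2 == 0) || (e.2 == 1)).

Definition height : choiceType := {ffun face -> int}.

Definition qedge (n : height) (q : rat) (e : dart) : bool :=
  [&& is_edge e, (n (right_face e))%:~R < q & q < (n (left_face e))%:~R].

(* Seen from its head, a dart of direction d lies in direction d + 2, so that
   the counterclockwise rotation meets d + 3, d + 4 = d and d + 5 = d + 1. *)
Definition next_qedge (n : height) (q : rat) (e : dart) : dart :=
  seq.head e [seq e' <- [:: (dhead e, e.2 + 3%:R); (dhead e, e.2);
                            (dhead e, e.2 + 1)] | qedge n q e'].

(* A loop is represented by the set of its oriented edges. *)
Definition qloops (n : height) (q : rat) : {set {set dart}} :=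
  [set [set e' | fconnect (next_qedge n q) e e'] |
     e in [set e | qedge n q e]]%SET.

(* The signed enclosed area \oint x dy. *)
Definition signed_area (l : {set dart}) : int :=
  \sum_(e in l) (pos e.1).1 * (dvec e.2).2.

Definition orientation (l : {set dart}) : int := sgz (signed_area l).

(* Winding number around the centre c of f: signed number of crossings of the
   horizontal half-line going east from c, upwards crossings being positive. *)
Definition winding (l : {set dart}) (f : face) : int :=
  if f is Some s then
    \sum_(e in l | (corner s).1 < (pos e.1).1)
       (((e.2 == 1) && ((pos e.1).2 == (corner s).2))%:R
        - ((e.2 == 3%:R) && ((pos e.1).2 == (corner s).2 + 1))%:R)
  else 0.

Definition surrounds (l : {set dart}) (f : face) : bool := winding l f != 0.

Definition loop_number (n : height) (q : rat) (eta : int) (f : face) : nat :=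
  #|[set l in qloops n q | (orientation l == eta) && surrounds l f]%SET|.

(* The signs eta and r are the integers 1 and -1. *)
Definition total_loop_number (R : realType) (eta r : int) (f : face)
    (n : height) : \bar R :=
  (\esum_(k in [set k : int | sgz (k%:~R + 1 / 2 : rat) = r])
     (loop_number n (k%:~R + 1 / 2) eta f)%:R%:E)%E.

End Lattice.

Arguments f0 : clear implicits.

Section HeightFunction.
Context {R : realType}.
Variables (U : int -> R) (L : nat).

Definition height_weight (n : height L) : R :=
  \prod_(e : dart L | uedge e) expR (- U (n (left_face e) - n (right_face e))).

Definition height_configs : set (height L) := [set n : height L | n None = 0].

Definition height_partition : \bar R :=
  (\esum_(n in height_configs) (height_weight n)%:E)%E.

(* For nonnegative observables F; height_partition is positive and finite. *)
Definition height_expectation (F : height L -> \bar R) : \bar R :=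
  ((\esum_(n in height_configs) (F n * (height_weight n)%:E))
   * ((fine height_partition)^-1)%:E)%E.

End HeightFunction.

Section SpinModel.
Context {R : realType}.
Variables (U : int -> R) (L : nat).

(* The integral of F over [-pi, pi[ in each of the coordinates listed in s, the
   others being given by theta.  It is applied below to bounded continuous F,
   for which the iterated integral is the integral against Lebesgue measure on
   the product. *)
Fixpoint angle_integral (s : seq (vertex L)) (F : (vertex L -> R) -> R)
    (theta : vertex L -> R) : R :=
  if s is x :: s' then
    \int[lebesgue_measure]_(t in `[- pi, pi[)
      angle_integral s' F (fun y => if y == x then t else theta y)
  else F theta.

Definition spin_density (theta : vertex L -> R) : R :=
  \prod_(e : dart L | uedge e) G_ U (theta e.1 - theta (dhead e)).

Definition spin_integral (F : (vertex L -> R) -> R) : R :=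
  angle_integral (enum (vertex L)) (fun theta => F theta * spin_density theta)
    (fun=> 0).

Definition spin_expectation (F : (vertex L -> R) -> R) : R :=
  spin_integral F / spin_integral (fun=> 1).

End SpinModel.

(* The quadrants Q_1, ..., Q_4 are indexed by 0, ..., 3. *)
Definition quadrant_corner (j : 'I_4) : int * int :=
  match val j with
  | 0%N => (0, 0) | 1%N => (1, 0) | 2%N => (1, 1) | _ => (0, 1)
  end.

Definition in_quadrant (j : 'I_4) (p : int * int) : bool :=
  match val j with
  | 0%N => (0 <= p.1) && (0 <= p.2)
  | 1%N => (p.1 <= 1) && (0 <= p.2)
  | 2%N => (p.1 <= 1) && (p.2 <= 1)
  | _ => (0 <= p.1) && (p.2 <= 1)
  end.

(* Unordered pairs are listed with the vertical site first.  The corner is the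
   only site on both parts, so each pair of distinct sites is listed once. *)
Definition quadrant_pairs (L : nat) (j : 'I_4) : {set vertex L * vertex L} :=
  [set xy | [&& xy.1 != xy.2,
     in_quadrant j (pos xy.1), (pos xy.1).1 == (quadrant_corner j).1,
     in_quadrant j (pos xy.2) & (pos xy.2).2 == (quadrant_corner j).2]]%SET.

(* Main.v *)
(** Write W = exp(- U).  A positively oriented loop around f0 of level above 0
enters the interior of the quadrant Q_1 through a site x of the horizontal axis
and leaves it through a site y of the vertical axis; for clockwise loops of
negative level the axes are exchanged.  Explore such an excursion from its first
edge, and let k + 1/2 be its level relative to the height on the right of that
edge.  Lower by 1 the height of the explored faces lying above the level line,
and add to the gradient of the new height a unit current along the line: the
result is an integer current with source x and sink y, from which the height can
be recovered.  The weights of the edges of the line are unchanged, and since U is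
convex, the sum over the heights of the other faces does not decrease (a cluster
argument of Edwards-Sokal type).  As <cos(theta_x - theta_y)> is a ratio of sums
over currents, it bounds the probability p_k of the excursion.  On the other
hand an excursion of relative level k forces a height difference larger than k
along its first edge, so that p_k decays exponentially in k, and
p_k <= min(a, t_k) <= a^(1-s) t_k^s can be summed over k.  For large eps one also
needs <cos(theta_x - theta_y)> <= 1, that is G_U >= 0, which holds because W is a
mixture of Gaussians.

The second inequality holds pointwise: the winding numbers around f0 of the loops
of level q add up to [q < n(f0)] - [q < 0], and a loop with non-zero winding
number is oriented according to its sign. *)

Require Import Defs.
From HB Require Import structures.
From mathcomp Require Import all_boot all_order all_algebra.
From mathcomp Require Import all_classical all_reals all_analysis.
From mathcomp Require Import measurable_realfun complex.
From mathcomp Require Import ring lra zify.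

Set Implicit Arguments.
Unset Strict Implicit.
Unset Printing Implicit Defensive.

Import Order.TTheory GRing.Theory Num.Theory.
Import numFieldNormedType.Exports.

Local Open Scope classical_set_scope.
Local Open Scope ring_scope.

(** Two obstacles shape the construction. First, the current must determine the height, although it
    does not show at which level the line runs. Levels are therefore counted from the face on the
    right of the first edge: a half-line leads from it to the outer face outside the interior of the
    quadrant, where the line has no edge, so the current gives the height of that face, except that
    the outer face may itself have been lowered. This last bit is the sign of the level, which is
    fixed by the kind of loop. Secondly, lowering by 1 is not an involution, so no flip of clusters
    in a single copy achieves it. A second independent copy is added, whose boundary values are
    levelled on the high faces; exchanging the copies on clusters lowers the first one, and a
    reflection about a half-integer restores the second one, which then cancels. The decay of p_k
    comes from the same monotonicity: given the difference across one edge, the total weight of the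
    other edges does not increase when a non-negative difference grows. *)

Lemma le_esum_inj (R : realType) (T T' : choiceType) (A : set T) (B : set T')
    (phi : T -> T') (g : T' -> \bar R) :
    set_inj A phi -> (forall x, A x -> B (phi x)) -> (forall y, (0 <= g y)%E) ->
  (\esum_(x in A) g (phi x) <= \esum_(y in B) g y)%E.
Proof.
move=> inj AB g0; rewrite -(@esum_image _ _ _ _ _ g inj).
rewrite esum_mkcond [leRHS]esum_mkcond.
apply: le_esum => n _; case: ifPn; last by case: ifP.
by rewrite inE => -[m /= mv <-]; rewrite ifT// inE; exact: AB.
Qed.

(** * Cluster flips and attraction *)

Section ClusterFlip.
Context {R : realType} {F E : finType} {X : choiceType}.
Variables (s t : E -> F) (V : E -> X -> X -> R) (inv : X -> X) (pos : pred X).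
Hypothesis V_ge0 : forall e a b, 0 <= V e a b.
Hypothesis invK : involutive inv.
Hypothesis V_inv : forall e a b, V e (inv a) (inv b) = V e a b.
Hypothesis V_pos : forall e a b, V e a (inv b) < V e a b -> pos a = pos b.

(* Edwards-Sokal: V is the sum of a part invariant under inv at one end of the
   edge and of a rest; inv can then be applied to whole clusters of the edges
   carrying the rest. *)
Let c e a b (o : bool) : R :=
  let m := Num.min (V e a b) (V e a (inv b)) in if o then V e a b - m else m.

Let c_ge0 e a b o : 0 <= c e a b o.
Proof.
rewrite /c; case: o; last by rewrite le_min !V_ge0.
by rewrite subr_ge0 ge_min lexx.
Qed.

Let V_split e a b : V e a b = \sum_(o : bool) c e a b o.
Proof. by rewrite big_bool /c /= subrK. Qed.

Let adj (w : {ffun E -> bool}) (f g : F) :=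
  [exists e, w e && ((s e == f) && (t e == g) || (s e == g) && (t e == f))].

Let cluster (w : {ffun E -> bool}) (A : {set F}) : {set F} :=
  [set f | [exists h in A, connect (adj w) h f]]%SET.

Let flip (C : {set F}) (n : {ffun F -> X}) : {ffun F -> X} :=
  [ffun f => if f \in C then inv (n f) else n f].

Let flipK C : involutive (flip C).
Proof. by move=> n; apply/ffunP => f; rewrite !ffunE; case: (f \in C); rewrite ?invK. Qed.

Let cluster_edge (w : {ffun E -> bool}) (A : {set F}) e : w e -> (s e \in cluster w A) = (t e \in cluster w A).
Proof.
move=> we; rewrite !inE; apply/existsP/existsP => -[h /andP[hA hc]]; exists h.
  rewrite hA /=; apply: connect_trans hc (connect1 _).
  by apply/existsP; exists e; rewrite we !eqxx.
rewrite hA /=; apply: connect_trans hc (connect1 _).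
by apply/existsP; exists e; rewrite we !eqxx orbT.
Qed.

(** An open edge has both ends in the cluster or neither, and [V] is invariant under [inv] at both
    ends. A closed edge carries the minimum over the two choices at one end, which is symmetric in
    them. *)
Let c_flip (w : {ffun E -> bool}) (A : {set F}) (n : {ffun F -> X}) e :
  let n' := flip (cluster w A) n in
  c e (n' (s e)) (n' (t e)) (w e) = c e (n (s e)) (n (t e)) (w e).
Proof.
have Vr a b : V e (inv a) b = V e a (inv b) by rewrite -[in LHS](invK b) V_inv.
rewrite /= !ffunE; case we: (w e).
  rewrite (cluster_edge A we); case: ifP => // _.
  by rewrite /c !V_inv.
rewrite /c; case: ifP => _; case: ifP => _ //; rewrite ?V_inv ?invK ?Vr//.
- by rewrite minC.
- by rewrite minC.
Qed.

(** On an open edge a non-zero weight means [V e a (inv b) < V e a b], so [V_pos] makes the sign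
    constant along clusters. *)
Let c_pos (w : {ffun E -> bool}) (n : {ffun F -> X}) : (forall e, c e (n (s e)) (n (t e)) (w e) != 0) ->
  forall h f, connect (adj w) h f -> pos (n h) = pos (n f).
Proof.
move=> nz h f /connectP[p + ->]; elim: p h => //= g p IH h /andP[hg /IH <-].
have key e : w e -> pos (n (s e)) = pos (n (t e)).
  move=> we; apply: (@V_pos e); rewrite ltNge; apply: contra (nz e) => le.
  by rewrite we /c (min_idPl le) subrr.
case/existsP: hg => e /andP[we /orP[|]] /andP[/eqP<- /eqP<-].
  exact: key.
by rewrite key.
Qed.

(** For fixed open edges, the clusters of the pinned faces in [Hi] are flipped. If they reach a
    pinned face outside [Hi], all weights on the left vanish by [c_pos], and this is where the
    inequality may be strict; otherwise the flip is an injection preserving weights. *)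
Lemma cluster_flip (S Hi : {set F}) (v : F -> X) :
    {in S, forall f, pos (v f) = (f \in Hi)} ->
  (\esum_(n in [set n : {ffun F -> X} | {in S, forall f, n f = v f}])
     (\prod_e V e (n (s e)) (n (t e)))%:E <=
   \esum_(n in [set n : {ffun F -> X} |
               {in S, forall f, n f = if f \in Hi then inv (v f) else v f}])
     (\prod_e V e (n (s e)) (n (t e)))%:E)%E.
Proof.
move=> posv; pose W (w : {ffun E -> bool}) (n : {ffun F -> X}) : R :=
  \prod_e c e (n (s e)) (n (t e)) (w e).
have W_ge0 w n : (0 <= (W w n)%:E)%E.
  by rewrite lee_fin; apply: prodr_ge0 => e _; exact: c_ge0.
have VW (n : {ffun F -> X}) : (\prod_e V e (n (s e)) (n (t e)))%:E =
            (\sum_(w : {ffun E -> bool}) (W w n)%:E)%E.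
  rewrite sumEFin; congr EFin; under eq_bigr do rewrite V_split.
  by rewrite bigA_distr_bigA.
under eq_esum do rewrite VW; rewrite esum_sum//.
under [leRHS]eq_esum do rewrite VW; rewrite [leRHS]esum_sum//.
apply: lee_sum => w _; set C := cluster w (S :&: Hi).
have [/fintype.subsetP sub|] := boolP (S :&: C \subset Hi); last first.
  case/fintype.subsetPn => f; rewrite inE => /andP[fS]; rewrite inE.
  case/existsP => h /andP[]; rewrite inE => /andP[hS hHi] hf fHi.
  rewrite esum1 ?esum_ge0// => n /= nv.
  have [->//|nz] := eqVneq (W w n) 0.
  have nz' e : c e (n (s e)) (n (t e)) (w e) != 0.
    by move: nz; apply: contra_neq => e0; rewrite /W (bigD1 e)//= e0 mul0r.
  by have := c_pos nz' hf; rewrite !nv// !posv// hHi (negbTE fHi).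
have inj : set_inj [set n : {ffun F -> X} | {in S, forall f, n f = v f}] (flip C).
  by move=> x y _ _; exact: (can_inj (flipK C)).
rewrite (@eq_esum _ _ _ _ (fun n => (W w (flip C n))%:E)); last first.
  by move=> n _; congr EFin; apply: eq_bigr => e _; rewrite c_flip.
apply: (@le_esum_inj _ _ _ _ _ (flip C) (fun n => (W w n)%:E)) => //.
move=> n /= mv f fS; rewrite ffunE mv//.
have -> // : (f \in C) = (f \in Hi).
apply/idP/idP => [fC|fHi]; first by apply: sub; rewrite inE fS.
by rewrite inE; apply/existsP; exists f; rewrite inE fS fHi connect0.
Qed.
End ClusterFlip.

Lemma esumZl (R : realType) (T : choiceType) (A : set T) (f : T -> \bar R) (r : R) :
    0 <= r -> (forall x, (0 <= f x)%E) ->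
  (\esum_(x in A) (r%:E * f x) = r%:E * \esum_(x in A) f x)%E.
Proof.
move=> r0 f0; rewrite /esum -ereal_supZl//; last first.
  by apply/set0P; exists 0%E; exists set0; [exact: fsets_set0|rewrite fsbig_set0].
rewrite image_comp; congr ereal_sup; apply/eq_imagel => X /= [_ XA].
by rewrite ge0_mule_fsumr.
Qed.

(** * Convexity and symmetry of the edge weights *)

Section Potential.
Context {R : realType}.
Variable U : int -> R.
Hypothesis convU : convex_interaction U.
Hypothesis gaussU : annealed_gaussian U.

Definition boltzmann (q : int) : R := expR (- U q).
Local Notation W := boltzmann.

Lemma boltzmann_gt0 q : 0 < W q. Proof. exact: expR_gt0. Qed.
Lemma boltzmann_ge0 q : 0 <= W q. Proof. exact: expR_ge0. Qed.
Lemma boltzmannN q : W (- q) = W q.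
Proof. by rewrite /W annealed_gaussian_even. Qed.

(** Both [c] and [d] are convex combinations of [a] and [b], with complementary coefficients, so the
    two convexity bounds add up. *)
Lemma convex_interaction_swap (a b c d : int) :
  b <= c <= a -> c + d = a + b -> U c + U d <= U a + U b.
Proof.
move=> /andP[bc ca] cd.
have [ab|ab] := eqVneq a b.
  have -> : c = a by lia.
  by have -> : d = b by lia.
pose t : R := (c - b)%:~R / (a - b)%:~R.
have ab0 : (0 : R) < (a - b)%:~R by rewrite ltr0z; lia.
have t01 : 0 <= t <= 1.
  rewrite ler_pdivrMr// mul1r ler_int lerD2r ca andbT.
  by rewrite divr_ge0 ?(ltW ab0)// ler0z subr_ge0.
have abE : (a - b)%:~R = a%:~R - b%:~R :> R by rewrite rmorphB.
have cE : c%:~R = t * a%:~R + (1 - t) * b%:~R.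
  rewrite /t rmorphB /= abE; move: ab0; rewrite abE => ab0; field.
  by rewrite gt_eqF.
have dE : d%:~R = (1 - t) * a%:~R + (1 - (1 - t)) * b%:~R.
  have -> : d = a + b - c by lia.
  rewrite rmorphB rmorphD /= cE; ring.
have t01' : 0 <= 1 - t <= 1 by lra.
have := convU t01 cE; have := convU t01' dE; lra.
Qed.

(** The differences on the right lie between those on the left and have the same sum: this is
    log-concavity. It becomes the hypothesis [V_pos] of [cluster_flip] for the exchange of two
    copies. *)
Lemma boltzmann_swap (x y x' y' : int) : (x <= y) && (y' <= x') || (y <= x) && (x' <= y') ->
  W (x - x') * W (y - y') <= W (x - y') * W (y - x').
Proof.
move=> h; rewrite /W -!expRD ler_expR -!opprD lerN2.
case/orP: h => /andP[h1 h2].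
  rewrite [leRHS]addrC; apply: convex_interaction_swap; lia.
apply: convex_interaction_swap; lia.
Qed.

Lemma boltzmann_norm q : W `|q| = W q.
Proof. by case: ger0P => // _; rewrite boltzmannN. Qed.

Lemma boltzmann_mono (a b : int) : `|a| <= `|b| -> W b <= W a.
Proof.
move=> ab; have := @convex_interaction_swap `|b| (- `|b|) `|a| (- `|a|).
rewrite !(annealed_gaussian_even _ gaussU) subrr subrr => /(_ _ erefl) h.
rewrite -(boltzmann_norm a) -(boltzmann_norm b) /W ler_expR lerN2.
by have := h ltac:(lia); lra.
Qed.
End Potential.

(** * Monotonicity of partition functions in the pinned heights *)

Section Attraction.
Context {R : realType} {F E : finType}.
Variables (s t : E -> F) (pr : pred E) (W : int -> R).
Hypothesis W_gt0 : forall q, 0 < W q.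
Hypothesis W_even : forall q, W (- q) = W q.
Hypothesis W_mono : forall a b : int, `|a| <= `|b| -> W b <= W a.
Hypothesis W_swap : forall x y x' y' : int,
  (x <= y) && (y' <= x') || (y <= x) && (x' <= y') ->
  W (x - x') * W (y - y') <= W (x - y') * W (y - x').

(** Edges outside [pr] have no factor. In the applications these are the edges of the level line, or
    a single edge; both their faces lie in [S], so their factors are constant. *)
Definition pinned_sum (S : {set F}) (v : F -> int) : \bar R :=
  \esum_(n in [set n : {ffun F -> int} | {in S, forall f, n f = v f}])
    (\prod_(e | pr e) W (n (s e) - n (t e)))%:E.
Local Notation Z := pinned_sum.

Let w_ge0 (n : {ffun F -> int}) : (0 <= (\prod_(e | pr e) W (n (s e) - n (t e)))%:E)%E.
Proof. by rewrite lee_fin prodr_ge0// => e _; exact: ltW. Qed.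

Lemma pinned_sum_shift S v (c : int) : Z S (fun f => v f + c) = Z S v.
Proof.
have le (u : F -> int) (d : int) : (Z S u <= Z S (fun f => (u f + d)%R))%E.
  rewrite /Z; pose sh (n : {ffun F -> int}) : {ffun F -> int} := [ffun f => n f + d].
  rewrite (@eq_esum _ _ _ _ (fun n => (\prod_(e | pr e)
      W (sh n (s e) - sh n (t e)))%:E)); last first.
    move=> n _; congr EFin; apply: eq_bigr => e _; rewrite !ffunE; congr W.
    by rewrite opprD addrACA subrr addr0.
  apply: (@le_esum_inj _ _ _ _ _ sh
     (fun n => (\prod_(e | pr e) W (n (s e) - n (t e)))%:E)) => //.
    move=> x y _ _ /ffunP xy; apply/ffunP => f.
    by have := xy f; rewrite !ffunE => /addIr.
  by move=> n /= nv f fS; rewrite ffunE nv.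
apply/eqP; rewrite eq_le le andbT (le_trans (le _ (- c)))//.
rewrite (_ : (fun f => _) = v)//; apply/funext => f; lia.
Qed.

Lemma eq_pinned_sum (S : {set F}) (u v : F -> int) : {in S, u =1 v} -> Z S u = Z S v.
Proof.
move=> uv; rewrite /Z (_ : [set n : {ffun F -> int} | {in S, forall f, n f = u f}] =
  [set n : {ffun F -> int} | {in S, forall f, n f = v f}])//.
by apply/seteqP; split => n /= h f fS; rewrite h// uv.
Qed.

Lemma pinned_sum_gt0 S v : (0 < Z S v)%E.
Proof.
pose n : {ffun F -> int} := [ffun f => v f].
have : (0 < (\prod_(e | pr e) W (n (s e) - n (t e)))%:E)%E.
  by rewrite lte_fin prodr_gt0.
move=> /lt_le_trans; apply.
rewrite -(@esum_set1 _ _ n (fun n => (\prod_(e | pr e) W (n (s e) - n (t e)))%:E))//.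
by apply: (@le_esum_inj _ _ _ _ _ id) => // x -> f _; rewrite ffunE.
Qed.

Variable S : {set F}.
Hypothesis Z_fin : forall v, (Z S v < +oo)%E.

(** Two independent copies form one model with values in pairs of integers, to which [cluster_flip]
    applies with the swap as involution. *)
Let esum_pair (u v : F -> int) :
  (\esum_(n in [set n : {ffun F -> int * int} | {in S, forall f, n f = (u f, v f)}])
    (\prod_e if pr e then W ((n (s e)).1 - (n (t e)).1) * W ((n (s e)).2 - (n (t e)).2) else 1)%:E
   = Z S u * Z S v)%E.
Proof.
pose w (n : {ffun F -> int}) := \prod_(e | pr e) W (n (s e) - n (t e)).
have Zv : (Z S v)%E = (fine (Z S v))%:E.
  rewrite fineK// ge0_fin_numE ?Z_fin//; exact: ltW (pinned_sum_gt0 _ _).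
transitivity (\esum_(m in [set n : {ffun F -> int} | {in S, forall f, n f = u f}])
  \esum_(n in [set n : {ffun F -> int} | {in S, forall f, n f = v f}]) ((w m)%:E * (w n)%:E))%E.
  rewrite esum_esum; last by move=> m n _ _; apply: mule_ge0; exact: w_ge0.
  pose split (n : {ffun F -> int * int}) : {ffun F -> int} * {ffun F -> int} :=
    ([ffun f => (n f).1], [ffun f => (n f).2]).
  rewrite (@reindex_esum _ _ _ [set n : {ffun F -> int * int} |
     {in S, forall f, n f = (u f, v f)}] _ split); last first.
    split.
    - by move=> n /= nuv; split => f fS; rewrite ffunE nuv.
    - move=> m n _ _ [/ffunP h1 /ffunP h2]; apply/ffunP => f.
      have := h1 f; have := h2 f; rewrite !ffunE.
      by case: (m f) (n f) => [? ?] [? ?] /= -> ->.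
    - move=> [m n] /= [mu nv]; exists [ffun f => (m f, n f)].
        by move=> f fS /=; rewrite ffunE mu// nv.
      by congr pair; apply/ffunP => f; rewrite !ffunE.
  apply: eq_esum => n _; rewrite -EFinM; congr EFin.
  rewrite /w -big_split /= -big_mkcond; apply: eq_bigr => e _; by rewrite !ffunE.
rewrite (@eq_esum _ _ _ _ (fun m => (fine (Z S v))%:E * (w m)%:E))%E; last first.
  move=> m _; rewrite esumZl//.
    by rewrite -/(Z S v) Zv muleC.
  by rewrite -lee_fin; exact: w_ge0.
rewrite esumZl//; first by rewrite -Zv muleC.
by rewrite fine_ge0// ltW// pinned_sum_gt0.
Qed.

Variables (Hi : {set F}) (v : F -> int) (k : int).
Hypothesis vHi : {in S, forall f, (k < v f) = (f \in Hi)}.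

(** Boundary values of the auxiliary copy, used at the two heights next to [k + 1/2]. *)
Let flat (a : int) f := if f \in Hi then a else v f.

(* Exchanges, on clusters of Hi, two independent copies of the model, the first
   one lowered by 1. *)
Let pinned_sum_exchange :
  (Z S v * Z S (flat k) <= Z S (flat (k + 1)%R) * Z S (fun f => (v f - (f \in Hi)%:Z)%R))%E.
Proof.
rewrite -(pinned_sum_shift S v (- 1)) -(pinned_sum_shift S (flat (k + 1)) (- 1)).
rewrite -!esum_pair//.
pose V (e : E) (a b : int * int) := if pr e then W (a.1 - b.1) * W (a.2 - b.2) else 1.
pose sw (a : int * int) := (a.2, a.1).
(* With the first copy lowered, [a.2 <= a.1] holds on [S] exactly at the faces of [Hi]: there
   [k <= v f - 1], while elsewhere the second copy has the value [v f]. *)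
have := @cluster_flip R F E (int * int)%type s t V sw (fun a => a.2 <= a.1) _ _ _ _
  S Hi (fun f => (v f - 1, flat k f)).
move=> /(_ _ _ _ _ _)/le_trans; apply.
- by move=> e a b; rewrite /V; case: ifP => // _; rewrite mulr_ge0// ltW.
- by case.
- by move=> e a b; rewrite /V; case: ifP => // _; rewrite mulrC.
- move=> e [x y] [x' y']; rewrite /V /sw /=; case: ifP => _; last by rewrite ltxx.
  move=> h; apply/idP/idP => h'; rewrite leNgt; apply/negP => h'';
  move: h; rewrite ltNge => /negP; apply; apply: W_swap; lia.
- move=> f fS /=; rewrite /flat -vHi//; have [] := ltP k (v f); lia.
rewrite le_eqVlt; apply/orP; left; apply/eqP.
congr (esum _ _); apply/seteqP; split => n /= h f fS; rewrite h// /flat /sw;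
  case: (f \in Hi); rewrite /= ?addrK ?subr0//.
Qed.

(* Reflects the clusters of Hi about k + 1/2. *)
Let pinned_sum_reflect : (Z S (flat (k + 1)%R) <= Z S (flat k))%E.
Proof.
pose V (e : E) (a b : int) := if pr e then W (a - b) else 1.
pose rf (a : int) : int := k + k + 1 - a.
rewrite /Z; under eq_esum do rewrite big_mkcond.
under [leRHS]eq_esum do rewrite big_mkcond.
have := @cluster_flip R F E int s t V rf (fun a => k < a) _ _ _ _
  S Hi (flat (k + 1)).
move=> /(_ _ _ _ _ _)/le_trans; apply.
- by move=> e a b; rewrite /V; case: ifP => // _; rewrite ltW.
- by move=> a; rewrite /rf; lia.
- move=> e a b; rewrite /V; case: ifP => // _; rewrite -W_even; congr W; rewrite /rf; lia.
- move=> e a b; rewrite /V /rf; case: ifP => _; last by rewrite ltxx.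
  move=> h; apply/idP/idP => h'; rewrite ltNge; apply/negP => h'';
  move: h; rewrite ltNge => /negP; apply; apply: W_mono; lia.
- move=> f fS /=; rewrite /flat -vHi//; have [] := ltP k (v f); lia.
rewrite le_eqVlt; apply/orP; left; apply/eqP.
congr (esum _ _); apply/seteqP; split => n /= h f fS; rewrite h// /flat /rf;
  case: (f \in Hi) => //; lia.
Qed.

(** The exchange and the reflection are combined; [Z S (flat k)] then stands on both sides and
    cancels, being positive and finite. *)
Lemma pinned_sum_attraction : (Z S v <= Z S (fun f => (v f - (f \in Hi)%:Z)%R))%E.
Proof.
have Zk : (Z S (flat k) = (fine (Z S (flat k)))%:E)%E.
  rewrite fineK// ge0_fin_numE ?Z_fin//; exact: ltW (pinned_sum_gt0 _ _).
have Zk0 : 0 < fine (Z S (flat k)) by rewrite -lte_fin -Zk pinned_sum_gt0.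
rewrite -(@lee_pmul2r _ (fine (Z S (flat k)))%:E)//.
by rewrite -Zk (le_trans pinned_sum_exchange)// muleC lee_pmul//;
  exact: ltW (pinned_sum_gt0 _ _).
Qed.
End Attraction.

(** * The dual lattice *)

Lemma Z4_case (P : 'Z_4 -> Prop) :
  P 0 -> P 1 -> P 2%:R -> P 3%:R -> forall d, P d.
Proof.
move=> P0 P1 P2 P3 [[|[|[|[|//]]]] hd].
- by rewrite (_ : Ordinal hd = 0)//; exact: val_inj.
- by rewrite (_ : Ordinal hd = 1)//; exact: val_inj.
- by rewrite (_ : Ordinal hd = 2%:R)//; exact: val_inj.
- by rewrite (_ : Ordinal hd = 3%:R)//; exact: val_inj.
Qed.

Lemma big_Z4 (V : nmodType) (F : 'Z_4 -> V) :
  \sum_d F d = F 0 + F 1 + F 2%:R + F 3%:R.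
Proof.
rewrite !big_ord_recl big_ord0 addr0 !addrA.
by congr (_ + _ + _ + _); congr F; exact: val_inj.
Qed.

Lemma sectorD1 d : sector (d + 1) + dvec d = sector d.
Proof. by elim/Z4_case: d. Qed.

Lemma sectorD2 d : sector (d + 2%:R) + dvec d = sector (d - 1).
Proof. by elim/Z4_case: d. Qed.

Lemma dvecD2 d : dvec (d + 2%:R) = - dvec d.
Proof. by elim/Z4_case: d. Qed.

Section Lattice.
Variable L : nat.
Implicit Types (e : dart L) (v : vertex L) (p : int * int).

Definition in_box p : bool :=
  (- L%:Z <= p.1 <= L%:Z) && (- L%:Z <= p.2 <= L%:Z).

Lemma pos_inj : injective (@pos L).
Proof.
move=> [a b] [a' b'] [h1 h2]; congr pair; apply: val_inj => /=; lia.
Qed.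

Lemma pos_snd v : (pos v).2 = (v.2 : nat)%:Z - L%:Z.
Proof. by []. Qed.

Lemma pos_in_box v : in_box (pos v).
Proof.
case: v => [[a ha] [b hb]]; rewrite /in_box /pos /=; lia.
Qed.

Lemma pos_onto p : in_box p -> exists v, pos v = p.
Proof.
case: p => a b /andP[/= /andP[a1 a2] /andP[b1 b2]].
have ha : (absz (a + L%:Z)%R < L.*2.+1)%N by lia.
have hb : (absz (b + L%:Z)%R < L.*2.+1)%N by lia.
by exists (Ordinal ha, Ordinal hb); rewrite /pos /=; congr pair; lia.
Qed.

Lemma is_edgeE e : is_edge e = in_box (pos e.1 + dvec e.2).
Proof.
apply/idP/idP => [/eqP <-|/pos_onto[v vE]]; first exact: pos_in_box.
rewrite /is_edge /dhead; case: pickP => [w /= -> //|/(_ v)].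
by rewrite vE eqxx.
Qed.

Lemma pos_dhead e : is_edge e -> pos (dhead e) = pos e.1 + dvec e.2.
Proof. by move=> /eqP. Qed.

Lemma face_at_corner s : face_at L (corner s) = Some s.
Proof.
rewrite /face_at; case: pickP => [s' /eqP|/(_ s)]; last by rewrite eqxx.
case: s s' => a b [a' b'] [h1 h2]; congr Some; congr pair; apply: val_inj => /=; lia.
Qed.

Lemma face_at_out p :
  ~~ ((- L%:Z <= p.1 < L%:Z) && (- L%:Z <= p.2 < L%:Z)) -> face_at L p = None.
Proof.
move=> h; rewrite /face_at; case: pickP => // -[[a ha] [b hb]] /= /eqP pE.
by move: h; rewrite -pE /corner /=; lia.
Qed.

Lemma face_at_in p :
    (- L%:Z <= p.1 < L%:Z) && (- L%:Z <= p.2 < L%:Z) ->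
  exists2 s, face_at L p = Some s & corner s = p.
Proof.
case: p => a b /andP[/= /andP[a1 a2] /andP[b1 b2]].
have ha : (absz (a + L%:Z)%R < L.*2)%N by lia.
have hb : (absz (b + L%:Z)%R < L.*2)%N by lia.
have sE : corner (Ordinal ha, Ordinal hb) = (a, b).
  by rewrite /corner /=; congr pair; lia.
by exists (Ordinal ha, Ordinal hb); rewrite // -sE face_at_corner.
Qed.

Lemma right_face_rot v (d : 'Z_4) : right_face (v, d + 1) = left_face (v, d).
Proof. by rewrite /right_face /left_face /= addrK. Qed.

Lemma left_face_dhead e : is_edge e ->
  left_face (dhead e, e.2 + 1) = left_face e.
Proof.
move=> /pos_dhead h; rewrite /left_face /= h -addrA; congr (face_at _ (_ + _)).
by rewrite addrC sectorD1.
Qed.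

Lemma right_face_dhead e : is_edge e ->
  right_face (dhead e, e.2 + 3%:R) = right_face e.
Proof.
move=> /pos_dhead h; rewrite /right_face /= h -addrA; congr (face_at _ (_ + _)).
rewrite addrC -[RHS]sectorD2 -addrA; congr (sector (_ + _) + _); exact: val_inj.
Qed.

(** Neither sector beside a direction that leaves the box contains a square of it. Sums around a
    vertex can therefore run over all four directions. *)
Lemma left_face_nedge e : ~~ is_edge e -> left_face e = None.
Proof.
rewrite is_edgeE => h; apply: face_at_out; move: h; have := pos_in_box e.1.
rewrite /in_box; case: (pos e.1) => a b; case: e => v d /=.
by elim/Z4_case: d => /=; lia.
Qed.

Lemma right_face_nedge e : ~~ is_edge e -> right_face e = None.
Proof.
rewrite is_edgeE => h; apply: face_at_out; move: h; have := pos_in_box e.1.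
rewrite /in_box; case: (pos e.1) => a b; case: e => v d /=.
by elim/Z4_case: d => /=; lia.
Qed.

Definition drev e : dart L := (dhead e, e.2 + 2%:R).

Lemma is_edge_drev e : is_edge e -> is_edge (drev e).
Proof.
move=> h; rewrite is_edgeE /= (pos_dhead h) dvecD2 addrK; exact: pos_in_box.
Qed.

Lemma dhead_drev e : is_edge e -> dhead (drev e) = e.1.
Proof.
move=> h; apply: pos_inj.
by rewrite (pos_dhead (is_edge_drev h)) /= (pos_dhead h) dvecD2 addrK.
Qed.

Lemma drevK e : is_edge e -> drev (drev e) = e.
Proof.
move=> h; rewrite /drev dhead_drev//= -addrA (_ : 2%:R + 2%:R = 0) ?addr0; last exact: val_inj.
by case: e h.
Qed.

Lemma left_face_drev e : is_edge e -> left_face (drev e) = right_face e.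
Proof.
by move=> h; rewrite -right_face_rot -addrA -[RHS]right_face_dhead.
Qed.

Lemma right_face_drev e : is_edge e -> right_face (drev e) = left_face e.
Proof.
move=> h; rewrite /drev (_ : e.2 + 2%:R = e.2 + 1 + 1) ?right_face_rot ?left_face_dhead//.
by rewrite -addrA; congr (_ + _); exact: val_inj.
Qed.

Lemma uedge_drev e : is_edge e -> uedge (drev e) = ~~ uedge e.
Proof.
move=> h; rewrite /uedge h is_edge_drev//=.
by case: e {h} => v d /=; elim/Z4_case: d.
Qed.

Lemma qedgeE (n : height L) (k : int) e :
  qedge n (k%:~R + 1 / 2) e =
  [&& is_edge e, n (right_face e) <= k & k < n (left_face e)].
Proof.
rewrite /qedge; congr [&& _, _ & _].
  apply/idP/idP => h; first by rewrite -ltzD1 -(ltr_int rat) rmorphD /=; lra.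
  by move: h; rewrite -(ler_int rat) => h; lra.
apply/idP/idP => h; first by rewrite -(ltr_int rat); lra.
by move: h; rewrite -lezD1 -(ler_int rat) rmorphD /=; lra.
Qed.

End Lattice.

#[local] Opaque pos.

(** * Flows and potentials *)

Section Flows.
Variable L : nat.
Implicit Types (e : dart L) (v : vertex L) (p : int * int) (j c : dart L -> int).
Implicit Types (n : height L).

Definition antisym j := forall e, is_edge e -> j (drev e) = - j e.
Definition outflow j v : int := \sum_(e | is_edge e && (e.1 == v)) j e.
Definition grad n e : int := n (left_face e) - n (right_face e).
Definition circ c e : int := c e - c (drev e).

Lemma antisym_grad n : antisym (grad n).
Proof. by move=> e h; rewrite /grad left_face_drev// right_face_drev// opprB. Qed.

Lemma antisym_circ c : antisym (circ c).
Proof. by move=> e h; rewrite /circ drevK// opprB. Qed.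

Lemma antisymD j j' : antisym j -> antisym j' -> antisym (fun e => j e + j' e).
Proof. by move=> h h' e ee; rewrite h// h'// opprD. Qed.

Lemma sum_drev (V : nmodType) (Q : pred (dart L)) (F : dart L -> V) :
  \sum_(e | is_edge e && Q e) F e = \sum_(e | is_edge e && Q (drev e)) F (drev e).
Proof.
rewrite (reindex_onto (@drev L) (@drev L)) => [|e /andP[h _]]; last exact: drevK.
apply: eq_bigl => e; apply/idP/idP => [/andP[/andP[h1 h2] /eqP h3]|/andP[h1 h2]].
  by have := is_edge_drev h1; rewrite h3 h2 => ->.
by rewrite is_edge_drev// h2 drevK// eqxx.
Qed.

Lemma sum_uedge j (F : dart L -> int) : antisym j ->
  (forall e, is_edge e -> F (drev e) = - F e) ->
  \sum_(e | is_edge e) j e * F e = (\sum_(e | uedge e) j e * F e) *+ 2.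
Proof.
move=> aj aF; rewrite mulr2n (bigID (@uedge L))/=; congr (_ + _).
  by apply: eq_bigl => e; rewrite /uedge andbA andbb.
rewrite sum_drev.
apply: eq_big => [e|e /andP[h _]]; last by rewrite aj// aF// mulrNN.
apply/andP/idP => [[h]|h]; first by rewrite uedge_drev// negbK.
by have /andP[h' _] := h; rewrite h' uedge_drev// negbK.
Qed.

Lemma outflow_circ c v :
  outflow (circ c) v =
  \sum_(e | is_edge e) c e * ((e.1 == v)%:Z - (dhead e == v)%:Z).
Proof.
rewrite /outflow /circ big_split /= sumrN.
rewrite (sum_drev (fun e => e.1 == v) (fun e => c (drev e))) /=.
rewrite [RHS](eq_bigr (fun e => c e * (e.1 == v)%:Z + - (c e * (dhead e == v)%:Z))); last first.
  by move=> e _; rewrite mulrBr.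
rewrite big_split /= sumrN; congr (_ - _).
  rewrite [RHS](bigID (fun e => e.1 == v)) /= [X in _ + X]big1 ?addr0.
    by apply: eq_bigr => e /andP[_ ->]; rewrite mulr1.
  by move=> e /andP[_ /negbTE->]; rewrite mulr0.
rewrite [RHS](bigID (fun e => dhead e == v)) /= [X in _ + X]big1 ?addr0.
  by apply: eq_bigr => e /andP[h ->]; rewrite mulr1 drevK.
by move=> e /andP[_ /negbTE->]; rewrite mulr0.
Qed.

(** For an antisymmetric flow, [circ j] is twice [j], and pairing each edge with its reversal
    doubles the other side too; the factor 2 cancels over the integers. *)
Lemma outflow_uedge j v : antisym j ->
  outflow j v = \sum_(e | uedge e) j e * ((e.1 == v)%:Z - (dhead e == v)%:Z).
Proof.
move=> aj.
have h2 : outflow (circ j) v = outflow j v *+ 2.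
  rewrite /outflow -sumrMnl; apply: eq_bigr => e /andP[h _].
  by rewrite /circ aj// opprK mulr2n.
have := outflow_circ j v; rewrite h2 sum_uedge//; last first.
  by move=> e h; rewrite dhead_drev//= opprB.
by move/eqP; rewrite !mulr2n => /eqP; lia.
Qed.

Lemma sum_tail (V : nmodType) (F : dart L -> V) v :
  \sum_(e | is_edge e && (e.1 == v)) F e = \sum_(d | is_edge (v, d)) F (v, d).
Proof.
rewrite (reindex_onto (fun d => (v, d)) snd) => [|[w d] /andP[_ /eqP /= ->]//].
by apply: eq_bigl => d; rewrite /= !eqxx !andbT.
Qed.

(** Each sector at [v] is on the left of one direction and on the right of the next, so the four
    differences telescope. *)
Lemma outflow_grad n v : outflow (grad n) v = 0.
Proof.
rewrite /outflow sum_tail big_mkcond /=.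
transitivity (\sum_d grad n (v, d)).
  apply: eq_bigr => d _; case: ifPn => // h.
  by rewrite /grad left_face_nedge// right_face_nedge// subrr.
rewrite big_Z4 /grad.
have rot (d d' : 'Z_4) : d' = d + 1 -> right_face (v, d') = left_face (v, d).
  by move=> ->; exact: right_face_rot.
rewrite (rot 0 1); last exact: val_inj.
rewrite (rot 1 2%:R); last exact: val_inj.
rewrite (rot 2%:R 3%:R); last exact: val_inj.
rewrite (rot 3%:R 0); last exact: val_inj.
ring.
Qed.

(** Upward flux across the half-line going east from the centre of the unit square at [p]. For the
    circulation along a loop it is the winding number around that square. *)
Definition flow_east j p : int :=
  \sum_(e | is_edge e && [&& e.2 == 1, (pos e.1).2 == p.2 & p.1 < (pos e.1).1]) j e.

Let flow_at j d p : int := \sum_(e | is_edge e && ((e.2 == d) && (pos e.1 == p))) j e.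

Let flow_atE j d v : flow_at j d (pos v) = if is_edge (v, d) then j (v, d) else 0.
Proof.
case: ifPn => h.
  rewrite /flow_at (big_pred1 (v, d))// => -[w d'] /=.
  apply/idP/idP => [/andP[_ /andP[/eqP-> /eqP/(@pos_inj L)->]]//|/eqP[-> ->]].
  by rewrite h !eqxx.
apply: big1 => -[w d'] /= /andP[h' /andP[/eqP dE /eqP/(@pos_inj L) wE]].
by move: h; rewrite -dE -wE h'.
Qed.

Let flow_east_west j (a b : int) : flow_east j (a - 1, b) - flow_east j (a, b) = flow_at j 1 (a, b).
Proof.
apply/eqP; rewrite subr_eq; apply/eqP.
rewrite /flow_east (bigID (fun e => (pos e.1).1 == a)) /=; congr (_ + _).
  apply: eq_bigl => e; case: (pos e.1) => x y /=.
  apply/idP/idP.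
    by move=> /andP[/andP[-> /and3P[-> /eqP-> _]] /eqP->]; rewrite eqxx.
  by move=> /andP[-> /andP[-> /eqP[-> ->]]]; rewrite !eqxx /= andbT; lia.
apply: eq_bigl => e; case: (pos e.1) => x y /=; rewrite -!andbA; do 3!congr (_ && _).
lia.
Qed.

(** Conservation of the flow, summed over the vertices of row [b] to the right of [a]: horizontal
    flows cancel in pairs, except the one coming from [(a, b)]. *)
Let flow_east_south j (a b : int) : antisym j -> (forall v, outflow j v = 0) ->
  flow_east j (a, b) - flow_east j (a, b - 1) = flow_at j 0 (a, b).
Proof.
move=> aj j0.
pose R v := (a < (pos v).1) && ((pos v).2 == b).
have : \sum_(e | is_edge e && R e.1) j e = 0.
  rewrite (partition_big (fun e => e.1) R) /=; last by move=> e /andP[].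
  apply: big1 => v Rv; rewrite -[RHS](j0 v); apply: eq_bigl => e.
  by rewrite -andbA; case: eqP => [->|]; rewrite ?Rv ?andbF.
rewrite (partition_big (fun e => e.2) xpredT)//= big_Z4.
have -> : \sum_(e | is_edge e && R e.1 && (e.2 == 1)) j e = flow_east j (a, b).
  apply: eq_bigl => e; rewrite /R; case: (is_edge e) => //=.
  by case: (e.2 == 1); rewrite /= ?andbT ?andbF// andbC.
have -> : \sum_(e | is_edge e && R e.1 && (e.2 == 3%:R)) j e = - flow_east j (a, b - 1).
  under eq_bigl do rewrite -andbA; rewrite sum_drev -sumrN.
  apply: eq_big => [e|e /andP[h _]]; last exact: aj.
  case h : (is_edge e) => //=; rewrite /R (pos_dhead h).
  case: e {h} => v d /=; case: (pos v) => x y /=.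
  have -> : (d + 2%:R == 3%:R) = (d == 1) by elim/Z4_case: d.
  by have [->|_] := eqVneq d 1; rewrite /= ?andbT ?andbF//; lia.
have -> : \sum_(e | is_edge e && R e.1 && (e.2 == 2%:R)) j e =
    - (\sum_(e | is_edge e && R e.1 && (e.2 == 0)) j e + flow_at j 0 (a, b)).
  under eq_bigl do rewrite -andbA; rewrite sum_drev.
  rewrite (eq_bigr (fun e => - j e)); last by move=> e /andP[h _]; exact: aj.
  rewrite sumrN; congr (- _).
  rewrite (bigID (fun e => pos e.1 == (a, b))) /= addrC; congr (_ + _).
    apply: eq_bigl => e; case h : (is_edge e) => //=; rewrite /R (pos_dhead h).
    case: e {h} => v d /=; case: (pos v) => x y /=.
    have -> : (d + 2%:R == 2%:R) = (d == 0) by elim/Z4_case: d.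
    have [->|_] := eqVneq d 0; rewrite /= ?andbT ?andbF// -pair_eqE /=; lia.
  apply: eq_bigl => e; case h : (is_edge e) => //=; rewrite /R (pos_dhead h).
  case: e {h} => v d /=; case: (pos v) => x y /=.
  have -> : (d + 2%:R == 2%:R) = (d == 0) by elim/Z4_case: d.
  have [->|_] := eqVneq d 0; rewrite /= ?andbT ?andbF// -pair_eqE /=; lia.
by move=> h; apply/eqP; rewrite -subr_eq0 -[X in _ == X]h; apply/eqP; ring.
Qed.

Let flow_at_out j d p : ~~ in_box L p -> flow_at j d p = 0.
Proof.
move=> h; apply: big1 => e /andP[_ /andP[_ /eqP pE]].
by move: h; rewrite -pE pos_in_box.
Qed.

Definition potential j : height L :=
  [ffun f => if f is Some s then flow_east j (corner s) else 0].

(** West of the box the value is the flux through a whole row; it does not change from a row to the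
    next and is 0 below the box. In the other outer positions no edge crosses the half-line. *)
Lemma potential_face_at j p : antisym j -> (forall v, outflow j v = 0) ->
  potential j (face_at L p) = flow_east j p.
Proof.
move=> aj j0.
have [/face_at_in[s -> <-]|h] :=
  boolP ((- L%:Z <= p.1 < L%:Z) && (- L%:Z <= p.2 < L%:Z)); first by rewrite ffunE.
rewrite face_at_out// ffunE; case: p h => a b /= h.
have low x : b < - L%:Z -> flow_east j (x, b) = 0.
  move=> hb; apply: big1 => e /andP[_ /and3P[_ /= /eqP eb _]].
  by move: eb (pos_in_box e.1); case: (pos e.1) => ? ?; rewrite /in_box /=; lia.
have [hb|hb] := ltP b (- L%:Z); first by rewrite low.
have [ha|ha] := leP L%:Z a.
  rewrite /flow_east big1// => e /andP[_ /and3P[_ /= _ ea]].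
  by move: ea (pos_in_box e.1); case: (pos e.1) => ? ?; rewrite /in_box /=; lia.
have [hb'|hb'] := leP L%:Z b.
  rewrite /flow_east big1// => e /andP[ee /and3P[/eqP e1 /= /eqP eb _]].
  by move: eb ee; rewrite is_edgeE e1; case: (pos e.1) => ? ?; rewrite /in_box /=; lia.
have {h}ha' : a < - L%:Z by lia.
have [k bE] : exists k : nat, b = - L%:Z - 1 + k%:Z.
  by exists (absz (b + L%:Z + 1)%R); lia.
rewrite bE {low hb hb' bE}; elim: k => [|k IH].
  rewrite /flow_east big1// => e /andP[_ /and3P[_ /= /eqP eb _]].
  by move: eb (pos_in_box e.1); case: (pos e.1) => ? ?; rewrite /in_box /=; lia.
have := @flow_east_south j a (- L%:Z - 1 + k.+1%:Z) aj j0.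
rewrite flow_at_out; last by rewrite /in_box /=; lia.
rewrite (_ : - L%:Z - 1 + k.+1%:Z - 1 = - L%:Z - 1 + k%:Z); last by lia.
by rewrite -IH subr0 => ->.
Qed.

(** Discrete Poincare lemma. The half-lines of two squares on either side of a vertical edge differ
    by that edge; for a horizontal edge, conservation of the flow in the strip between them gives
    the claim. *)
Lemma grad_potential j e : antisym j -> (forall v, outflow j v = 0) ->
  is_edge e -> grad (potential j) e = j e.
Proof.
move=> aj j0.
have key v (d : 'Z_4) : (d == 0) || (d == 1) -> is_edge (v, d) ->
    grad (potential j) (v, d) = j (v, d).
  move=> hd h; rewrite /grad /left_face /right_face !potential_face_at//=.
  have := flow_atE j d v; rewrite h; case: (pos v) => a b.
  case/orP: hd => /eqP-> <- /=; rewrite -?flow_east_south// -?flow_east_west//.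
    by congr (flow_east _ (_, _) - flow_east _ (_, _)); rewrite /sector /=; lia.
  by congr (flow_east _ (_, _) - flow_east _ (_, _)); rewrite /sector /=; lia.
move=> h; have [/andP[_]|] := boolP (uedge e); first by case: e h => v d h /key; apply.
rewrite -uedge_drev// => /andP[h' hd].
have := key _ _ hd h'; rewrite -/(drev e) aj//.
by rewrite antisym_grad// => /oppr_inj.
Qed.

Lemma height_const_south n (a b : int) :
    (forall b', b' <= b -> n (face_at L (a, b')) = n (face_at L (a, b' - 1))) ->
  n (face_at L (a, b)) = n None.
Proof.
move=> h; have [k] : exists k : nat, b - k%:Z < - L%:Z.
  by exists (absz (b + L%:Z + 1)%R); lia.
elim: k b h => [|k IH] b h hk; first by rewrite face_at_out//=; lia.
by rewrite h// IH//; [move=> b' hb'; rewrite h//; lia|lia].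
Qed.

Lemma height_const_west n (a b : int) :
    (forall a', a' <= a -> n (face_at L (a', b)) = n (face_at L (a' - 1, b))) ->
  n (face_at L (a, b)) = n None.
Proof.
move=> h; have [k] : exists k : nat, a - k%:Z < - L%:Z.
  by exists (absz (a + L%:Z + 1)%R); lia.
elim: k a h => [|k IH] a h hk; first by rewrite face_at_out//=; lia.
by rewrite h// IH//; [move=> b' hb'; rewrite h//; lia|lia].
Qed.

Lemma eq_south n (a b : int) :
  (forall v, pos v = (a, b) -> is_edge (v, 0) -> grad n (v, 0) = 0) ->
  n (face_at L (a, b)) = n (face_at L (a, b - 1)).
Proof.
move=> h; have [/(@pos_onto L)[v vE]|out] := boolP (in_box L (a, b)); last first.
  by rewrite !face_at_out//; move: out; rewrite /in_box /=; lia.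
have lE : (a, b) + sector 0 = (a, b) by congr pair; rewrite /sector /=; lia.
have rE : (a, b) + sector (0 - 1) = (a, b - 1) by congr pair; rewrite /sector /=; lia.
have [ee|ee] := boolP (is_edge (v, 0)).
  have /eqP := h v vE ee.
  by rewrite /grad /left_face /right_face /= vE lE rE subr_eq0 => /eqP.
have := left_face_nedge ee; have := right_face_nedge ee.
by rewrite /left_face /right_face /= vE lE rE => -> ->.
Qed.

Lemma eq_west n (a b : int) :
  (forall v, pos v = (a, b) -> is_edge (v, 1) -> grad n (v, 1) = 0) ->
  n (face_at L (a, b)) = n (face_at L (a - 1, b)).
Proof.
move=> h; have [/(@pos_onto L)[v vE]|out] := boolP (in_box L (a, b)); last first.
  by rewrite !face_at_out//; move: out; rewrite /in_box /=; lia.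
have lE : (a, b) + sector 1 = (a - 1, b) by congr pair; rewrite /sector /=; lia.
have rE : (a, b) + sector (1 - 1) = (a, b) by congr pair; rewrite /sector /=; lia.
have [ee|ee] := boolP (is_edge (v, 1)).
  have /eqP := h v vE ee.
  by rewrite /grad /left_face /right_face /= vE lE rE subr_eq0 => /eqP.
have := left_face_nedge ee; have := right_face_nedge ee.
by rewrite /left_face /right_face /= vE lE rE => -> ->.
Qed.

Lemma grad0_const n : (forall e, uedge e -> grad n e = 0) -> forall f, n f = n None.
Proof.
move=> h [s|//]; rewrite -face_at_corner; case: (corner s) => a b.
apply: height_const_south => b' _; apply: eq_south => v _ ee.
by apply: h; rewrite /uedge ee.
Qed.

Lemma grad_inj n n' f : (forall e, uedge e -> grad n e = grad n' e) ->
  n f = n' f -> n = n'.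
Proof.
move=> h nf; pose D : height L := [ffun g => n g - n' g].
have D0 g : D g = D None.
  apply: grad0_const => e /h; rewrite /grad !ffunE; lia.
apply/ffunP => g; have := D0 g; have := D0 f; rewrite !ffunE nf subrr => <- /eqP.
by rewrite subr_eq0 => /eqP.
Qed.

End Flows.

Lemma esum_fintype (R : realType) (T : finType) (f : T -> \bar R) :
  (forall x, (0 <= f x)%E) -> (\esum_(x in [set: T]) f x = \sum_(x : T) f x)%E.
Proof.
move=> f0; rewrite esum_fset//; last exact: finite_finset.
rewrite fsbig_finite/=; last exact: finite_finset.
apply: perm_big; apply: uniq_perm; rewrite ?finmap.fset_uniq ?index_enum_uniq// => x.
rewrite mem_index_enum in_fset_set; last exact: finite_finset.
by apply/mem_set.
Qed.

Definition symmetric_sum (V : nmodType) (f : int -> V) (N : nat) : V :=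
  \sum_(k < N.*2.+1) f ((k : nat)%:Z - N%:Z).

Lemma symmetric_sumS (V : nmodType) (f : int -> V) (N : nat) :
  symmetric_sum f N.+1 = symmetric_sum f N + (f N.+1%:Z + f (- N.+1%:Z)).
Proof.
transitivity (f (- N.+1%:Z) + symmetric_sum f N + f N.+1%:Z); last first.
  by rewrite addrC addrA [RHS]addrC.
rewrite /symmetric_sum doubleS big_ord_recr big_ord_recl.
congr (f _ + _ + f _); [by rewrite sub0r| |by rewrite /=; lia].
by apply: eq_bigr => i _; congr f; rewrite /= /bump /=; lia.
Qed.

Lemma symmetric_sumN (V : nmodType) (f : int -> V) (N : nat) :
  symmetric_sum (fun m => f (- m)) N = symmetric_sum f N.
Proof.
rewrite /symmetric_sum (reindex_inj rev_ord_inj); apply: eq_bigr => i _ /=.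
congr f; have := ltn_ord i; lia.
Qed.

(** * The Fourier series of the spin density *)

Section Fourier.
Context {R : realType}.
Variable U : int -> R.
Hypothesis sumU : summable_interaction U.
Local Notation W := (boltzmann U).

Definition G_trunc (N : nat) (phi : R) : R :=
  symmetric_sum (fun m => cos (m%:~R * phi) * W m) N.

Lemma symmetric_sum_bounded : exists M, forall N, symmetric_sum W N <= M.
Proof.
have E0 : (0 <= \esum_(m in [set: int]) (expR (- U m))%:E)%E.
  by apply: esum_ge0 => m _; rewrite lee_fin expR_ge0.
exists (fine (\esum_(m in [set: int]) (expR (- U m))%:E)) => N.
rewrite -lee_fin fineK ?ge0_fin_numE// /symmetric_sum -sumEFin.
rewrite -(@esum_fintype _ _ (fun k : 'I_(N.*2.+1) => (W ((k : nat)%:Z - N%:Z))%:E));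
  last by move=> k; rewrite lee_fin boltzmann_ge0.
apply: (@le_esum_inj _ _ _ _ _ (fun k : 'I_(N.*2.+1) => (k : nat)%:Z - N%:Z)
  (fun m => (W m)%:E)) => // [x y _ _ /addIr[/val_inj]//|m].
by rewrite lee_fin boltzmann_ge0.
Qed.

Let S_le N M : (N <= M)%N -> symmetric_sum W N <= symmetric_sum W M.
Proof.
elim: M => [|M IH]; first by rewrite leqn0 => /eqP->.
rewrite leq_eqVlt ltnS => /predU1P[->//|/IH/le_trans]; apply.
by rewrite symmetric_sumS lerDl addr_ge0 ?boltzmann_ge0.
Qed.

Let S_cvg : cvgn (symmetric_sum W).
Proof.
apply: nondecreasing_is_cvgn => [N M|]; first exact: S_le.
have [M hM] := symmetric_sum_bounded; by exists M => _ [N _ <-].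
Qed.

Let G_dist phi N M : (N <= M)%N ->
  `|G_trunc M phi - G_trunc N phi| <= symmetric_sum W M - symmetric_sum W N.
Proof.
elim: M => [|M IH]; first by rewrite leqn0 => /eqP->; rewrite !subrr normr0.
rewrite leq_eqVlt ltnS => /predU1P[->|NM]; first by rewrite !subrr normr0.
rewrite /G_trunc !symmetric_sumS -/(G_trunc M phi) -/(G_trunc N phi).
have h m : `|cos (m%:~R * phi) * W m| <= W m.
  rewrite normrM (ger0_norm (boltzmann_ge0 _ _)) ler_piMl ?boltzmann_ge0//.
  by rewrite ler_norml cos_geN1 cos_le1.
have E (a b c : R) : a + b - c = (a - c) + b by ring.
rewrite !E (le_trans (ler_normD _ _))// lerD ?IH//.
by rewrite (le_trans (ler_normD _ _))// lerD.
Qed.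

(** Weierstrass test: the tail of the cosine series is dominated by that of the series of [W], which
    does not depend on [phi]. *)
Lemma G_trunc_approx (eps : R) : 0 < eps ->
  exists N0, forall N, (N0 <= N)%N -> forall phi, `|G_ U phi - G_trunc N phi| <= eps.
Proof.
move=> eps0; have := S_cvg => /cvgrPdist_le /(_ _ eps0)[N0 _ hN0].
set S := limn (symmetric_sum W) in hN0.
have SS M : symmetric_sum W M <= S by apply: nondecreasing_cvgn_le => // *; exact: S_le.
exists N0 => N NN0 phi.
have hN : S - symmetric_sum W N <= eps.
  by have := hN0 N NN0; rewrite /= ger0_norm// subr_ge0.
have Gc : cvgn (fun N => G_trunc N phi).
  have E (f : int -> R) M : symmetric_sum f M = f 0 +
      series (fun n => f n.+1%:Z + f (- n.+1%:Z)) M.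
    elim: M => [|M IH]; last by rewrite symmetric_sumS IH /series /= big_nat_recr//= [RHS]addrA.
    by rewrite /symmetric_sum /series /= big_geq// addr0 big_ord1 subrr.
  rewrite /G_trunc; under eq_fun do rewrite E.
  apply: is_cvgD; first exact: is_cvg_cst.
  apply: normed_cvg.
  apply: (@series_le_cvg _ _ (fun n => W n.+1%:Z + W (- n.+1%:Z))) => [n|n|n|] //.
  - exact: normr_ge0.
  - by rewrite addr_ge0 ?boltzmann_ge0.
  - rewrite /=; apply: (le_trans (ler_normD _ _)); apply: lerD;
      rewrite normrM (ger0_norm (boltzmann_ge0 _ _)) ler_piMl ?boltzmann_ge0//;
      by rewrite ler_norml cos_geN1 cos_le1.
  - rewrite (_ : series _ = (fun M => symmetric_sum W M - W 0)).
      by apply: is_cvgB => //; exact: is_cvg_cst.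
    by apply/funext => M; rewrite E addrC addKr.
have : G_ U phi = limn (fun N => G_trunc N phi) by [].
move=> ->; rewrite -normrN opprB.
have hc : (fun M => `|G_trunc N phi - G_trunc M phi|) @ \oo -->
    `|G_trunc N phi - limn (fun N => G_trunc N phi)|.
  by apply: cvg_norm; apply: cvgB => //; exact: cvg_cst.
apply: (cvgr_to_le hc); exists N => // M /= NM.
rewrite distrC (le_trans (G_dist _ NM))// (le_trans _ hN)//.
by rewrite lerD2r.
Qed.

Lemma G_trunc_bounded : exists2 M, 0 <= M & forall N phi, `|G_trunc N phi| <= M.
Proof.
have [M hM] := symmetric_sum_bounded; exists M => [|N phi].
  by apply: le_trans (hM 0%N); rewrite /symmetric_sum sumr_ge0// => *; exact: boltzmann_ge0.
apply: le_trans (hM N); apply: le_trans (ler_norm_sum _ _ _) _.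
apply: ler_sum => k _; rewrite normrM (ger0_norm (boltzmann_ge0 _ _)) ler_piMl ?boltzmann_ge0//.
by rewrite ler_norml cos_geN1 cos_le1.
Qed.

End Fourier.

Lemma Rintegral_sum d (T : measurableType d) (R : realType)
    (mu : {measure set T -> \bar R}) (D : set T) (I : Type) (r : seq I)
    (f : I -> T -> R) :
    measurable D -> (forall i, mu.-integrable D (EFin \o f i)) ->
  \int[mu]_(x in D) (\sum_(i <- r) f i x) = \sum_(i <- r) \int[mu]_(x in D) f i x.
Proof.
move=> mD fi; elim: r => [|i r IH].
  rewrite big_nil; under eq_Rintegral do rewrite big_nil.
  by rewrite Rintegral_cst// mul0r.
rewrite big_cons -IH; under eq_Rintegral do rewrite big_cons.
apply: RintegralD => //.
rewrite (_ : _ \o _ = (fun x => \sum_(i <- r) (EFin \o f i) x)%E).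
  by apply: integrable_sum => //.
by apply/funext => x /=; rewrite sumEFin.
Qed.

(** * Non-negativity of the spin density by Fejer summation *)

Section Positivity.
Context {R : realType}.
Variable U : int -> R.
Hypothesis gaussU : annealed_gaussian U.
Hypothesis sumU : summable_interaction U.
Local Notation W := (boltzmann U).

(* Fejer: up to a factor N, the left-hand side is a Cesaro mean and the
   right-hand side a Toeplitz form. *)
Lemma sum_symmetric_sum (f : int -> R) N :
  \sum_(k < N) symmetric_sum f k = \sum_(i < N) \sum_(j < N) f ((i : nat)%:Z - (j : nat)%:Z).
Proof.
elim: N => [|N IH]; first by rewrite !big_ord0.
have S M : symmetric_sum f M = f 0 + \sum_(i < M) (f (i.+1)%:Z + f (- (i.+1)%:Z)).
  elim: M => [|M IHM]; first by rewrite big_ord0 addr0 /symmetric_sum big_ord1 subrr.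
  rewrite symmetric_sumS IHM [in RHS]big_ord_recr; exact: esym (addrA _ _ _).
rewrite big_ord_recr /= IH S [RHS]big_ord_recr /=.
under [X in _ = X + _]eq_bigr do rewrite big_ord_recr /=.
rewrite [X in _ = X + _]big_split /= -addrA; congr (_ + _).
rewrite [X in _ = _ + X]big_ord_recr subrr; apply: etrans (esym (addrA _ _ _)).
rewrite [LHS]addrC; congr (_ + _).
rewrite big_split [LHS]addrC; congr (_ + _).
  rewrite (reindex_inj rev_ord_inj) /=; apply: eq_bigr => i _; congr f.
  have := ltn_ord i; lia.
rewrite (reindex_inj rev_ord_inj) /=; apply: eq_bigr => i _; congr f.
have := ltn_ord i; lia.
Qed.

Let cvg_sum (I : Type) (r : seq I) (f : I -> nat -> R) (a : I -> R) :
    (forall i, f i @ \oo --> a i) ->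
  (fun k => \sum_(i <- r) f i k) @ \oo --> \sum_(i <- r) a i.
Proof.
move=> fa; elim: r => [|i r IH].
  by under eq_cvg do rewrite big_nil; rewrite big_nil; exact: cvg_cst.
by under eq_cvg do rewrite big_cons; rewrite big_cons; apply: cvgD.
Qed.

(* Each term of the power series of expR contributes a square. *)
Lemma expR_kernel_ge0 (I : finType) (u z : I -> R) (l : R) : 0 <= l ->
  0 <= \sum_i \sum_j u i * u j * expR (l * z i * z j).
Proof.
move=> l0.
pose F (k : nat) := \sum_i \sum_j u i * u j * series (exp_coeff (l * z i * z j)) k.
have F0 k : 0 <= F k.
  have -> : F k = \sum_(0 <= m < k) l ^+ m / m`!%:R * (\sum_i u i * z i ^+ m) ^+ 2.
    rewrite /F /series /=.
    under eq_bigr do under eq_bigr do rewrite mulr_sumr.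
    under eq_bigr do rewrite exchange_big /=.
    rewrite exchange_big /=; apply: eq_bigr => m _.
    rewrite expr2 big_distrlr /= mulr_sumr; apply: eq_bigr => i _.
    rewrite mulr_sumr; apply: eq_bigr => j _.
    by rewrite /exp_coeff /= !exprMn; ring.
  by apply: sumr_ge0 => m _; rewrite mulr_ge0 ?sqr_ge0 ?divr_ge0 ?exprn_ge0 ?ler0n.
have Fc : F @ \oo --> \sum_i \sum_j u i * u j * expR (l * z i * z j).
  apply: cvg_sum => i; apply: cvg_sum => j; apply: cvgM; first exact: cvg_cst.
  exact: is_cvg_series_exp_coeff.
by apply: (cvgr_to_ge Fc); exact: nearW.
Qed.

(** Under the mixture of Gaussians, exp(-l(i-j)^2/2) is a product of a function of i, a function of
    j and exp(lij), while cos((i-j)phi) splits into a cosine part and a sine part. Both parts are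
    forms covered by [expR_kernel_ge0]. *)
Lemma sum_G_trunc_ge0 N phi : 0 <= \sum_(k < N) G_trunc U k phi.
Proof.
rewrite sum_symmetric_sum pair_bigA /=; case: gaussU => mu muU.
pose D : set R := `[0%R, +oo[%classic; pose E (q : int) (l : R) : R := expR (- (l * q%:~R ^+ 2 / 2)).
have mD : measurable D by exact: measurable_itv.
have mE q : measurable_fun D (E q).
  apply: measurable_funTS; apply: measurableT_comp; first exact: measurable_expR.
  apply: measurable_funN; apply: measurable_funM => //; exact: measurable_funM.
have WE q : W q = \int[mu]_(l in D) E q l by rewrite /Rintegral -muU.
have iE q : mu.-integrable D (EFin \o E q).
  apply/integrableP; split; first by apply/measurable_EFinP; exact: mE.
  under eq_integral do rewrite /= ger0_norm ?expR_ge0//.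
  by rewrite -muU ltry.
pose f (p : 'I_N * 'I_N) (l : R) : R := cos (((p.1 : nat)%:Z - (p.2 : nat)%:Z)%:~R * phi) *
  E ((p.1 : nat)%:Z - (p.2 : nat)%:Z) l.
have -> : \sum_(p : 'I_N * 'I_N) cos (((p.1 : nat)%:Z - (p.2 : nat)%:Z)%:~R * phi) *
    W ((p.1 : nat)%:Z - (p.2 : nat)%:Z) = \int[mu]_(l in D) \sum_(p : 'I_N * 'I_N) f p l.
  rewrite Rintegral_sum//; last first.
    by move=> p; apply: (@integrableZl _ _ _ mu D mD _ _ (iE _)).
  by apply: eq_bigr => p _; rewrite WE /f RintegralZl.
apply: Rintegral_ge0 => l; rewrite /D /= in_itv /= andbT => l0.
pose u (a : R -> R) (i : 'I_N) : R := a ((i : nat)%:R * phi) * expR (- (l * (i : nat)%:R ^+ 2 / 2)).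
have -> : \sum_(p : 'I_N * 'I_N) f p l =
    \sum_i \sum_j u cos i * u cos j * expR (l * (i : nat)%:R * (j : nat)%:R) +
    \sum_i \sum_j u sin i * u sin j * expR (l * (i : nat)%:R * (j : nat)%:R).
  rewrite !pair_bigA /= -big_split /=; apply: eq_bigr => -[i j] _.
  rewrite /f /u /E /= rmorphB /= mulrBl cosB.
  have -> : - (l * ((i : nat)%:R - (j : nat)%:R) ^+ 2 / 2) =
      - (l * (i : nat)%:R ^+ 2 / 2) + - (l * (j : nat)%:R ^+ 2 / 2) + l * (i : nat)%:R * (j : nat)%:R :> R.
    lra.
  rewrite !expRD; ring.
by rewrite addr_ge0// expR_kernel_ge0.
Qed.

(** Single partial sums need not be non-negative, but their Cesaro means are, and these have the
    same limit. *)
Lemma G_ge0 phi : 0 <= G_ U phi.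
Proof.
have Gc : (fun N => G_trunc U N phi) @ \oo --> G_ U phi.
  apply/cvgrPdist_le => e e0; have [N0 h] := G_trunc_approx sumU e0.
  by exists N0 => // N /h.
apply: (cvgr_to_ge (cesaro Gc)); apply: nearW => N.
rewrite /arithmetic_mean /= mulr_ge0// ?invr_ge0// /series /= big_mkord.
exact: sum_G_trunc_ge0.
Qed.

End Positivity.

(** * Integrals over the torus *)

Section TrigonometricIntegrals.
Context {R : realType}.
Local Notation mu := (@lebesgue_measure R).
Local Notation circle := (`[- pi, pi[%classic : set R).

Let mcircle : measurable circle.
Proof. exact: measurable_itv. Qed.

Let mu_circle : mu circle = (2 * pi)%:E.
Proof.
rewrite lebesgue_measure_itv /= lte_fin ifT; last by have := pi_gt0 R; lra.
by rewrite -EFinB; congr EFin; ring.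
Qed.

Let Rintegral_circle_cst (r : R) : \int[mu]_(t in circle) r = r * (2 * pi).
Proof.
rewrite Rintegral_cst//; congr (_ * _).
exact: (congr1 fine mu_circle).
Qed.

Lemma continuous_integrable_circle (f : R -> R) :
  continuous f -> mu.-integrable circle (EFin \o f).
Proof.
move=> cf.
have h : mu.-integrable (`[- pi, pi]%classic : set R) (EFin \o f).
  apply: continuous_compact_integrable; first exact: segment_compact.
  exact: continuous_subspaceT.
apply: integrableS h => //.
by apply: subset_itvl; rewrite bnd_simp.
Qed.

Let sin_period_int (x : R) (k : int) : sin (x + (pi *+ 2) *~ k) = sin x.
Proof.
case: k => n; first by rewrite -pmulrn (periodicn (@sinD2pi R)).
rewrite NegzE mulrNz -pmulrn -[in RHS](subrK ((pi *+ 2) *+ n.+1) x).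
by rewrite (periodicn (@sinD2pi R)).
Qed.

Lemma continuous_cos_affine (a b : R) : continuous (fun t => cos (a * t + b)).
Proof.
move=> t; apply: (@continuous_comp _ _ _ (fun t => a * t + b) cos).
  by apply: cvgD; [apply: cvgM; [exact: cvg_cst|exact: cvg_id]|exact: cvg_cst].
exact: continuous_cos.
Qed.

Lemma Rintegral_circle_cos (k : int) (A : R) :
  \int[mu]_(t in circle) cos (k%:~R * t + A) =
  if k == 0 then 2 * pi * cos A else 0.
Proof.
have [->|k0] := eqVneq k 0.
  under eq_Rintegral do rewrite mul0r add0r.
  by rewrite Rintegral_circle_cst mulrC.
have kR : k%:~R != 0 :> R by rewrite intr_eq0.
rewrite Rintegral_itv_bndo_bndc; last first.
  by apply: continuous_integrable_circle; exact: continuous_cos_affine.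
pose F (t : R) := k%:~R^-1 * sin (k%:~R * t + A).
have dF (t : R) : is_derive t 1 F (cos (k%:~R * t + A)).
  have h : is_derive t 1 (fun t : R => k%:~R * t + A) (k%:~R).
    by apply: is_derive_eq; rewrite addr0 /GRing.scale /= mulr1.
  have h2 := @is_derive1_comp _ sin (fun t : R => k%:~R * t + A) t _ _
     (is_derive_sin (k%:~R * t + A)) h.
  apply: is_derive_eq; rewrite /GRing.scale /=.
  by rewrite mulrC -mulrA mulfV// mulr1.
rewrite /Rintegral (@continuous_FTC2 _ _ F)//=.
- have -> : F pi = F (- pi).
    rewrite /F; congr (_ * _); have -> : k%:~R * pi + A = (k%:~R * - pi + A) + (pi *+ 2) *~ k.
      by rewrite -mulrzl mulr2n; ring.
    exact: sin_period_int.
  by rewrite subrr.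
- by have := pi_gt0 R; lra.
- exact/continuous_subspaceT/continuous_cos_affine.
- have cF : continuous F.
    by move=> t; apply: differentiable_continuous; apply/derivable1_diffP; have [] := dF t.
  split.
  + by move=> t _; have [] := dF t.
  + by apply: cvg_at_right_filter; exact: cF.
  + by apply: cvg_at_left_filter; exact: cF.
- by move=> t _; rewrite derive1E; have [_ ->] := dF t.
Qed.

Context {V : finType}.
Implicit Types (F : (V -> R) -> R) (theta : V -> R).

Definition update theta x t : V -> R := fun y => if y == x then t else theta y.

Definition trig_poly (I : finType) (c : I -> R) (k : I -> V -> int) theta : R :=
  \sum_i c i * cos (\sum_v (k i v)%:~R * theta v).

Lemma trig_poly_update (I : finType) (c : I -> R) (k : I -> V -> int) theta x t :
  trig_poly c k (update theta x t) =
  \sum_i c i * cos ((k i x)%:~R * t + \sum_(v | v != x) (k i v)%:~R * theta v).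
Proof.
apply: eq_bigr => i _; congr (_ * cos _); rewrite (bigD1 x)//= /update eqxx.
by congr (_ + _); apply: eq_bigr => v /negbTE ->.
Qed.

Lemma continuous_trig_poly_update (I : finType) (c : I -> R) (k : I -> V -> int) theta x :
  continuous (fun t => trig_poly c k (update theta x t)).
Proof.
pose f i (t : R) := c i * cos ((k i x)%:~R * t + \sum_(v | v != x) (k i v)%:~R * theta v).
have cf i : continuous (f i).
  by move=> t; apply: cvgM; [exact: cvg_cst|exact: continuous_cos_affine].
have h (r : seq I) : continuous (fun t : R => \sum_(i <- r) f i t).
  elim: r => [|i r IH] t.
    rewrite (_ : (fun _ => _) = cst 0); last by apply/funext => u; rewrite big_nil.
    exact: cvg_cst.
  rewrite (_ : (fun _ => _) = (fun u => f i u + \sum_(i <- r) f i u)); last first.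
    by apply/funext => u; rewrite big_cons.
  by apply: cvgD; [exact: cf|exact: IH].
rewrite (_ : (fun _ => _) = (fun t : R => \sum_i f i t)); first exact: h.
by apply/funext => t; rewrite trig_poly_update.
Qed.

Lemma Rintegral_trig_poly (I : finType) (c : I -> R) (k : I -> V -> int) theta x :
  \int[mu]_(t in circle) trig_poly c k (update theta x t) =
  trig_poly (fun i => if k i x == 0 then 2 * pi * c i else 0) k theta.
Proof.
under eq_Rintegral do rewrite trig_poly_update.
have int i : mu.-integrable circle (EFin \o
    (fun t : R => c i * cos ((k i x)%:~R * t + \sum_(v | v != x) (k i v)%:~R * theta v))).
  apply: continuous_integrable_circle => t.
  by apply: cvgM; [exact: cvg_cst|exact: continuous_cos_affine].
rewrite Rintegral_sum//; apply: eq_bigr => i _.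
rewrite RintegralZl//; last first.
  by apply: continuous_integrable_circle; exact: continuous_cos_affine.
rewrite Rintegral_circle_cos; case: eqP => [kx|]; last by rewrite mulr0 mul0r.
rewrite [in RHS](bigD1 x)//= kx mul0r add0r; ring.
Qed.

Fixpoint torus_integral (s : seq V) F theta : R :=
  if s is x :: s' then
    \int[mu]_(t in circle) torus_integral s' F (update theta x t)
  else F theta.

Lemma torus_integral_trig_poly (I : finType) (c : I -> R) (k : I -> V -> int) s theta :
  torus_integral s (trig_poly c k) theta =
  trig_poly (fun i => if all (fun x => k i x == 0) s then (2 * pi) ^+ size s * c i else 0)
    k theta.
Proof.
elim: s theta => [|x s IH] theta /=.
  by apply: eq_bigr => i _; rewrite mul1r.
under eq_Rintegral do rewrite IH.
rewrite Rintegral_trig_poly; apply: eq_bigr => i _; congr (_ * _).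
case: (k i x == 0) => //=; case: ifP => _; last by rewrite mulr0.
by rewrite exprS; ring.
Qed.

(** Uniformity in all angles at once survives each of the iterated integrals, and it also yields
    integrability of the integrands. *)
Definition uniform_limit (T : nat -> (V -> R) -> R) F :=
  forall eps, 0 < eps ->
    exists N0, forall N, (N0 <= N)%N -> forall theta, `|F theta - T N theta| <= eps.

Definition is_trig_poly F :=
  exists (I : finType) (c : I -> R) (k : I -> V -> int), F = trig_poly c k.

Lemma is_trig_poly_torus_integral s F :
  is_trig_poly F -> is_trig_poly (torus_integral s F).
Proof.
move=> [I [c [k ->]]]; exists I; eexists; exists k; apply/funext => theta.
exact: torus_integral_trig_poly.
Qed.

(** Measurability comes from the pointwise limit, integrability from the continuous function [T N0],
    which differs from [F] by at most 1 on an interval of finite length. *)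
Lemma uniform_limit_integrable (T : nat -> (V -> R) -> R) F x theta :
    (forall N, is_trig_poly (T N)) -> uniform_limit T F ->
  mu.-integrable circle (EFin \o (fun t => F (update theta x t))).
Proof.
move=> Ttrig TF.
have cT N : continuous (fun t => T N (update theta x t)).
  by have [I [c [k ->]]] := Ttrig N; exact: continuous_trig_poly_update.
have iT N := continuous_integrable_circle (cT N).
have [N0 hN0] := TF 1 ltr01.
have mF : measurable_fun circle (fun t => F (update theta x t)).
  apply: (@measurable_fun_cvg _ _ _ _
    (fun N t => T N (update theta x t))).
    move=> N; apply: subspace_continuous_measurable_fun => //; exact: continuous_subspaceT.
  move=> t _; apply/cvgrPdist_le => e /TF[N1 hN1]; exists N1 => // N N1N.
  exact: hN1.
have mD : measurable_fun circle (fun t => F (update theta x t) - T N0 (update theta x t)).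
  by apply: measurable_funB => //; apply: measurable_realfun.subspace_continuous_measurable_fun => //; exact: continuous_subspaceT.
have iD : mu.-integrable circle (EFin \o
    (fun t => F (update theta x t) - T N0 (update theta x t))).
  apply: measurable_bounded_integrable => //.
    by move: (ltry (2 * pi : R)); rewrite -mu_circle.
  exists 1; split => // M M1 t _ /=; apply: le_trans (ltW M1); exact: hN0.
rewrite (_ : EFin \o _ = (EFin \o (fun t => F (update theta x t) - T N0 (update theta x t)))
   \+ (EFin \o (fun t => T N0 (update theta x t)))).
  exact: integrableD.
by apply/funext => t /=; rewrite -EFinD subrK.
Qed.

Lemma uniform_limit_integral (T : nat -> (V -> R) -> R) F x :
    (forall N, is_trig_poly (T N)) -> uniform_limit T F ->
  uniform_limit (fun N theta => \int[mu]_(t in circle) T N (update theta x t))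
    (fun theta => \int[mu]_(t in circle) F (update theta x t)).
Proof.
move=> Ttrig TF.
have cT N theta : continuous (fun t => T N (update theta x t)).
  by have [I [c [k ->]]] := Ttrig N; exact: continuous_trig_poly_update.
have iT N theta := continuous_integrable_circle (@cT N theta).
have iF theta := uniform_limit_integrable x theta Ttrig TF.
move=> eps eps0; have e0 : 0 < eps / (2 * pi) by rewrite divr_gt0// mulr_gt0// pi_gt0.
have [N0 hN0] := TF _ e0; exists N0 => N NN0 theta.
rewrite -RintegralB//; apply: le_trans (le_normr_Rintegral _ _) _ => //.
  rewrite (_ : EFin \o _ = (EFin \o (fun t => F (update theta x t)))
     \- (EFin \o (fun t => T N (update theta x t))))%E//.
  exact: integrableB.
apply: (@le_trans _ _ (\int[mu]_(t in circle) (eps / (2 * pi)))); last first.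
  by rewrite Rintegral_circle_cst divfK// gt_eqF// mulr_gt0// pi_gt0.
apply: le_Rintegral => //.
- rewrite (_ : EFin \o _ = (abse \o ((EFin \o (fun t => F (update theta x t)))
     \- (EFin \o (fun t => T N (update theta x t)))))%E)//.
  by apply: integrable_abse; exact: integrableB.
- by apply: continuous_integrable_circle => t; exact: cvg_cst.
- by move=> t _; exact: hN0.
Qed.

Lemma uniform_limit_torus_integral (T : nat -> (V -> R) -> R) F s :
    (forall N, is_trig_poly (T N)) -> uniform_limit T F ->
  uniform_limit (fun N => torus_integral s (T N)) (torus_integral s F).
Proof.
move=> Ttrig TF; elim: s => //= x s IH.
apply: (@uniform_limit_integral (fun N => torus_integral s (T N))) => // N.
exact: is_trig_poly_torus_integral.
Qed.

Lemma le_torus_integral (T T' : nat -> (V -> R) -> R) F F' s theta :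
    (forall N, is_trig_poly (T N)) -> uniform_limit T F ->
    (forall N, is_trig_poly (T' N)) -> uniform_limit T' F' ->
    (forall theta, F theta <= F' theta) ->
  torus_integral s F theta <= torus_integral s F' theta.
Proof.
move=> tT TF tT' TF' FF'; elim: s theta => //= x s IH theta.
apply: le_Rintegral => //.
- apply: (uniform_limit_integrable _ _ _ (uniform_limit_torus_integral s tT TF)) => N.
  exact: is_trig_poly_torus_integral.
- apply: (uniform_limit_integrable _ _ _ (uniform_limit_torus_integral s tT' TF')) => N.
  exact: is_trig_poly_torus_integral.
Qed.

End TrigonometricIntegrals.

(** * Current representation of the spin model *)

Section SpinDuality.
Context {R : realType}.
Variables (U : int -> R) (L : nat).
Hypothesis gaussU : annealed_gaussian U.
Hypothesis sumU : summable_interaction U.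
Local Notation W := (boltzmann U).

Definition edge : finType := {e : dart L | e \in @uedge L}.

Lemma big_edge (T : Type) (idx : T) (op : Monoid.com_law idx) (F : dart L -> T) :
  \big[op/idx]_(e | uedge e) F e = \big[op/idx]_(e : edge) F (val e).
Proof. by rewrite -(big_sub (@uedge L) F). Qed.

Definition current (N : nat) : finType := {ffun edge -> 'I_N.*2.+1}.

Definition cval N (m : current N) (e : edge) : int := (m e : nat)%:Z - N%:Z.

Definition divergence (m : edge -> int) (v : vertex L) : int :=
  \sum_e m e * (((val e).1 == v)%:Z - (dhead (val e) == v)%:Z).

Definition current_weight (m : edge -> int) : R := \prod_e W (m e).

(** A product of cosine series expands directly only in exponential form. Since [W] is even, the
    exponential series are real, and taking real parts at the end recovers cosines. *)
Let cis (x : R) : R[i] := (cos x +i* sin x)%C.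

Let cisD : {morph cis : x y / x + y >-> x * y}.
Proof.
move=> x y; rewrite /cis cosD sinD; congr Complex.
by rewrite addrC mulrC [sin x * _]mulrC.
Qed.

Let cis0 : cis 0 = 1. Proof. by rewrite /cis cos0 sin0. Qed.

Let prod_cis (f : edge -> R) : \prod_e cis (f e) = cis (\sum_e f e).
Proof. by rewrite (big_morph cis cisD cis0). Qed.

Let rcE (x : R) (z : R[i]) : (x%:C * z)%C = (x * complex.Re z +i* (x * complex.Im z))%C.
Proof. by case: z => a b; congr Complex => /=; rewrite mul0r ?subr0 ?addr0. Qed.

Let G_truncE N phi : (G_trunc U N phi)%:C%C =
  \sum_(k < N.*2.+1) (W ((k : nat)%:Z - N%:Z))%:C%C * cis (((k : nat)%:Z - N%:Z)%:~R * phi).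
Proof.
apply/eqP; rewrite eq_complex !raddf_sum /=; apply/andP; split; apply/eqP.
  by apply: eq_bigr => k _; rewrite mul0r subr0 mulrC.
pose f (m : int) : R := W m * sin (m%:~R * phi).
transitivity (symmetric_sum f N); last first.
  by apply: eq_bigr => k _; rewrite mul0r addr0.
have : symmetric_sum f N = - symmetric_sum f N.
  rewrite -[LHS]symmetric_sumN /symmetric_sum -sumrN; apply: eq_bigr => k _.
  by rewrite /f boltzmannN// rmorphN /= mulNr sinN mulrN.
by rewrite big1//; lra.
Qed.

Let prod_G_trunc N (phi : edge -> R) :
  \prod_e G_trunc U N (phi e) =
  \sum_(m : current N) current_weight (cval m) * cos (\sum_e (cval m e)%:~R * phi e).
Proof.
have : (\prod_e G_trunc U N (phi e))%:C%C =
    \sum_(m : current N) (current_weight (cval m))%:C%C * cis (\sum_e (cval m e)%:~R * phi e).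
  have -> : (\prod_e G_trunc U N (phi e))%:C%C = \prod_e (G_trunc U N (phi e))%:C%C.
    exact: rmorph_prod.
  under eq_bigr do rewrite G_truncE.
  rewrite bigA_distr_bigA /=; apply: eq_bigr => m _.
  by rewrite big_split /= prod_cis; congr (_ * _); rewrite -rmorph_prod.
move=> /(congr1 (@complex.Re R)) /= ->; rewrite raddf_sum; apply: eq_bigr => m _.
by rewrite rcE.
Qed.

Definition density_trunc N (theta : vertex L -> R) : R :=
  \prod_(e : edge) G_trunc U N (theta (val e).1 - theta (dhead (val e))).

Let sum_edge_vertex N (m : current N) (theta : vertex L -> R) :
  \sum_e (cval m e)%:~R * (theta (val e).1 - theta (dhead (val e))) =
  \sum_v (divergence (cval m) v)%:~R * theta v.
Proof.
have h (a : vertex L) : theta a = \sum_v (a == v)%:R * theta v.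
  rewrite (bigD1 a)//= eqxx mul1r big1 ?addr0// => v va.
  by rewrite eq_sym (negbTE va) mul0r.
under eq_bigr => e _ do rewrite (h (val e).1) (h (dhead (val e))) -sumrB mulr_sumr.
rewrite exchange_big; apply: eq_bigr => v _ /=.
rewrite /divergence rmorph_sum mulr_suml; apply: eq_bigr => e _.
have E (b c : bool) : (b%:Z - c%:Z)%:~R = b%:R - c%:R :> R by rewrite rmorphB.
by rewrite -mulrBl mulrA; congr (_ * _); rewrite [RHS]intrM E.
Qed.

Variables x y : vertex L.

Let src (b : bool) (v : vertex L) : int :=
  if b then (v == x)%:Z - (v == y)%:Z else (v == y)%:Z - (v == x)%:Z.

Let cos_src b (theta : vertex L -> R) :
  \sum_v (src b v)%:~R * theta v =
  if b then theta x - theta y else theta y - theta x.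
Proof.
have h (a : vertex L) : theta a = \sum_v (v == a)%:R * theta v.
  rewrite (bigD1 a)//= eqxx mul1r big1 ?addr0// => v va.
  by rewrite (negbTE va) mul0r.
case: b; rewrite /src (h x) (h y) -sumrB; apply: eq_bigr => v _;
  by rewrite rmorphB /= mulrBl.
Qed.

(** The flag chooses the sign in cos S cos D = (cos(S + D) + cos(S - D)) / 2, where D is the angle
    difference between [x] and [y]; hence the factor 1/2 on the weights below. *)
Let freq N (mb : current N * bool) (v : vertex L) : int :=
  divergence (cval mb.1) v + src mb.2 v.

Let trunc_trig_poly N theta :
  cos (theta x - theta y) * density_trunc N theta =
  trig_poly (fun mb : current N * bool => current_weight (cval mb.1) / 2) (@freq N) theta.
Proof.
rewrite /density_trunc prod_G_trunc mulr_sumr /trig_poly.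
rewrite -(pair_bigA _ (fun m b => current_weight (cval m) / 2 *
   cos (\sum_v (freq (m, b) v)%:~R * theta v))) /=.
apply: eq_bigr => m _; rewrite sum_edge_vertex big_bool /= /freq /=.
set S := \sum_v _ * _.
have h b : \sum_v (divergence (cval m) v + src b v)%:~R * theta v =
   S + if b then theta x - theta y else theta y - theta x.
  rewrite -cos_src /S -big_split /=; apply: eq_bigr => v _.
  by rewrite rmorphD mulrDl.
have := h true; have := h false; rewrite /src => -> ->.
rewrite -[theta y - theta x]opprB [cos (S - _)]cosB [cos (S + _)]cosD; lra.
Qed.

Definition sourced_sum N : R :=
  \sum_(m : current N | [forall v, divergence (cval m) v == (v == x)%:Z - (v == y)%:Z])
    current_weight (cval m).

Let cflip N (m : current N) : current N := [ffun e => rev_ord (m e)].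

Let cval_flip N (m : current N) e : cval (cflip m) e = - cval m e.
Proof. rewrite /cval ffunE; case: (m e) => k hk /=; lia. Qed.

(** Only currents whose divergence cancels the source term survive. Reversing a current exchanges
    the two signs of the source and preserves weights, so the two halves add up to a single sum. *)
Let torus_integral_trunc N :
  torus_integral (enum (vertex L))
    (fun theta => cos (theta x - theta y) * density_trunc N theta) (fun=> 0) =
  (2 * pi) ^+ #|vertex L| * sourced_sum N.
Proof.
under [X in torus_integral _ X _]funext do rewrite trunc_trig_poly.
rewrite torus_integral_trig_poly /trig_poly -cardE.
rewrite -(pair_bigA _ (fun m b => (if all (fun v => freq (m, b) v == 0) (enum (vertex L))
   then (2 * pi) ^+ #|vertex L| * (current_weight (cval m) / 2) else 0) *
   cos (\sum_v (freq (m, b) v)%:~R * 0))) /=.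
have allE N' (mb : current N' * bool) : all (fun v => freq mb v == 0) (enum (vertex L)) =
    [forall v, divergence (cval mb.1) v == - src mb.2 v].
  apply/allP/forallP => h v; first by rewrite -addr_eq0; apply: h; rewrite mem_enum.
  by move=> _; rewrite addr_eq0.
have cz (m : current N) b : cos (\sum_v (freq (m, b) v)%:~R * 0 : R) = 1.
  by rewrite big1 ?cos0// => v _; rewrite mulr0.
under eq_bigr do rewrite big_bool /= !cz !mulr1 !allE /=.
rewrite big_split /= -!big_mkcond /=.
have half : \sum_(m : current N | [forall v, divergence (cval m) v == - ((v == x)%:Z - (v == y)%:Z)])
    (2 * pi) ^+ #|vertex L| * (current_weight (cval m) / 2)
  = \sum_(m : current N | [forall v, divergence (cval m) v == - ((v == y)%:Z - (v == x)%:Z)])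
    (2 * pi) ^+ #|vertex L| * (current_weight (cval m) / 2).
  rewrite (reindex_inj (h := @cflip N)); last first.
    by move=> a b /ffunP ab; apply/ffunP => e; have := ab e; rewrite !ffunE => /rev_ord_inj.
  apply: eq_big => [m|m _].
    apply: eq_forallb => v; rewrite /divergence.
    under eq_bigr do rewrite cval_flip mulNr.
    by rewrite sumrN eqr_opp opprB.
  congr (_ * (_ / _)); apply: eq_bigr => e _; by rewrite cval_flip boltzmannN.
rewrite half -big_split /= /sourced_sum mulr_sumr.
apply: eq_big => [m|m _]; first by apply: eq_forallb => v; rewrite opprB.
lra.
Qed.

Let prod_approx (r : seq edge) :
  uniform_limit (fun N theta => \prod_(e <- r) G_trunc U N (theta (val e).1 - theta (dhead (val e))))
    (fun theta : vertex L -> R => \prod_(e <- r) G_ U (theta (val e).1 - theta (dhead (val e)))).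
Proof.
have [M M0 hM] := G_trunc_bounded sumU.
have GM phi : `|G_ U phi| <= M + 1.
  have [N0 /(_ N0 (leqnn _) phi) h] := G_trunc_approx sumU ltr01.
  rewrite -[G_ U phi](subrK (G_trunc U N0 phi)) (le_trans (ler_normD _ _))//.
  by rewrite addrC lerD.
have bound s N (theta : vertex L -> R) :
    `|\prod_(e <- s) G_trunc U N (theta (val e).1 - theta (dhead (val e)))| <= (M + 1) ^+ size s.
  elim: s => [|e s IH]; first by rewrite big_nil normr1.
  rewrite big_cons exprS normrM ler_pM//.
  by apply: le_trans (hM _ _) _; rewrite lerDl.
elim: r => [|e r IH] eps eps0.
  by exists 0%N => N _ theta; rewrite !big_nil subrr normr0 ltW.
pose B := (M + 1) ^+ (size r).+1.
have B0 : 0 < B by rewrite exprn_gt0//; lra.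
(* The tolerances make each of the two terms in the decomposition of [g * P - gt * Q] at most
   [eps / 2]; [M + 1] bounds every factor and is positive even when [M] is 0. *)
have d0 : 0 < eps / 2 / (M + 1) by rewrite !divr_gt0//; lra.
have d1 : 0 < eps / 2 / (M + 1) ^+ size r by rewrite !divr_gt0// exprn_gt0//; lra.
have [N0 h0] := IH _ d0; have [N1 h1] := G_trunc_approx sumU d1.
exists (maxn N0 N1) => N; rewrite geq_max => /andP[N0N N1N] theta.
rewrite !big_cons; set g := G_ U _; set gt := G_trunc U N _.
set P := \prod_(_ <- r) _; set Q := \prod_(_ <- r) _.
have -> : g * P - gt * Q = g * (P - Q) + (g - gt) * Q by ring.
rewrite (le_trans (ler_normD _ _))// [leRHS](_ : _ = eps / 2 + eps / 2); last by lra.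
rewrite !normrM; apply: lerD.
  rewrite [leRHS](_ : _ = (M + 1) * (eps / 2 / (M + 1))); last first.
    by rewrite [RHS]mulrC divfK// gt_eqF//; lra.
  by apply: ler_pM => //; [exact: GM|exact: h0].
rewrite [leRHS](_ : _ = eps / 2 / (M + 1) ^+ size r * (M + 1) ^+ size r); last first.
  by rewrite divfK// gt_eqF// exprn_gt0//; lra.
by apply: ler_pM => //; [exact: h1|exact: bound].
Qed.

Let angle_integralE (s : seq (vertex L)) (F : (vertex L -> R) -> R) theta :
  angle_integral s F theta = torus_integral s F theta.
Proof.
elim: s theta => //= v s IH theta; apply: eq_Rintegral => t _; exact: IH.
Qed.

Lemma spin_uniform_limit :
  uniform_limit (fun N theta => cos (theta x - theta y) * density_trunc N theta)
    (fun theta : vertex L -> R => cos (theta x - theta y) * spin_density U theta).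
Proof.
move=> e /(prod_approx (index_enum edge))[N0 h]; exists N0 => N /h{}h theta.
rewrite -mulrBr normrM /spin_density big_edge.
apply: le_trans (h theta); rewrite ler_piMl//.
by rewrite ler_norml cos_geN1 cos_le1.
Qed.

Lemma is_trig_poly_trunc N :
  is_trig_poly (fun theta : vertex L -> R => cos (theta x - theta y) * density_trunc N theta).
Proof.
exists (current N * bool)%type; eexists; eexists; apply/funext => theta.
exact: trunc_trig_poly.
Qed.

Lemma spin_integralE F :
  spin_integral U F = torus_integral (enum (vertex L))
    (fun theta => F theta * spin_density U theta) (fun=> 0).
Proof. by rewrite /spin_integral angle_integralE. Qed.

Lemma spin_integral_approx (eps : R) : 0 < eps ->
  exists N0, forall N, (N0 <= N)%N ->
    `|spin_integral U (fun theta : vertex L -> R => cos (theta x - theta y)) -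
      (2 * pi) ^+ #|vertex L| * sourced_sum N| <= eps.
Proof.
move=> /(uniform_limit_torus_integral (enum (vertex L)) is_trig_poly_trunc
  spin_uniform_limit)[N0 h].
by exists N0 => N /h /(_ (fun=> 0)); rewrite torus_integral_trunc spin_integralE.
Qed.

End SpinDuality.

(** The constant 1 is written as the cosine of a zero difference, so that the partition function has
    the same current representation, without source. *)
Lemma le_spin_integral (R : realType) (U : int -> R) L (x y : vertex L) :
    annealed_gaussian U -> summable_interaction U ->
  spin_integral U (fun theta : vertex L -> R => cos (theta x - theta y)) <=
  spin_integral U (fun theta : vertex L -> R => cos (theta x - theta x)).
Proof.
move=> gaussU sumU; rewrite !spin_integralE; apply: le_torus_integral.
- exact: (@is_trig_poly_trunc _ _ _ gaussU x y).
- exact: spin_uniform_limit.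
- exact: (@is_trig_poly_trunc _ _ _ gaussU x x).
- exact: spin_uniform_limit.
move=> theta; apply: ler_wpM2r; last by rewrite subrr cos0 cos_le1.
by apply: prodr_ge0 => e _; exact: G_ge0.
Qed.

(** * Winding numbers of level loops *)

Section Loops.
Variable L : nat.
Variables (n : height L) (k : int).
Implicit Types (e : dart L) (v : vertex L) (l : {set dart L}).
Local Notation q := (k%:~R + 1 / 2 : rat).
Local Notation next := (next_qedge n q).

(** The level edges at [v] separate consecutive sectors on opposite sides of [q], which reduces
    every local statement about the line to four booleans. *)
Let above v (d : 'Z_4) : bool := k < n (left_face (v, d)).

Lemma qedge_vertex v (d : 'Z_4) :
  qedge n q (v, d) = ~~ above v (d - 1) && above v d.
Proof.
rewrite qedgeE /above -leNgt -(right_face_rot v (d - 1)) subrK.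
have [//|h] := boolP (is_edge (v, d)).
by rewrite left_face_nedge// right_face_nedge//=; case: ltP => //; rewrite andbF.
Qed.

Lemma qedge_edge e : qedge n q e -> is_edge e.
Proof. by move=> /andP[]. Qed.

Let turn v (d : 'Z_4) : 'Z_4 :=
  if above v (d + 3%:R) then d + 3%:R else if above v d then d else d + 1.

Let above_head e : qedge n q e ->
  above (dhead e) (e.2 + 1) /\ ~~ above (dhead e) (e.2 + 2%:R).
Proof.
move=> /[dup]; rewrite {1}qedgeE => /andP[ee _]; rewrite qedgeE => /and3P[_ h1 h2].
rewrite /above left_face_dhead// h2; split => //.
by rewrite -right_face_rot -addrA -[X in right_face (_, _ + X)](_ : 3%:R = _)
  ?right_face_dhead -?leNgt//; exact: val_inj.
Qed.

Lemma next_qedgeE e : qedge n q e -> next e = (dhead e, turn (dhead e) e.2).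
Proof.
move=> /above_head[h1 h2]; rewrite /next_qedge /= !qedge_vertex /turn.
have -> : e.2 + 3%:R - 1 = e.2 + 2%:R by rewrite -addrA; congr (_ + _); exact: val_inj.
have -> : e.2 - 1 = e.2 + 3%:R by congr (_ + _); exact: val_inj.
rewrite h2 addrK h1 /=.
by case: (above _ (e.2 + 3%:R)) => //=; case: (above _ e.2).
Qed.

Lemma next_qedge_qedge e : qedge n q e -> qedge n q (next e).
Proof.
move=> he; rewrite next_qedgeE// qedge_vertex /turn; have [h1 h2] := above_head he.
have E3 : e.2 + 3%:R - 1 = e.2 + 2%:R by rewrite -addrA; congr (_ + _); exact: val_inj.
have E0 : e.2 - 1 = e.2 + 3%:R by congr (_ + _); exact: val_inj.
case: ifP => h3; first by rewrite E3 h2 h3.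
by case: ifP => h0; rewrite ?E0 ?h3 ?h0// addrK h0 h1.
Qed.

(** The turn is invertible: [turnK] recovers the incoming direction from the outgoing one and the
    sectors at the vertex. *)
Lemma next_qedge_inj : {in qedge n q &, injective next}.
Proof.
have turnK e : qedge n q e -> e.2 =
    let d' := turn (dhead e) e.2 in
    if above (dhead e) (d' + 2%:R) then d' + 1
    else if above (dhead e) (d' + 1) then d' else d' + 3%:R.
  move=> /above_head[h1 h2]; rewrite /turn /=.
  case h3 : (above (dhead e) (e.2 + 3%:R)).
    have -> : e.2 + 3%:R + 2%:R = e.2 + 1 by rewrite -addrA; congr (_ + _); exact: val_inj.
    rewrite h1 -addrA -[LHS]addr0; congr (_ + _); exact: val_inj.
  case h0 : (above (dhead e) e.2); first by rewrite (negbTE h2) h1.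
  have -> : e.2 + 1 + 2%:R = e.2 + 3%:R by rewrite -addrA; congr (_ + _); exact: val_inj.
  have -> : e.2 + 1 + 1 = e.2 + 2%:R by rewrite -addrA; congr (_ + _); exact: val_inj.
  rewrite h3 (negbTE h2) -addrA -[LHS]addr0; congr (_ + _); exact: val_inj.
move=> e e' he he'; rewrite !next_qedgeE// => -[hv hd].
have d : e.2 = e'.2.
  by have /= := turnK e he; have /= := turnK e' he'; rewrite hd hv => <-.
have ee := qedge_edge he; have ee' := qedge_edge he'.
by rewrite -(drevK ee) -(drevK ee') [in drev e]/drev [in drev e']/drev hv d.
Qed.

Lemma iter_qedge e i : qedge n q e -> qedge n q (iter i next e).
Proof. by move=> he; elim: i => //= i; exact: next_qedge_qedge. Qed.

Section OneLoop.
Variable e0 : dart L.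
Hypothesis qe0 : qedge n q e0.
Let l : {set dart L} := [set e | fconnect next e0 e]%SET.

Lemma loop_qedge e : e \in l -> qedge n q e.
Proof. by rewrite inE => /iter_findex <-; exact: iter_qedge. Qed.

Let loop_edge e : e \in l -> is_edge e.
Proof. by move=> /loop_qedge /qedge_edge. Qed.

Lemma loop_next e : e \in l -> next e \in l.
Proof. by rewrite !inE => h; apply: connect_trans h (fconnect1 _ _). Qed.

Let loop_next_image : [set next e | e in l]%SET = l.
Proof.
apply/eqP; rewrite eqEcard; apply/andP; split.
  by apply/fintype.subsetP => _ /imsetP[e el ->]; exact: loop_next.
rewrite card_in_imset// => e e' /loop_qedge he /loop_qedge he'.
exact: next_qedge_inj.
Qed.

Definition loop_flow e : int := (e \in l)%:Z.

(** [next] permutes the darts of the loop, so each vertex is as often a head as a tail. *)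
Lemma outflow_loop v : outflow (circ loop_flow) v = 0.
Proof.
rewrite outflow_circ.
have -> : \sum_(e | is_edge e) loop_flow e * ((e.1 == v)%:Z - (dhead e == v)%:Z) =
    \sum_(e in l) ((e.1 == v)%:Z - (dhead e == v)%:Z).
  rewrite [RHS]big_mkcond [LHS]big_mkcond; apply: eq_bigr => e _.
  rewrite /loop_flow; have [/loop_edge->|_] := boolP (e \in l); first by rewrite mul1r.
  by rewrite mul0r if_same.
rewrite sumrB -[in X in X - _]loop_next_image big_imset /=; last first.
  by move=> e e' /loop_qedge he /loop_qedge he'; exact: next_qedge_inj.
apply/eqP; rewrite subr_eq0; apply/eqP; apply: eq_bigr => e /loop_qedge he.
by rewrite next_qedgeE.
Qed.

(** The southward darts counted negatively by [winding] are the reversals of northward darts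
    starting one row lower, which is how they enter [circ]. *)
Lemma winding_potential f : winding l f = potential (circ loop_flow) f.
Proof.
rewrite ffunE; case: f => [s|//]; rewrite /winding /flow_east /circ.
rewrite [RHS]big_split /= sumrN.
pose N e := [&& e.2 == 1, (pos e.1).2 == (corner s).2 & (corner s).1 < (pos e.1).1].
pose S e := [&& e.2 == 3%:R, (pos e.1).2 == (corner s).2 + 1 & (corner s).1 < (pos e.1).1].
have -> : \sum_(e | is_edge e && N e) loop_flow (drev e) =
          \sum_(e | is_edge e && S e) loop_flow e.
  rewrite [LHS](sum_drev N (fun e => loop_flow (drev e))).
  apply: eq_big => [e|e /andP[h _]]; last by rewrite drevK.
  case h : (is_edge e) => //=; rewrite /N /S /= (pos_dhead h).
  case: e {h} => v d /=; case: (pos v) => a b /=.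
  have -> : (d + 2%:R == 1) = (d == 3%:R) by elim/Z4_case: d.
  have [->|//] := eqVneq d 3%:R; rewrite /=; lia.
have E (Q : pred (dart L)) : \sum_(e | is_edge e && Q e) loop_flow e =
    \sum_(e in l) (Q e)%:Z.
  rewrite [RHS]big_mkcond [LHS]big_mkcond; apply: eq_bigr => e _.
  rewrite /loop_flow; have [/loop_edge->|_] := boolP (e \in l); last by rewrite if_same.
  by case: (Q e).
rewrite !E -sumrB [LHS]big_mkcondr; apply: eq_bigr => e _; rewrite /N /S.
by case: (_ < _); rewrite ?andbT ?andbF ?subrr ?natz.
Qed.

Let w : height L := potential (circ loop_flow).

Let grad_w e : is_edge e -> w (left_face e) - w (right_face e) = loop_flow e - loop_flow (drev e).
Proof.
move=> ee; rewrite -[LHS]/(grad w e) grad_potential//; first exact: antisym_circ.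
exact: outflow_loop.
Qed.

Let drev_notin e : is_edge e -> n (right_face e) <= k -> drev e \notin l.
Proof.
move=> ee h; apply/negP => /loop_qedge; rewrite qedgeE => /and3P[_ _].
by rewrite left_face_drev// ltNge h.
Qed.

Let w_rot v (d : 'Z_4) : ~~ above v (d - 1) -> ~~ above v d ->
  w (left_face (v, d)) = w (left_face (v, d - 1)).
Proof.
move=> h1 h2; have [ee|ee] := boolP (is_edge (v, d)); last first.
  by rewrite -(right_face_rot v (d - 1)) subrK left_face_nedge// right_face_nedge.
rewrite -(right_face_rot v (d - 1)) subrK; apply/eqP; rewrite -subr_eq0 grad_w//.
rewrite /loop_flow (negbTE (drev_notin ee _)); last first.
  by rewrite leNgt -[d](subrK 1) right_face_rot.
rewrite (_ : (v, d) \in l = false)//; apply/negP => /loop_qedge.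
by rewrite qedge_vertex (negbTE h2) andbF.
Qed.

(* The faces between a loop edge and the next one, on the right, lie below q,
   so that no loop edge separates them: the winding number on the right of the
   loop is constant. *)
Let w_right_next e : e \in l -> w (right_face (next e)) = w (right_face e).
Proof.
move=> el; have he := loop_qedge el; rewrite next_qedgeE//.
have [h1 h2] := above_head he; set v := dhead e; set d := e.2.
have -> : right_face e = left_face (v, d + 2%:R).
  rewrite -right_face_dhead ?loop_edge// -right_face_rot -addrA.
  by congr (right_face (_, _ + _)); exact: val_inj.
have E3 : d + 3%:R - 1 = d + 2%:R by rewrite -addrA; congr (_ + _); exact: val_inj.
have E0 : d - 1 = d + 3%:R by congr (_ + _); exact: val_inj.
rewrite -[turn v d](subrK 1) right_face_rot /turn.
case: ifP => h3; first by rewrite E3.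
have r1 : w (left_face (v, d + 3%:R)) = w (left_face (v, d + 2%:R)).
  by have := @w_rot v (d + 3%:R); rewrite h3 E3 => ->.
case: ifP => h0; first by rewrite E0.
by rewrite addrK -r1; have := @w_rot v d; rewrite h0 E0 h3 => ->.
Qed.

Let w_right e : e \in l -> w (right_face e) = w (right_face e0).
Proof.
rewrite inE => /iter_findex <-; elim: (findex _ _ _) => //= i IH.
by rewrite w_right_next// inE fconnect_iter.
Qed.

(** The winding number is a constant [a] on the right of the loop and [a + 1] on its left, and it
    changes nowhere else. Identifying these two values leaves a constant function, so only [a] and
    [a + 1] occur; the outer face has value 0, hence [a] is 0 or -1. *)
Lemma winding_cases : (forall f, winding l f = 0 \/ winding l f = 1) \/
                      (forall f, winding l f = 0 \/ winding l f = - 1).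
Proof.
pose a : int := w (right_face e0).
have e0l : e0 \in l by rewrite inE connect0.
have lr e : e \in l -> w (right_face e) = a /\ w (left_face e) = a + 1.
  move=> el; rewrite /a -(w_right el); split => //.
  have ee := loop_edge el; have := grad_w ee.
  rewrite /loop_flow el (negbTE (drev_notin ee _)); last first.
    by have := loop_qedge el; rewrite qedgeE => /and3P[].
  by lia.
pose D : height L := [ffun f => if w f == a + 1 then a else w f].
have DE f : D f = if w f == a + 1 then a else w f by rewrite [LHS]ffunE.
have DN f : D f = D None.
  apply: grad0_const => e /andP[ee _]; rewrite /grad !DE.
  have [/lr[-> ->]|el] := boolP (e \in l); first by rewrite eqxx; case: ifP; lia.
  have [|el'] := boolP (drev e \in l).
    by move=> /lr; rewrite left_face_drev// right_face_drev// => -[-> ->]; rewrite eqxx; case: ifP; lia.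
  have := grad_w ee; rewrite /loop_flow (negbTE el) (negbTE el') subrr => /eqP.
  by rewrite subr_eq0 => /eqP->; rewrite subrr.
have w2 f : w f = a \/ w f = a + 1.
  have := DN f; rewrite -(DN (right_face e0)) !DE.
  have [-> _|_] := eqVneq (w f) (a + 1); first by right.
  by case: ifP => _ ->; left.
have w0 : w None = 0 by rewrite ffunE.
have := w2 None; rewrite w0 => -[a0|a0]; [left|right] => f;
  rewrite winding_potential -/w; have := w2 f; rewrite -?a0; lia.
Qed.

(** Discrete Green formula. A northward edge at abscissa [x] is seen by the [x + L] squares to its
    west in its row; the term in [L] drops out because the flux through a whole row is 0. *)
Lemma signed_area_winding : signed_area l = \sum_(s : square L) winding l (Some s).
Proof.
pose j := circ loop_flow.
have aj : antisym j by exact: antisym_circ.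
pose N e := is_edge e && (e.2 == 1).
have Nbox e : N e -> - L%:Z <= (pos e.1).1 <= L%:Z /\ - L%:Z <= (pos e.1).2 < L%:Z.
  move=> /andP[ee /eqP ed]; move: ee (pos_in_box e.1); rewrite is_edgeE ed /in_box.
  by case: (pos e.1) => a b /=; lia.
have wE : \sum_(s : square L) winding l (Some s) =
    \sum_(e | N e) j e * ((pos e.1).1 + L%:Z).
  transitivity (\sum_(s : square L) \sum_(e | N e)
      j e * (((pos e.1).2 == (corner s).2) && ((corner s).1 < (pos e.1).1))%:Z).
    apply: eq_bigr => s _; rewrite winding_potential ffunE /flow_east.
    rewrite [RHS]big_mkcond [LHS]big_mkcond; apply: eq_bigr => e _; rewrite /N.
    case: (is_edge e) => //=; case: (e.2 == 1) => //=.
    by case: (_ && _); rewrite ?mulr1 ?mulr0.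
  rewrite exchange_big; apply: eq_bigr => e /Nbox; rewrite -mulr_sumr.
  case: (pos e.1) => a b /= -[ha hb]; congr (_ * _).
  rewrite -(pair_bigA _ (fun i i' : 'I_L.*2 =>
     ((b == (i' : nat)%:Z - L%:Z) && ((i : nat)%:Z - L%:Z < a))%:Z)) /=.
  have hb' : (absz (b + L%:Z)%R < L.*2)%N by lia.
  transitivity (\sum_(i < L.*2) ((i : nat)%:Z < a + L%:Z)%R%:Z).
    apply: eq_bigr => i _; rewrite (bigD1 (Ordinal hb'))//= big1 ?addr0.
      by congr Posz; lia.
    by move=> i' /eqP i'b; case: eqP => // bE; case: i'b; apply: val_inj => /=; lia.
  have [m mL ->] : exists2 m : nat, (m <= L.*2)%N & a + L%:Z = m.
    by exists (absz (a + L%:Z)%R); lia.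
  elim: L.*2 mL => [|M IH]; first by rewrite leqn0 => /eqP->; rewrite big_ord0.
  rewrite leq_eqVlt ltnS big_ord_recr /= => /predU1P[->|/[dup] mM /IH ->]; last first.
    by rewrite ltz_nat ltnNge mM addr0.
  rewrite (eq_bigr (fun=> 1)) => [|i _]; last by rewrite ltz_nat ltnS ltnW.
  by rewrite sumr_const card_ord ltz_nat ltnSn; lia.
have N0 : \sum_(e | N e) j e = 0.
  rewrite (partition_big (fun e => e.1.2) xpredT)//= big1// => b _.
  transitivity (potential j (face_at L (- L%:Z - 1, (b : nat)%:Z - L%:Z))); last first.
    by rewrite face_at_out ?ffunE//=; lia.
  rewrite potential_face_at//; last exact: outflow_loop.
  apply: eq_bigl => e; rewrite /N -andbA; congr (_ && (_ && _)).
  have := pos_in_box e.1; rewrite /in_box => h.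
  rewrite pos_snd; apply/eqP/andP => [->|[/eqP /= h' _]]; last by apply: val_inj => /=; lia.
  by split => //=; move: h; case: (pos e.1) => ? ? /=; lia.
rewrite wE; under eq_bigr do rewrite mulrDr.
rewrite big_split /= -mulr_suml N0 mul0r addr0 /j /circ.
under eq_bigr do rewrite mulrBl.
rewrite big_split /= sumrN.
rewrite (sum_drev (fun e => e.2 == 1) (fun e => loop_flow (drev e) * (pos e.1).1)).
have E (Q : pred (dart L)) (F : dart L -> int) :
    \sum_(e | is_edge e && Q e) loop_flow e * F e = \sum_(e in l) (Q e)%:Z * F e.
  rewrite [RHS]big_mkcond [LHS]big_mkcond; apply: eq_bigr => e _.
  rewrite /loop_flow; have [/loop_edge->|_] := boolP (e \in l); last first.
    by rewrite mul0r if_same.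
  by case: (Q e); rewrite ?mul1r ?mul0r.
rewrite [X in _ - X](eq_bigr (fun e => loop_flow e * (pos (dhead e)).1)); last first.
  by move=> e /andP[ee _]; rewrite drevK.
rewrite !E -sumrB /signed_area; apply: eq_bigr => e /loop_edge ee.
rewrite (pos_dhead ee); case: e {ee} => v d /=; case: (pos v) => a b /=.
by elim/Z4_case: d => /=; lia.
Qed.

(** All non-zero winding numbers of one loop have the same sign by [winding_cases], hence so has
    their sum, the signed area. *)
Lemma orientation_winding f : winding l f != 0 -> orientation l = sgz (winding l f).
Proof.
rewrite /orientation signed_area_winding; case: f => [s|//] ws.
rewrite (bigD1 s)//; case: winding_cases => h;
  have [w1|w1] := h (Some s); try by rewrite w1 eqxx in ws.
  rewrite w1 !gtr0_sgz// ltr_pwDl//.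
  by apply: sumr_ge0 => i _; case: (h (Some i)) => ->.
rewrite w1 !ltr0_sgz// -oppr_gt0 opprD ltr_pwDl// oppr_ge0.
by apply: sumr_le0 => i _; case: (h (Some i)) => ->.
Qed.
End OneLoop.

(** Both sides vanish at the outer face and have the same gradient, since each level edge lies on
    exactly one loop. *)
Lemma sum_winding f :
  \sum_(l in qloops n q) winding l f = (k < n f)%R%:Z - (k < n None)%R%:Z.
Proof.
pose w : height L := [ffun g => \sum_(l in qloops n q) winding l g].
pose h : height L := [ffun g => (k < n g)%R%:Z - (k < n None)%R%:Z].
suff /ffunP/(_ f) : w = h by rewrite !ffunE.
apply: (@grad_inj _ _ _ None); last first.
  by rewrite !ffunE subrr; apply: big1.
move=> e /andP[ee _]; rewrite /grad !ffunE -sumrB.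
have sumE e' : \sum_(l in qloops n q) (e' \in l)%:Z = (qedge n q e')%:Z.
  have [he'|he'] := boolP (qedge n q e').
    rewrite (bigD1 [set e'' | fconnect next e' e'']%SET); last first.
      by apply/imsetP; exists e'; rewrite ?inE.
    rewrite /= inE connect0 big1 ?addr0// => l /andP[/imsetP[e1]].
    rewrite inE => he1 -> ne; rewrite inE; case e1e' : (fconnect _ _ _) => //.
    move: ne; apply: contraNeq => _; apply/eqP/setP => e''; rewrite !inE.
    apply/idP/idP => h2; last exact: connect_trans e1e' h2.
    apply: connect_trans h2.
    by rewrite (fconnect_sym_in _ next_qedge_inj)//; exact: next_qedge_qedge.
  rewrite big1// => l /imsetP[e1]; rewrite inE => he1 ->.
  by case el : (e' \in _) => //; move: he'; rewrite (loop_qedge he1 el).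
transitivity (\sum_(l in qloops n q) ((e \in l)%:Z - (drev e \in l)%:Z)).
  apply: eq_bigr => l /imsetP[e1]; rewrite inE => he1 ->.
  rewrite !(winding_potential he1) -[LHS]/(grad (potential (circ (loop_flow e1))) e).
  by rewrite grad_potential//; [exact: antisym_circ|exact: outflow_loop].
rewrite sumrB !sumE !qedgeE ee is_edge_drev//= left_face_drev// right_face_drev//.
by have [] := leP (n (right_face e)) k; have [] := leP (n (left_face e)) k; lia.
Qed.

(** Without such a loop, no winding number would have the sign of [eta], and neither could their
    sum. *)
Lemma loop_number_gt0 f (eta : int) :
    (k < n f)%R%:Z - (k < n None)%R%:Z = eta -> eta != 0 ->
  (0 < loop_number n q (sgz eta) f)%N.
Proof.
rewrite -sum_winding => etaE eta0; rewrite /loop_number card_gt0.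
apply/set0Pn; apply: contrapT => no; move: eta0; apply/negP; rewrite negbK.
have wl l : l \in qloops n q -> winding l f * sgz eta <= 0.
  move=> lq; rewrite leNgt; apply/negP => wpos; apply: no; exists l; rewrite inE lq /=.
  have [e1] := imsetP lq; rewrite inE => he1 lE.
  have w0 : winding l f != 0 by apply: contraTneq wpos => ->; rewrite mul0r.
  rewrite /surrounds w0 andbT; move: w0 wpos; rewrite lE => w0 wpos.
  rewrite (orientation_winding he1 w0); move: wpos.
  by case: sgzP; case: sgzP; lia.
have : eta * sgz eta <= 0.
  by rewrite -{1}etaE mulr_suml; apply: sumr_le0 => l; exact: wl.
by case: (sgzP eta); lia.
Qed.

End Loops.

Lemma esum_fiber (R : realType) (T K : choiceType) (A : set T) (key : T -> K)
    (f : T -> \bar R) : (forall t, (0 <= f t)%E) ->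
  (\esum_(t in A) f t =
   \esum_(x in key @` A) \esum_(t in A `&` [set t | key t = x]) f t)%E.
Proof.
move=> f0; rewrite esum_esum//; pose J x := A `&` [set t | key t = x].
apply: (@reindex_esum _ _ _ ((key @` A) `*`` J) A snd f); split.
- by move=> [x t] /= [_ []].
- move=> [x t] [x' t'] /set_mem[/= _ [_ /= xt]] /set_mem[/= _ [_ /= xt']] tt'.
  by rewrite -xt -xt' tt'.
- by move=> t At; exists (key t, t) => //; split; [exists t|split].
Qed.

Lemma le_esum_fiber (R : realType) (T K : choiceType) (A : set T) (key : T -> K)
    (f g : T -> \bar R) :
    (forall t, (0 <= f t)%E) -> (forall t, (0 <= g t)%E) ->
    (forall t0, A t0 ->
      (\esum_(t in A `&` [set t | key t = key t0]) f t <=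
       \esum_(t in A `&` [set t | key t = key t0]) g t)%E) ->
  (\esum_(t in A) f t <= \esum_(t in A) g t)%E.
Proof.
move=> f0 g0 h; rewrite !(esum_fiber _ key)//.
by apply: le_esum => x [t0 At0 <-]; exact: h.
Qed.

(** * Sums over heights and flows *)

Section FlowSums.
Context {R : realType}.
Variables (U : int -> R) (L : nat).
Hypothesis convU : convex_interaction U.
Hypothesis gaussU : annealed_gaussian U.
Hypothesis sumU : summable_interaction U.
Local Notation W := (boltzmann U).
Local Notation weight := (@current_weight R U L).

Lemma current_weight_gt0 m : 0 < weight m.
Proof. by apply: prodr_gt0 => e _; exact: boltzmann_gt0. Qed.

(** A finite family of integer currents takes values in some bounded range, which may be enlarged
    beyond [N0]; its weight is then part of a truncated sum. *)
Lemma esum_flow_le (D : pred {ffun edge L -> int}) (N0 : nat) (B : R) : 0 <= B ->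
    (forall N, (N0 <= N)%N ->
      \sum_(m : current L N | D [ffun e => cval m e]) weight (cval m) <= B) ->
  (\esum_(j in [set j : {ffun edge L -> int} | D j]) (weight j)%:E <= B%:E)%E.
Proof.
move=> B0 h; apply: ge_ereal_sup => _ [X [finX XD] <-].
rewrite fsbig_finite//= sumEFin lee_fin.
set s := finmap.enum_fset (fset_set X).
have us : uniq s by exact: finmap.fset_uniq.
have sD j : j \in s -> D j.
  by rewrite in_fset_set// => /set_mem /XD.
pose N := (N0 + \sum_(j <- s) \sum_e absz (j e))%N.
have small j e : j \in s -> (absz (j e) <= N)%N.
  move=> js; apply: leq_trans (leq_addl _ _).
  rewrite (big_rem j)//= (bigD1 e)//= -addnA; exact: leq_addr.
pose c (j : {ffun edge L -> int}) : current L N := [ffun e => inord (absz (j e + N%:Z)%R)].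
have cK (j : {ffun edge L -> int}) e : j \in s -> cval (c j) e = j e.
  move=> /(small _ e); rewrite /cval ffunE; move: (j e : int) => z zN.
  by rewrite inordK; lia.
have cinj : {in s &, injective c}.
  move=> j j' js j's jj'; apply/ffunP => e.
  by rewrite -(cK j e js) -(cK j' e j's) jj'.
apply: le_trans (h N (leq_addr _ _)).
have -> : \sum_(j <- s) weight j = \sum_(m <- map c s) weight (cval m).
  rewrite big_map; apply: eq_big_seq => j js.
  by apply: eq_bigr => e _; rewrite cK.
rewrite big_uniq ?map_inj_in_uniq//=.
rewrite [leRHS]big_mkcond [leLHS]big_mkcond; apply: ler_sum => m _.
case: ifPn => [/mapP[j js ->]|_]; last by case: ifP => // _; exact: ltW (current_weight_gt0 _).
rewrite ifT// (_ : finfun _ = j) ?sD//; apply/ffunP => e; rewrite ffunE.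
exact: cK.
Qed.

Let gradf (n : height L) : {ffun edge L -> int} := [ffun e => grad n (val e)].

Lemma height_weightE (n : height L) :
  height_weight U n = \prod_(e : edge L) W (n (left_face (val e)) - n (right_face (val e))).
Proof. by rewrite /height_weight big_edge. Qed.

Let weight_grad n : weight (gradf n) = height_weight U n.
Proof. by rewrite height_weightE; apply: eq_bigr => e _; rewrite ffunE. Qed.

Lemma height_weight_gt0 (n : height L) : 0 < height_weight U n.
Proof. by rewrite height_weightE; apply: prodr_gt0 => e _; exact: boltzmann_gt0. Qed.

(** A height pinned at one face is determined by its gradient, and the total weight of arbitrary
    integer currents factorizes into one convergent series per edge. *)
Lemma esum_height_weight_lty f (a : int) :
  (\esum_(n in [set n : height L | n f = a]) (height_weight U n)%:E < +oo)%E.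
Proof.
have [M hM] := symmetric_sum_bounded sumU.
have M0 : 0 <= M.
  by apply: le_trans (hM 0%N); rewrite /symmetric_sum sumr_ge0// => *; exact: boltzmann_ge0.
apply: (@le_lt_trans _ _ (M ^+ #|edge L|)%:E); last by rewrite ltry.
apply: (@le_trans _ _ (\esum_(j in [set j : {ffun edge L -> int} | xpredT j]) (weight j)%:E)%E).
  under eq_esum do rewrite -weight_grad.
  apply: (@le_esum_inj _ _ _ _ _ gradf (fun j : {ffun edge L -> int} => (weight j)%:E)) => //.
    move=> n n'; rewrite !inE => na n'a /ffunP nn'; apply: (@grad_inj _ _ _ f).
      by move=> e ue; have := nn' (exist _ e ue); rewrite !ffunE.
    by rewrite na.
  by move=> j; rewrite lee_fin ltW// current_weight_gt0.
apply: (@esum_flow_le _ 0); first exact: exprn_ge0.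
move=> N _; rewrite /current_weight /=.
rewrite -(bigA_distr_bigA (fun e (k : 'I_N.*2.+1) => W ((k : nat)%:Z - N%:Z))) /=.
rewrite prodr_const; apply: lerXn2r; rewrite ?nnegrE//; last exact: hM.
by apply: sumr_ge0 => *; exact: boltzmann_ge0.
Qed.

(** Restoring the omitted factors, which the pinning makes constant and positive, turns the sum into
    a part of a finite one. *)
Lemma pinned_sum_lty (pr : pred (edge L)) (S : {set face L}) (v : face L -> int) :
    S != finset.set0 ->
    (forall e, ~~ pr e -> left_face (val e) \in S /\ right_face (val e) \in S) ->
  (pinned_sum (fun e : edge L => left_face (val e)) (fun e => right_face (val e)) pr W S v
     < +oo)%E.
Proof.
move=> /set0Pn[f fS] prS.
pose c : R := \prod_(e : edge L | ~~ pr e) W (v (left_face (val e)) - v (right_face (val e))).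
have c0 : 0 < c by apply: prodr_gt0 => e _; exact: boltzmann_gt0.
set Z := pinned_sum _ _ _ _ _ _.
have : (c%:E * Z < +oo)%E.
  rewrite /Z /pinned_sum -esumZl; last 2 first.
  - exact: ltW.
  - by move=> n; rewrite lee_fin prodr_ge0// => e _; exact: boltzmann_ge0.
  apply: le_lt_trans (esum_height_weight_lty f (v f)).
  rewrite [leLHS](@eq_esum _ _ _ _ (fun n => (height_weight U n)%:E)); last first.
    move=> n /= nv; rewrite -EFinM height_weightE; congr EFin.
    rewrite [RHS](bigID pr) /= mulrC; congr (_ * _).
    by apply: eq_bigr => e /prS[hl hr]; rewrite !nv.
  apply: (@le_esum_inj _ _ _ _ _ id (fun n : height L => (height_weight U n)%:E)) => //.
    by move=> n /= nv; exact: nv.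
  by move=> n; rewrite lee_fin ltW// height_weight_gt0.
have Z0 : (0 < Z)%E by apply: pinned_sum_gt0 => q; exact: boltzmann_gt0.
by case: Z Z0 => // [z|] _; rewrite ?ltry// mulry gtr0_sg// mul1e.
Qed.

End FlowSums.

(* The sites of the quadrant Q_1 that are not on its boundary. *)
Definition interior L (v : vertex L) : bool := (1 <= (pos v).1) && (1 <= (pos v).2).

(** * Exploration of a level line *)

Section Exploration.
Variables (L : nat) (e0 : dart L).
Hypothesis e0_edge : is_edge e0.
Hypothesis tail_out : ~~ interior e0.1.
Hypothesis head_in : interior (dhead e0).
Variables (k0 : int) (y : vertex L).
Hypothesis y_out : ~~ interior y.
Implicit Types (n : height L) (e : dart L) (T t : nat).

(* The level is taken relative to the face on the right of e0, whose height the
   current built below determines. *)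
Definition level n : int := n (right_face e0) + k0.

Definition level_dart n e : bool :=
  [&& is_edge e, n (right_face e) <= level n & level n < n (left_face e)].

(* Follows the level line, also visiting the darts met while rotating from one
   of its edges to the next. *)
Definition step n e : dart L :=
  if level_dart n e then (dhead e, e.2 + 3%:R) else (e.1, e.2 + 1).

Local Notation walk n t := (iter t (step n) e0).

Definition escapes n T : Prop :=
  [/\ (0 < T)%N, forall t, (0 < t < T)%N -> interior (walk n t).1 & (walk n T).1 = y].

(** The sign of the level tells whether the outer face lies above it and is thus lowered. The flow
    alone does not reveal this, so it is recorded in [r]. *)
Definition escape_event (r : bool) : set (height L) :=
  [set n : height L | [/\ n None = 0, (0 <= level n) = r, level_dart n e0 & exists T, escapes n T]].

(** The outer face is included even if the walk does not meet it, so that pinning the explored faces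
    keeps the boundary condition. *)
Definition explored n T : {set face L} :=
  [set f | (f == None) || (f == right_face e0) ||
           (f \in map (@left_face L) (traject (step n) e0 T))]%SET.

Definition high n T : {set face L} := [set f in explored n T | level n < n f]%SET.

Definition lowered n T : height L := [ffun f => n f - (f \in high n T)%:Z].

Definition interface n T e : bool := (e \in traject (step n) e0 T) && level_dart n e.

Definition escape_flow n T e : int :=
  grad (lowered n T) e + circ (fun e => (interface n T e)%:Z) e.

(** Following an edge of the line keeps the face on the right; a rotation puts the former left face
    there, and happens only when that face is not above the level. *)
Lemma right_walk n t : level_dart n e0 -> n (right_face (walk n t)) <= level n.
Proof.
move=> /and3P[_ h0 _]; elim: t => //= t; move: (walk n t) => e he.
rewrite /step; case h : (level_dart n e).
  by rewrite right_face_dhead//; case/and3P: h.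
case: e he h => v d; rewrite right_face_rot => he h.
move: h; rewrite /level_dart he /=; have [_ /= h|ee _] := boolP (is_edge (v, d)).
  by rewrite leNgt h.
by rewrite left_face_nedge// -(right_face_nedge ee).
Qed.

(** The delicate case is a rotation from [b] meeting the continuation of a level edge [a]: then [b]
    is the reversal of [a] and has on its right a face above the level. *)
Lemma step_inj n e e' : n (right_face e) <= level n -> n (right_face e') <= level n ->
  step n e = step n e' -> e = e'.
Proof.
have mixed (a b : dart L) : level_dart n a -> n (right_face b) <= level n ->
    (dhead a, a.2 + 3%:R) = (b.1, b.2 + 1) -> a = b.
  case: b => w d /and3P[ea _ ha] hb /pair_equal_spec[/= E1 E2].
  have bE : (w, d) = drev a.
    rewrite -E1; congr pair; apply: (addIr 1); rewrite -E2 -addrA.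
    by congr (_ + _); exact: val_inj.
  by move: hb; rewrite bE right_face_drev// leNgt ha.
rewrite /step => he he'; case h : (level_dart n e); case h' : (level_dart n e').
- move=> /pair_equal_spec[E1 /addIr E2]; case/and3P: h => ee _ _; case/and3P: h' => ee' _ _.
  by rewrite -(drevK ee) -(drevK ee') /drev E1 E2.
- exact: mixed.
- by move=> /esym E; apply/esym/mixed.
- by case: e {he h} => v d; case: e' {he' h'} => v' d' /= /pair_equal_spec[-> /addIr ->].
Qed.

(** By injectivity a repetition would bring the walk back to [e0], whose tail is not interior,
    before the exit. *)
Lemma walk_uniq n T : level_dart n e0 -> escapes n T -> uniq (traject (step n) e0 T).
Proof.
move=> q0 [T0 ins _].
have inj i t : walk n i = walk n (i + t) -> e0 = walk n t.
  elim: i => [//|i IH] /= /step_inj h; apply: IH; apply: h;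
  exact: right_walk.
case: T T0 ins => // T _ ins; rewrite looping_uniq; apply/negP => /trajectP[t tT].
have [i iE] : exists i, (T = t + i.+1)%N by exists (T - t).-1; lia.
rewrite iE => /esym /inj h; have := ins i.+1; rewrite -h (negbTE tail_out).
by move/(_ _)/negP; apply; lia.
Qed.

Lemma right_explored n T t : (t <= T)%N -> level_dart n e0 ->
  right_face (walk n t) \in explored n T.
Proof.
move=> tT q0; elim: t tT => [|t IH] tT; first by rewrite inE eqxx orbT.
rewrite /= {1}/step; case h : (level_dart n (walk n t)).
  by rewrite right_face_dhead ?IH ?(ltnW tT)//; case/and3P: h.
rewrite right_face_rot inE; apply/orP; right; apply/mapP.
exists (walk n t); last by case: (walk n t).
by apply/trajectP; exists t.
Qed.

Lemma left_explored n T t : (t < T)%N -> left_face (walk n t) \in explored n T.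
Proof.
by move=> tT; rewrite inE map_f ?orbT//; apply/trajectP; exists t.
Qed.

Lemma interface_faces n T e : level_dart n e0 -> interface n T e ->
  left_face e \in high n T /\ right_face e \in explored n T :\: high n T.
Proof.
move=> q0 /andP[/trajectP[t tT ->] /and3P[_ h1 h2]].
rewrite !inE h2 andbT; split; first by have := left_explored n tT; rewrite inE.
have := right_explored (ltnW tT) q0; rewrite inE => ->.
by rewrite /= -leNgt right_walk.
Qed.

(** The gradient has no divergence. Along the walk the unit current telescopes from the tail of [e0]
    to [y], since rotations do not move the tail. *)
Lemma outflow_escape n T v : level_dart n e0 -> escapes n T ->
  outflow (escape_flow n T) v = (v == e0.1)%:Z - (v == y)%:Z.
Proof.
move=> q0 esc; have us := walk_uniq q0 esc.
rewrite /outflow /escape_flow big_split /=.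
rewrite -/(outflow (grad (lowered n T)) v) outflow_grad add0r.
rewrite -/(outflow (circ (fun e => (interface n T e)%:Z)) v) outflow_circ.
pose D e : int := (e.1 == v)%:Z - (dhead e == v)%:Z.
transitivity (\sum_(e <- traject (step n) e0 T) (level_dart n e)%:Z * D e).
  rewrite big_uniq//= [RHS]big_mkcond [LHS]big_mkcond; apply: eq_bigr => e _.
  rewrite /interface; case: (e \in _); last by case: ifP; rewrite ?mul0r.
  by rewrite /level_dart; case: (is_edge e); rewrite ?mul0r.
have -> (m : nat) : \sum_(e <- traject (step n) e0 m) (level_dart n e)%:Z * D e =
    (e0.1 == v)%:Z - ((walk n m).1 == v)%:Z.
  elim: m => [|m IH]; first by rewrite big_nil subrr.
  rewrite trajectSr -cats1 big_cat big_seq1 IH /D iterS; move: (walk n m) => e.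
  by rewrite /step /=; case: ifP => _; rewrite ?mul0r ?addr0// mul1r addrA subrK.
by case: esc => _ _ ->; rewrite ![v == _]eq_sym.
Qed.

Lemma escape_flow_antisym n T : antisym (escape_flow n T).
Proof. by apply: antisymD; [exact: antisym_grad | exact: antisym_circ]. Qed.

(** Stopping property: up to time [T] the walk only consults heights of explored faces. *)
Lemma eq_walk n n' T t : {in explored n T, n =1 n'} -> (t <= T)%N ->
  level_dart n e0 -> walk n' t = walk n t.
Proof.
move=> nn' tT q0.
have lE : level n' = level n by rewrite /level nn'// inE eqxx orbT.
elim: t tT => // t IH tT /=; rewrite IH ?(ltnW tT)// /step /level_dart lE.
by rewrite -!nn' ?left_explored// ?right_explored// ltnW.
Qed.

Lemma eq_trace n n' T : {in explored n T, n =1 n'} -> level_dart n e0 ->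
  traject (step n') e0 T = traject (step n) e0 T.
Proof.
move=> nn' q0; apply: (@eq_from_nth _ e0) => [|t]; rewrite !size_traject// => tT.
by rewrite !nth_traject// (eq_walk nn' (ltnW tT) q0).
Qed.

Lemma eq_explored n n' T : {in explored n T, n =1 n'} -> level_dart n e0 ->
  explored n' T = explored n T.
Proof. by move=> nn' q0; rewrite /explored (eq_trace nn' q0). Qed.

Lemma eq_escapes n n' T : {in explored n T, n =1 n'} -> level_dart n e0 ->
  escapes n T -> escapes n' T.
Proof.
move=> nn' q0 [T0 h hT]; split => // [t tT|]; rewrite (eq_walk nn')//.
  exact: h.
by case/andP: tT => _ /ltnW.
Qed.

Lemma interface_interior n T e : escapes n T -> interface n T e ->
  interior e.1 || interior (dhead e).
Proof.
case=> _ h _ /andP[/trajectP[[|t] tT ->] _]; first by rewrite head_in orbT.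
by rewrite h.
Qed.

Lemma interface_drev n T e : level_dart n e0 -> is_edge e ->
  n (right_face e) <= level n -> interface n T (drev e) = false.
Proof.
move=> q0 ee h; apply/negP => /andP[_ /and3P[_ _]].
by rewrite left_face_drev// ltNge h.
Qed.

Lemma in_high n T f : (f \in high n T) = (f \in explored n T) && (level n < n f).
Proof. by rewrite !inE. Qed.

Lemma high_le n T f : n f <= level n -> (f \in high n T) = false.
Proof. by move=> h; rewrite inE ltNge h andbF. Qed.

(** The left face is lowered and the right one is not; the added unit current compensates exactly.
    Hence the weights along the line do not change. *)
Lemma escape_flow_interface n T e : level_dart n e0 -> interface n T e ->
  escape_flow n T e = grad n e.
Proof.
move=> q0 /[dup] ie /(interface_faces q0)[hl /setDP[_ hr]].
have /andP[_ /and3P[ee h1 _]] := ie.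
rewrite /escape_flow /circ /grad !ffunE hl (negbTE hr) ie interface_drev//=; ring.
Qed.

(** A visited edge off the line has both its faces at or below the level, and neither is lowered. *)
Lemma escape_flow_visited n T t : (t < T)%N -> level_dart n e0 ->
  is_edge (walk n t) -> escape_flow n T (walk n t) = grad n (walk n t).
Proof.
move=> tT q0 ee; have [|ie] := boolP (interface n T (walk n t)).
  exact: escape_flow_interface.
have h1 := right_walk t q0; have h2 : n (left_face (walk n t)) <= level n.
  move: ie; rewrite /interface (_ : _ \in _) /=; last by apply/trajectP; exists t.
  by rewrite {1}/level_dart ee h1 /= -leNgt.
by rewrite /escape_flow /circ /grad !ffunE !high_le// (negbTE ie) interface_drev//=; ring.
Qed.

Lemma right_face_out : exists2 p, right_face e0 = face_at L p & (p.1 <= 0) || (p.2 <= 0).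
Proof.
exists (pos e0.1 + sector (e0.2 - 1)) => //.
move: tail_out head_in; rewrite /interior (pos_dhead e0_edge); case: (pos _) => a b.
by elim/Z4_case: (e0.2) => /=; lia.
Qed.

(** From the face on the right of [e0] a half-line to the west or to the south reaches the outer
    face and crosses only edges without interior endpoint. *)
Lemma height_out_const n :
    (forall e, is_edge e -> ~~ interior e.1 -> ~~ interior (dhead e) -> grad n e = 0) ->
  n (right_face e0) = n None.
Proof.
move=> h; have [[a b] -> /= /orP[p0|p0]] := right_face_out.
  apply: height_const_west => a' ha; apply: eq_west => v vE ee; apply: h => //.
    by rewrite /interior vE /=; lia.
  by rewrite /interior (pos_dhead ee) /= vE /=; lia.
apply: height_const_south => b' hb; apply: eq_south => v vE ee; apply: h => //.
  by rewrite /interior vE /=; lia.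
by rewrite /interior (pos_dhead ee) /= vE /=; lia.
Qed.

Lemma lowered_None n T : n None = 0 -> lowered n T None = - (~~ (0 <= level n))%:Z.
Proof. by move=> n0; rewrite ffunE !inE n0 /= sub0r -ltNge. Qed.

Lemma lowered_right n T : level_dart n e0 -> lowered n T (right_face e0) = n (right_face e0).
Proof. by move=> /and3P[_ h _]; rewrite ffunE high_le// subr0. Qed.

(* Outside the quadrant the flow is a gradient, which gives the height to the
   right of e0; the walk can then be replayed, since the flow through a visited
   dart is still the gradient of n. *)
Lemma escape_flow_inj r n1 n2 T1 T2 :
    n1 None = 0 -> n2 None = 0 -> (0 <= level n1) = r -> (0 <= level n2) = r ->
    level_dart n1 e0 -> level_dart n2 e0 -> escapes n1 T1 -> escapes n2 T2 ->
    (forall e, is_edge e -> escape_flow n1 T1 e = escape_flow n2 T2 e) ->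
  n1 = n2.
Proof.
move=> n10 n20 l1 l2 q1 q2 E1 E2 JJ.
have lN : lowered n1 T1 None = lowered n2 T2 None by rewrite !lowered_None// l1 l2.
have nr : n1 (right_face e0) = n2 (right_face e0).
  rewrite -(lowered_right T1 q1) -(lowered_right T2 q2).
  pose D : height L := [ffun f => lowered n1 T1 f - lowered n2 T2 f].
  suff : D (right_face e0) = D None by rewrite [LHS]ffunE [RHS]ffunE lN; lia.
  apply: height_out_const => e ee o1 o2; have := JJ e ee.
  have out n T : escapes n T -> interface n T e = false /\ interface n T (drev e) = false.
    move=> hE; split; apply/negP => /(interface_interior hE); rewrite /= ?dhead_drev//;
    by rewrite (negbTE o1) (negbTE o2).
  rewrite /escape_flow /circ; have [-> ->] := out _ _ E1; have [-> ->] := out _ _ E2.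
  rewrite /grad !subrr !addr0 => h; rewrite [D _]ffunE [X in _ - X]ffunE; lia.
have lv : level n1 = level n2 by rewrite /level nr.
have W t : (t <= T1)%N -> (t <= T2)%N -> walk n1 t = walk n2 t /\
    n1 (right_face (walk n1 t)) = n2 (right_face (walk n1 t)).
  elim: t => [//|t IH] t1 t2; have [wE rE] := IH (ltnW t1) (ltnW t2).
  have lE : n1 (left_face (walk n1 t)) = n2 (left_face (walk n1 t)).
    have [ee|ee] := boolP (is_edge (walk n1 t)); last first.
      by rewrite left_face_nedge// n10 n20.
    have := JJ _ ee; rewrite [LHS]escape_flow_visited// [in RHS]wE escape_flow_visited -?wE//.
    by rewrite /grad; lia.
  rewrite !iterS -wE /step /level_dart -lv -rE -lE; split => //.
  case h : [&& _, _ & _]; last by case: (walk n1 t) lE => v d; rewrite right_face_rot.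
  by rewrite right_face_dhead//; case/and3P: h.
(* The walks agree up to the smaller exit time, at which both are at [y]; the other one has then
   left the interior as well. *)
have TT : T1 = T2.
  have le n n' T T' : (forall t, (t <= T)%N -> (t <= T')%N -> walk n t = walk n' t) ->
      escapes n T -> escapes n' T' -> (T' <= T)%N.
    move=> ww [T0 _ wT] [_ h' _]; rewrite leqNgt; apply/negP => lt.
    by have := h' T; rewrite -ww ?(ltnW lt)// wT (negbTE y_out) T0 lt => /(_ isT).
  apply/eqP; rewrite eqn_leq; apply/andP; split; last first.
    by apply: (le n1 n2) => // t h1 h2; case: (W t h1 h2).
  by apply: (le n2 n1) => // t h1 h2; case: (W t h2 h1).
move: E2 JJ lN W; rewrite -{T2}TT => E2 JJ lN W.
have nn : {in explored n1 T1, n1 =1 n2}.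
  have nl t : (t < T1)%N -> n1 (left_face (walk n1 t)) = n2 (left_face (walk n1 t)).
    move=> tT; have [wE rE] := W t (ltnW tT) (ltnW tT).
    have [ee|ee] := boolP (is_edge (walk n1 t)); last first.
      by rewrite left_face_nedge// n10 n20.
    have := JJ _ ee; rewrite [LHS]escape_flow_visited// [in RHS]wE escape_flow_visited -?wE//.
    by rewrite /grad; lia.
  move=> f; rewrite inE => /orP[/orP[/eqP->|/eqP->//]|]; first by rewrite n10 n20.
  by move=> /mapP[e /trajectP[t tT ->] ->]; exact: nl.
have sE := eq_explored nn q1; have tE := eq_trace nn q1.
have hE : high n2 T1 = high n1 T1.
  apply/setP => f; rewrite !inE -lv; have := sE; rewrite /explored => /setP/(_ f).
  rewrite !inE => ->; case fS : (_ || _) => //=.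
  by rewrite nn// inE.
have lowE : lowered n1 T1 = lowered n2 T1.
  apply: (@grad_inj _ _ _ None) => // e /andP[ee _].
  have iE e' : interface n1 T1 e' = interface n2 T1 e'.
    rewrite /interface tE; case h : (_ \in _) => //=; rewrite /level_dart.
    have h' : interface n1 T1 e' = level_dart n1 e' by rewrite /interface h.
    case/trajectP: h => t tT ->; rewrite -lv !nn ?left_explored//.
    by apply: right_explored => //; exact: ltnW.
  by have := JJ e ee; rewrite /escape_flow /circ !iE; lia.
apply/ffunP => f; have /ffunP/(_ f) := lowE.
by rewrite !ffunE hE; lia.
Qed.

Lemma escapes_uniq n T T' : escapes n T -> escapes n T' -> T = T'.
Proof.
move=> [T0 h hT] [T0' h' hT']; apply/eqP; rewrite eqn_leq.
apply/andP; split; rewrite leqNgt; apply/negP => lt.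
  by have := h T'; rewrite hT' (negbTE y_out) T0' lt => /(_ isT).
by have := h' T; rewrite hT (negbTE y_out) T0 lt => /(_ isT).
Qed.

Definition exit_time n : nat := xget 0%N [set T | escapes n T].

Lemma exit_timeP n T : escapes n T -> exit_time n = T.
Proof.
move=> h; apply: (escapes_uniq _ h).
exact: (xgetPex 0%N (ex_intro [set T | escapes n T] T h)).
Qed.

Definition edge_flow n : {ffun edge L -> int} :=
  [ffun e => escape_flow n (exit_time n) (val e)].

Section Mass.
Context {R : realType}.
Variable U : int -> R.
Hypothesis convU : convex_interaction U.
Hypothesis gaussU : annealed_gaussian U.
Hypothesis sumU : summable_interaction U.
Local Notation W := (boltzmann U).

(* Once the explored faces are pinned, lowering the high ones only changes the
   factors of the edges off the interface, and increases their sum. *)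
Lemma escape_mass r :
  (\esum_(n in escape_event r) (height_weight U n)%:E <=
   \esum_(n in escape_event r) (current_weight U (edge_flow n))%:E)%E.
Proof.
(* The fibres fix the explored set and the heights on it; the value 0 elsewhere is only a filler. *)
pose key n : {set face L} * {ffun face L -> int} :=
  let S := explored n (exit_time n) in (S, [ffun f => if f \in S then n f else 0]).
apply: (le_esum_fiber (key := key)).
- by move=> n; rewrite lee_fin ltW// height_weight_gt0.
- by move=> n; rewrite lee_fin ltW// current_weight_gt0.
move=> n0 [n00 l0 q0 [T ET]]; have T0 := exit_timeP ET.
set S := explored n0 T; set Hi := high n0 T.
have NS : None \in S by rewrite inE eqxx.
have rS : right_face e0 \in S by rewrite inE eqxx orbT.
have lS : left_face e0 \in S by apply: (@left_explored _ _ 0%N); case: ET.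
have levE n : {in S, n0 =1 n} -> level n = level n0 by move=> h; rewrite /level h.
have fiberE : escape_event r `&` [set n | key n = key n0] =
    [set n : height L | {in S, forall f, n f = n0 f}].
  apply/seteqP; split => n /=.
    move=> [_ [SE /ffunP nE] f fS]; have := nE f.
    by rewrite !ffunE SE T0 -/S fS.
  move=> nn; have nn' : {in S, n0 =1 n} by move=> f /nn.
  have ET' := eq_escapes nn' q0 ET; have tE := exit_timeP ET'.
  split; first by split; rewrite ?levE ?nn//; [rewrite /level_dart levE ?nn|exists T].
  rewrite /key tE T0 (eq_explored nn' q0); congr pair; apply/ffunP => f; rewrite !ffunE.
  by case: ifP => // /nn.
rewrite fiberE.
(* Interface edges, in either direction, are set apart: their factors equal the constant [c] on the
   whole fibre, both for the height and for the flow. *)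
pose pr : pred (edge L) := fun e : edge L => ~~ (interface n0 T (val e) || interface n0 T (drev (val e))).
have prS (e : edge L) : ~~ pr e -> left_face (val e) \in S /\ right_face (val e) \in S.
  have /andP[ee _] := valP e; have hs f : f \in Hi -> f \in S by rewrite inE => /andP[].
  rewrite negbK => /orP[] /(interface_faces q0)[/hs h1 /setDP[h2 _]] //.
  by rewrite left_face_drev// in h1; rewrite right_face_drev// in h2.
pose c : R := \prod_(e : edge L | ~~ pr e) W (n0 (left_face (val e)) - n0 (right_face (val e))).
have c0 : 0 <= c by apply: prodr_ge0 => e _; exact: boltzmann_ge0.
pose low (n : height L) : height L := [ffun f => n f - (f \in Hi)%:Z].
pose P (n : height L) : R :=
  \prod_(e : edge L | pr e) W (n (left_face (val e)) - n (right_face (val e))).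
have P0 n : (0 <= (P n)%:E)%E by rewrite lee_fin prodr_ge0// => e _; exact: boltzmann_ge0.
have cE (n : height L) : {in S, forall f, n f = n0 f} ->
    \prod_(e : edge L | ~~ pr e) W (n (left_face (val e)) - n (right_face (val e))) = c.
  by move=> nn; apply: eq_bigr => e /prS[hl hr]; rewrite !nn.
rewrite (@eq_esum _ _ _ _ (fun n => c%:E * (P n)%:E)%E); last first.
  move=> n nn; rewrite -EFinM -(cE n nn) height_weightE; congr EFin.
  by rewrite (bigID pr) /= mulrC.
rewrite [leRHS](@eq_esum _ _ _ _ (fun n => c%:E * (P (low n))%:E)%E); last first.
  move=> n nn; have nn' : {in S, n0 =1 n} by move=> f /nn.
  have tE : exit_time n = T by apply/exit_timeP/(eq_escapes nn' q0).
  rewrite -EFinM; congr EFin.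
  have trE := eq_trace nn' q0.
  have iE e : interface n T e = interface n0 T e.
    rewrite /interface trE; case h : (_ \in _) => //=; rewrite /level_dart levE//.
    by case/trajectP: h => t tT ->; rewrite !nn ?left_explored ?right_explored// ltnW.
  have hE : high n T = Hi.
    apply/setP => f; rewrite !in_high (eq_explored nn' q0) levE//.
    by case fS : (f \in _) => //=; rewrite nn.
  have qn : level_dart n e0 by rewrite /level_dart levE ?nn.
  rewrite /current_weight (bigID pr) /= mulrC -(cE n nn); congr (_ * _).
    apply: eq_bigr => e; rewrite negbK ffunE tE -!iE => /orP[h|h].
      by rewrite escape_flow_interface.
    have /andP[ee _] := valP e.
    have /= := escape_flow_interface qn h.
    rewrite escape_flow_antisym// antisym_grad// => /oppr_inj ->//.
  apply: eq_bigr => e; rewrite {1}/pr negb_or -!iE ffunE tE => /andP[h h'].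
  rewrite /escape_flow /circ (negbTE h) (negbTE h') subrr addr0 /grad.
  by rewrite /lowered hE.
rewrite !esumZl//; apply: lee_wpmul2l; first by rewrite lee_fin.
pose Z (v : face L -> int) := pinned_sum (fun e : edge L => left_face (val e))
  (fun e : edge L => right_face (val e)) pr W S v.
apply: (@le_trans _ _ (Z (fun f => n0 f - (f \in Hi)%:Z))).
  rewrite -[leLHS]/(Z n0); apply: (@pinned_sum_attraction _ _ _ _ _ _ _ _ _ _ _ _ _ _ _ (level n0)).
  - by move=> q; exact: boltzmann_gt0.
  - exact: boltzmannN.
  - exact: boltzmann_mono.
  - exact: boltzmann_swap.
  - by move=> v; apply: pinned_sum_lty => //; apply/set0Pn; exists None.
  - by move=> f fS; rewrite !inE; move: fS; rewrite inE => ->.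
pose up (n : height L) : height L := [ffun f => n f + (f \in Hi)%:Z].
have lowK n : low (up n) = n by apply/ffunP => f; rewrite !ffunE addrK.
rewrite /Z /pinned_sum [leLHS](@eq_esum _ _ _ _ (fun n => (P (low (up n)))%:E)); last first.
  by move=> n _; rewrite lowK.
apply: (@le_esum_inj _ _ _ _ _ up (fun n => (P (low n))%:E)) => //.
  by move=> n n' _ _ nn'; rewrite -(lowK n) nn' lowK.
by move=> n h f fS; rewrite ffunE h// subrK.
Qed.

Lemma escape_le_sourced_sum r N0 (B : R) : 0 <= B ->
    (forall N, (N0 <= N)%N -> sourced_sum U e0.1 y N <= B) ->
  (\esum_(n in escape_event r) (height_weight U n)%:E <= B%:E)%E.
Proof.
move=> B0 h; apply: le_trans (escape_mass r) _.
pose D (j : {ffun edge L -> int}) :=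
  [forall v, divergence j v == (v == e0.1)%:Z - (v == y)%:Z].
apply: (@le_trans _ _ (\esum_(j in [set j | D j]) (current_weight U j)%:E)%E); last first.
  apply: (@esum_flow_le _ _ _ _ N0) => // N /h; apply: le_trans.
  rewrite /sourced_sum le_eqVlt; apply/orP; left; apply/eqP/eq_bigl => m.
  by apply: eq_forallb => v; congr (_ == _); apply: eq_bigr => e _; rewrite ffunE.
apply: (@le_esum_inj _ _ _ _ _ edge_flow (fun j => (current_weight U j)%:E)) => //.
- move=> n1 n2; rewrite !inE => -[n10 l1 q1 [T1 E1]] [n20 l2 q2 [T2 E2]] /ffunP JJ.
  apply: (@escape_flow_inj r n1 n2 T1 T2) => //.
  have uE (e : dart L) : uedge e -> escape_flow n1 T1 e = escape_flow n2 T2 e.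
    move=> ue; have := JJ (exist _ e ue).
    by rewrite !ffunE/= (exit_timeP E1) (exit_timeP E2).
  move=> e ee; have [/uE//|ue] := boolP (uedge e).
  apply: oppr_inj; rewrite -!escape_flow_antisym//; apply: uE.
  by rewrite uedge_drev.
- move=> n [n0 l q [T E]]; apply/forallP => v; apply/eqP.
  rewrite -(outflow_escape v q E) outflow_uedge; last exact: escape_flow_antisym.
  by rewrite big_edge; apply: eq_bigr => e _; rewrite ffunE (exit_timeP E).
- by move=> j; rewrite lee_fin ltW// current_weight_gt0.
Qed.

End Mass.
End Exploration.

(** * Excursions of loops into the quadrant *)

Section Excursions.
Variables (L : nat) (n : height L) (k : int).
Implicit Types (e : dart L) (v : vertex L) (l : {set dart L}).
Local Notation q := (k%:~R + 1 / 2 : rat).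
Local Notation next := (next_qedge n q).

Definition enters e : bool := [&& is_edge e, ~~ interior e.1 & interior (dhead e)].
Definition exits e : bool := [&& is_edge e, interior e.1 & ~~ interior (dhead e)].

Lemma entersE e : enters e = is_edge e &&
  ([&& e.2 == 1, (pos e.1).2 == 0 & 0 < (pos e.1).1] ||
   [&& e.2 == 0, (pos e.1).1 == 0 & 0 < (pos e.1).2]).
Proof.
rewrite /enters; case ee : (is_edge e) => //=; rewrite /interior (pos_dhead ee).
by case: e {ee} => v d /=; case: (pos v) => a b; elim/Z4_case: d => /=; lia.
Qed.

Lemma exitsE e : exits e = is_edge e &&
  ([&& e.2 == 3%:R, (pos e.1).2 == 1 & 0 < (pos e.1).1] ||
   [&& e.2 == 2%:R, (pos e.1).1 == 1 & 0 < (pos e.1).2]).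
Proof.
rewrite /exits; case ee : (is_edge e) => //=; rewrite /interior (pos_dhead ee).
by case: e {ee} => v d /=; case: (pos v) => a b; elim/Z4_case: d => /=; lia.
Qed.

Definition excursion e m : Prop :=
  [/\ enters e, forall i, (0 < i <= m)%N -> interior (iter i next e).1
    & ~~ interior (dhead (iter m next e))].

Let tail_next e : qedge n q e -> (next e).1 = dhead e.
Proof. by move=> he; rewrite next_qedgeE. Qed.

Let iter_inj i e e' : qedge n q e -> qedge n q e' ->
  iter i next e = iter i next e' -> e = e'.
Proof.
move=> he he'; elim: i => //= i IH h; apply: IH; apply: (@next_qedge_inj _ n k) => //;
exact: iter_qedge.
Qed.

(** If the line never left the interior, it could not return to its entry, whose tail is outside. *)
Lemma excursion_exists e : qedge n q e -> enters e -> exists m, excursion e m.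
Proof.
move=> he ee.
have ex : exists m, ~~ interior (dhead (iter m next e)).
  apply: contrapT => no; have := looping_order next e => /trajectP[i io].
  have [j ->] : exists j, order next e = (i + j.+1)%N.
    by exists (order next e - i).-1; lia.
  rewrite iterD => /esym /(@iter_inj i e (iter j.+1 next e) he).
  move=> /(_ (iter_qedge _ he)) eE; have /and3P[_ /negP h _] := ee; apply: h.
  rewrite eE iterS tail_next ?iter_qedge//; apply: contrapT => /negP h; apply: no.
  by exists j.
exists (ex_minn ex); case: ex_minnP => m hm least; split => // -[//|i] /= im.
rewrite tail_next ?iter_qedge//; apply/negPn/negP => /least; lia.
Qed.

(** Run backwards from a common exit, the longer excursion would contain the entry of the shorter
    one after its start, where all tails are interior. *)
Lemma excursion_inj e e' m m' : qedge n q e -> qedge n q e' -> excursion e m ->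
  excursion e' m' -> iter m next e = iter m' next e' -> e = e'.
Proof.
wlog mm : e e' m m' / (m <= m')%N => [h|] he he' E E' eq.
  have [mm|/ltnW mm] := leqP m m'; first exact: (h _ _ _ _ mm).
  by apply/esym; apply: (h _ _ _ _ mm).
have m'E : m' = (m + (m' - m))%N by lia.
move: eq; rewrite {1}m'E iterD => /(iter_inj he (iter_qedge _ he')).
case d : (m' - m)%N => [//|i] eE; case: E => /and3P[_ /negP h _] _ _.
by case: E' => _ h' _; case: h; rewrite eE; apply: h'; lia.
Qed.

Section Loop.
Variable e1 : dart L.
Hypothesis he1 : qedge n q e1.
Let l : {set dart L} := [set e | fconnect next e1 e]%SET.

Let lq e : e \in l -> qedge n q e. Proof. exact: loop_qedge. Qed.
Let le e : e \in l -> is_edge e. Proof. by move=> /lq /qedge_edge. Qed.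

Lemma loop_eq e : e \in l -> l = [set e' | fconnect next e e']%SET.
Proof.
move=> /[dup] /lq he; rewrite inE => e1e; apply/setP => e'; rewrite !inE.
apply/idP/idP => h; last exact: connect_trans e1e h.
apply: connect_trans h.
by rewrite (fconnect_sym_in _ (@next_qedge_inj _ n k))//; exact: next_qedge_qedge.
Qed.

(* Distinct entries have distinct exits. *)
Lemma excursion_avoiding (En Ex : {set dart L}) :
    (forall e, e \in En -> e \in l /\ enters e) -> (#|Ex| < #|En|)%N ->
  exists2 e, e \in En & exists2 m, excursion e m & iter m next e \notin Ex.
Proof.
move=> hEn lt; apply: contrapT => no.
have ex e : exists m, e \in En -> excursion e m.
  have [eEn|] := boolP (e \in En); last by exists 0%N.
  have [el en] := hEn _ eEn; have [m hm] := excursion_exists (lq el) en.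
  by exists m.
have [m hm] := choice ex.
have sub : {in En, forall e, iter (m e) next e \in Ex}.
  move=> e eEn; apply/negPn/negP => h; apply: no; exists e => //.
  by exists (m e) => //; exact: hm.
have inj : {in En &, injective (fun e => iter (m e) next e)}.
  move=> e e' eEn e'En; have [el _] := hEn _ eEn; have [e'l _] := hEn _ e'En.
  by apply: excursion_inj; rewrite ?lq//; exact: hm.
move: lt; rewrite ltnNge -(card_in_imset inj) subset_leq_card//.
by apply/fintype.subsetP => _ /imsetP[e /sub h ->].
Qed.

(** The outflow of the loop, which vanishes at every vertex, is summed over the interior
    vertices. *)
Lemma card_enters_exits : #|[set e in l | enters e]%SET| = #|[set e in l | exits e]%SET|.
Proof.
suff : \sum_(e in l) ((exits e)%:Z - (enters e)%:Z) = 0.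
  rewrite sumrB -!sum1_card => h.
  have E (P : pred (dart L)) : \sum_(e in l) (P e)%:Z =
      (\sum_(e in [set e in l | P e]%SET) 1)%N%:Z.
    rewrite (big_morph Posz PoszD (erefl _)) big_mkcond [RHS]big_mkcond; apply: eq_bigr => e _.
    by rewrite inE; case: (_ \in l); case: (P e).
  by move: h; rewrite !E; lia.
have : \sum_(v | interior v) outflow (circ (loop_flow n k e1)) v = 0.
  by apply: big1 => v _; exact: outflow_loop.
under eq_bigr do rewrite outflow_circ.
rewrite exchange_big /=; apply: etrans; rewrite [LHS]big_mkcond [RHS]big_mkcond.
apply: eq_bigr => e _.
rewrite -mulr_sumr /loop_flow; have [el|] := boolP (e \in _); last by rewrite mul0r if_same.
rewrite le// mul1r sumrB.
have E w : \sum_(v | interior v) (w == v)%:Z = (interior w)%:Z.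
  have [iw|iw] := boolP (interior w).
    by rewrite (bigD1 w)//= eqxx big1 ?addr0// => v /andP[_ /negbTE]; rewrite eq_sym => ->.
  by rewrite big1// => v iv; case: eqP iv iw => // <- ->.
rewrite !E /exits /enters le//=.
by case: (interior e.1); case: (interior _).
Qed.

Lemma excursion_exits e m : e \in l -> excursion e m ->
  iter m next e \in l /\ exits (iter m next e).
Proof.
move=> el [/and3P[_ _ hh] h1 h2].
have ml : iter m next e \in l by elim: (m) => //= i; exact: loop_next.
split=> //; rewrite /exits le// h2 andbT; case: m h1 h2 {ml} => [|m] h1 h2.
  by rewrite /= hh in h2.
by apply: h1; rewrite /= leqnn.
Qed.

Hypothesis L_gt0 : (0 < L)%N.

Let sub_loop (P : pred (dart L)) : {set dart L} := [set e in l | P e]%SET.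

Let enH := sub_loop (fun e => enters e && (e.2 == 1)).
Let enV := sub_loop (fun e => enters e && (e.2 == 0)).
Let exH := sub_loop (fun e => exits e && (e.2 == 3%:R)).
Let exV := sub_loop (fun e => exits e && (e.2 == 2%:R)).

(** The half-line going east from the centre of [f0] crosses exactly the vertical edges between the
    horizontal axis and the interior of the quadrant. *)
Let winding_f0 : winding l (f0 L) = #|enH|%:Z - #|exH|%:Z.
Proof.
have [s sE cE] : exists2 s, f0 L = Some s & corner s = (0, 0).
  by apply: face_at_in => /=; lia.
rewrite sE /winding cE /=.
have E (P : pred (dart L)) : #|sub_loop P|%:Z = \sum_(e in l) (P e)%:Z.
  rewrite -sum1_card (big_morph Posz PoszD (erefl _)) big_mkcond [RHS]big_mkcond.
  by apply: eq_bigr => e _; rewrite inE; case: (_ \in l); case: (P e).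
rewrite /enH /exH !E -sumrB big_mkcondr; apply: eq_bigr => e el.
rewrite entersE exitsE le//= !natz add0r; case: e el => v d _ /=; case: (pos v) => a b.
by elim/Z4_case: d => /=; case: (0 < a); rewrite ?orbF ?andbF ?andbT ?subrr.
Qed.

(** Entries through the horizontal axis outnumber the exits through it, so one of them leads to an
    exit through the vertical axis. *)
Lemma positive_excursion : 0 < winding l (f0 L) -> exists2 e, e \in l & exists2 m,
  excursion e m & (e.2 == 1) && ((iter m next e).2 != 3%:R).
Proof.
rewrite winding_f0 => h.
have lt : (#|exH| < #|enH|)%N by lia.
have [e|e eH [m E ex]] := excursion_avoiding _ lt.
  by rewrite inE => /andP[el /andP[]].
move: eH; rewrite inE => /and3P[el en ed]; exists e => //; exists m => //.
rewrite ed; apply: contraNneq ex => d3; rewrite inE d3 eqxx andbT.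
by have [-> ->] := excursion_exits el E.
Qed.

(** As entries and exits balance in total, a deficit of entries through the horizontal axis is an
    excess through the vertical one. *)
Lemma negative_excursion : winding l (f0 L) < 0 -> exists2 e, e \in l & exists2 m,
  excursion e m & (e.2 == 0) && ((iter m next e).2 != 2%:R).
Proof.
rewrite winding_f0 => h.
have split2 (P : pred (dart L)) (d d' : 'Z_4) : d != d' ->
    (forall e, P e -> (e.2 == d) || (e.2 == d')) ->
    #|sub_loop P| = (#|sub_loop (fun e => P e && (e.2 == d))| +
                     #|sub_loop (fun e => P e && (e.2 == d'))|)%N.
  move=> dd' Pd; rewrite -cardsUI [X in (_ + X)%N]eq_card0 ?addn0.
    apply: eq_card => e; rewrite !inE -andb_orr; case Pe : (P e); last by rewrite !andbF.
    by rewrite -andb_orr Pd.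
  move=> e; rewrite !inE; apply/negP => /andP[/and3P[_ _ /eqP e2] /and3P[_ _]].
  by rewrite e2 (negbTE dd').
have := card_enters_exits; rewrite -/(sub_loop enters) -/(sub_loop exits).
rewrite (split2 enters 1 0)// => [|e]; last first.
  by rewrite entersE => /andP[_ /orP[/andP[->]|/andP[->]]]//; rewrite orbT.
rewrite (split2 exits 3%:R 2%:R)// => [|e]; last first.
  by rewrite exitsE => /andP[_ /orP[/andP[->]|/andP[->]]]//; rewrite orbT.
rewrite -/enH -/enV -/exH -/exV => bal.
have lt : (#|exV| < #|enV|)%N by lia.
have [e|e eH [m E ex]] := excursion_avoiding _ lt.
  by rewrite inE => /andP[el /andP[]].
move: eH; rewrite inE => /and3P[el en ed]; exists e => //; exists m => //.
rewrite ed; apply: contraNneq ex => d3; rewrite inE d3 eqxx andbT.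
by have [-> ->] := excursion_exits el E.
Qed.

End Loop.

(** One move of [next_qedge] is one crossing followed by at most two rotations; a further rotation
    is excluded because the successor is again a level edge. *)
Lemma next_step e0 k0 e : level e0 k0 n = k -> qedge n q e ->
  exists2 j, iter j.+1 (step e0 k0 n) e = next e &
    forall i, (0 < i <= j.+1)%N -> (iter i (step e0 k0 n) e).1 = dhead e.
Proof.
move=> lE he; have ldE e' : level_dart e0 k0 n e' = qedge n q e'.
  by rewrite qedgeE /level_dart lE.
have s1 : step e0 k0 n e = (dhead e, e.2 + 3%:R) by rewrite /step ldE he.
have rot (d : 'Z_4) : qedge n q (dhead e, d) = false ->
    step e0 k0 n (dhead e, d) = (dhead e, d + 1).
  by rewrite /step ldE => ->.
have E4 : e.2 + 3%:R + 1 = e.2.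
  by rewrite -addrA (_ : 3%:R + 1 = 0) ?addr0//; exact: val_inj.
have := next_qedge_qedge he.
rewrite /next_qedge /=; case h3 : (qedge n q (dhead e, e.2 + 3%:R)).
  by exists 0%N => //= -[|[|]]//= _; rewrite s1.
have s2 := rot _ h3; rewrite E4 in s2; case h0 : (qedge n q (dhead e, e.2)).
  by exists 1%N => /=; rewrite ?s1// => -[|[|[|]]]//= _; rewrite s1 ?s2.
have s3 := rot _ h0; case h1 : (qedge n q (dhead e, e.2 + 1)) => /=.
  by exists 2%N => /=; rewrite ?s1 ?s2// => -[|[|[|[|]]]]//= _; rewrite s1 ?s2 ?s3.
have := next_qedgeE he; rewrite /next_qedge /= h3 h0 h1 /= => eE.
by have := next_qedge_qedge he; rewrite /next_qedge /= h3 h0 h1 /= {1}eE /=;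
   case: ifP => _; rewrite ?h3//; case: ifP => _; rewrite ?h0 ?h1.
Qed.

Lemma excursion_escapes e k0 m : qedge n q e -> level e k0 n = k -> excursion e m ->
  exists T, escapes e k0 (dhead (iter m next e)) n T.
Proof.
move=> he lE [_ h _].
have [t tE ht] : exists2 t, iter t (step e k0 n) e = iter m next e &
    forall i, (0 < i <= t)%N -> interior (iter i (step e k0 n) e).1.
  elim: m h => [|m IH] h; first by exists 0%N => // -[].
  have [|t tE ht] := IH; first by move=> i im; apply: h; lia.
  have [j jE hj] := next_step lE (iter_qedge m he).
  exists (j.+1 + t)%N; first by rewrite iterD tE jE.
  move=> i it; have [le_it|lt_ti] := leqP i t; first by apply: ht; lia.
  rewrite (_ : i = (i - t) + t)%N ?iterD ?tE ?hj; [|lia|lia].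
  by have := h m.+1; rewrite iterS tail_next ?iter_qedge//; apply; rewrite /= leqnn.
exists t.+1; split => //.
rewrite iterS tE /step; have := iter_qedge m he.
by rewrite /level_dart lE -qedgeE => ->.
Qed.

End Excursions.

(** * Counting level loops by their excursions *)

Section LoopsToEscapes.
Variable L : nat.
Hypothesis L_gt0 : (0 < L)%N.
Implicit Types (n : height L) (e : dart L).

(** No edge joins the corner of the quadrant to its interior, so excursions start and end at these
    sites only. *)
Definition axis_pairs : {set vertex L * vertex L} :=
  [set xy | [&& (pos xy.1).1 == 0, 0 < (pos xy.1).2,
                (pos xy.2).2 == 0 & 0 < (pos xy.2).1]]%SET.

Lemma axis_pairs_quadrant : axis_pairs \subset quadrant_pairs L ord0.
Proof.
apply/fintype.subsetP => -[x y]; rewrite !inE /in_quadrant /quadrant_corner /=.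
move=> /and4P[/eqP x1 x2 /eqP y2 y1]; apply/and5P; split; rewrite ?x1 ?y2 ?eqxx//=.
- by apply: contraTneq y1 => <-; rewrite x1.
- exact: ltW.
- by rewrite ltW.
Qed.

Definition up_event (xy : vertex L * vertex L) (j : int) : set (height L) :=
  escape_event (xy.2, 1) j xy.1 true.

Definition right_event (xy : vertex L * vertex L) (j : int) : set (height L) :=
  escape_event (xy.1, 0) j xy.2 false.

Lemma escape_event_ge0 (e0 : dart L) j y r n : escape_event e0 j y r n -> 0 <= j.
Proof. by move=> [_ _ /and3P[_]]; rewrite /level lerDl. Qed.

(** The first edge of an excursion determines its loop, so the loops are covered by the images of
    the pairs. The relative level depends on the pair, through the height on the right of that
    edge. *)
Lemma loop_number_up n (k : int) : n None = 0 -> 0 <= k ->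
  (loop_number n (k%:~R + 1 / 2 : rat) 1 (f0 L) <=
   #|[set xy in axis_pairs | `[< up_event xy (k - n (right_face (xy.2, 1%R))) n >]]%SET|)%N.
Proof.
move=> n0 k0; pose q : rat := k%:~R + 1 / 2.
pose loop e : {set dart L} := [set e' | fconnect (next_qedge n q) e e']%SET.
apply: leq_trans (leq_imset_card (fun xy : vertex L * vertex L => loop (xy.2, 1)) _).
apply/subset_leq_card/fintype.subsetP => l; rewrite inE => /andP[/imsetP[e1]].
rewrite inE => he1 -> /andP[/eqP o1 w0].
have w1 : 0 < winding (loop e1) (f0 L).
  by move: o1; rewrite (orientation_winding he1 w0); case: sgzP.
have [e el [m E /andP[/eqP e2 ex]]] := positive_excursion he1 L_gt0 w1.
have he := loop_qedge he1 el; have [ml exm] := excursion_exits he1 el E.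
have eE : (e.1, 1) = e by rewrite -e2; case: (e).
apply/imsetP; exists (dhead (iter m (next_qedge n q) e), e.1); last first.
  by rewrite /= eE; exact: loop_eq.
rewrite !inE /=; apply/andP; split.
  have [+ _ _] := E; rewrite entersE e2 => /andP[_]; rewrite eqxx orbF /= => /andP[-> ->].
  rewrite andbT; move: exm ex; rewrite exitsE => /andP[ee]; rewrite (pos_dhead ee).
  move=> /orP[/andP[->//]|/and3P[/eqP -> h1 h2] _].
  by move: h1 h2; case: (pos _) => a b /=; lia.
have lE : level e (k - n (right_face e)) n = k by rewrite /level addrC subrK.
have qE := he; rewrite qedgeE -[X in _ <= X]lE -[X in X < _]lE in qE.
apply/asboolP; rewrite /up_event /= eE; split => //; first by rewrite lE.
exact: excursion_escapes.
Qed.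

Lemma loop_number_right n (k : int) : n None = 0 -> k < 0 ->
  (loop_number n (k%:~R + 1 / 2 : rat) (-1) (f0 L) <=
   #|[set xy in axis_pairs | `[< right_event xy (k - n (right_face (xy.1, 0%R))) n >]]%SET|)%N.
Proof.
move=> n0 k0; pose q : rat := k%:~R + 1 / 2.
pose loop e : {set dart L} := [set e' | fconnect (next_qedge n q) e e']%SET.
apply: leq_trans (leq_imset_card (fun xy : vertex L * vertex L => loop (xy.1, 0)) _).
apply/subset_leq_card/fintype.subsetP => l; rewrite inE => /andP[/imsetP[e1]].
rewrite inE => he1 -> /andP[/eqP o1 w0].
have w1 : winding (loop e1) (f0 L) < 0.
  by move: o1; rewrite (orientation_winding he1 w0); case: sgzP.
have [e el [m E /andP[/eqP e2 ex]]] := negative_excursion he1 L_gt0 w1.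
have he := loop_qedge he1 el; have [ml exm] := excursion_exits he1 el E.
have eE : (e.1, 0) = e by rewrite -e2; case: (e).
apply/imsetP; exists (e.1, dhead (iter m (next_qedge n q) e)); last first.
  by rewrite /= eE; exact: loop_eq.
rewrite !inE /=; apply/andP; split.
  have [+ _ _] := E; rewrite entersE e2 => /andP[_]; rewrite eqxx /= => /andP[-> ->] /=.
  move: exm ex; rewrite exitsE => /andP[ee]; rewrite (pos_dhead ee).
  move=> /orP[/and3P[/eqP -> h1 h2] _|/andP[->//]].
  by move: h1 h2; case: (pos _) => a b /=; lia.
have lE : level e (k - n (right_face e)) n = k by rewrite /level addrC subrK.
have qE := he; rewrite qedgeE -[X in _ <= X]lE -[X in X < _]lE in qE.
apply/asboolP; rewrite /right_event /= eE; split => //.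
  by rewrite lE; apply/negbTE; rewrite -ltNge.
exact: excursion_escapes.
Qed.

End LoopsToEscapes.

(** * Escape probabilities and spin correlations *)

Section Duality.
Context {R : realType}.
Variables (U : int -> R) (L : nat).
Hypothesis convU : convex_interaction U.
Hypothesis gaussU : annealed_gaussian U.
Hypothesis sumU : summable_interaction U.
Local Notation W := (boltzmann U).
Local Notation Zh := (fine (@height_partition R U L)).
Local Notation c2pi := ((2 * pi : R) ^+ #|vertex L|).
Local Notation spin x y := (spin_integral U (fun theta : vertex L -> R => cos (theta x - theta y))).

Lemma height_partition_fin : @height_partition R U L = Zh%:E.
Proof.
rewrite fineK// ge0_fin_numE; first exact: (esum_height_weight_lty sumU).
by apply: esum_ge0 => n _; rewrite lee_fin ltW// height_weight_gt0.
Qed.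

Lemma height_partition_gt0 : 0 < Zh.
Proof.
rewrite -lte_fin -height_partition_fin.
have h : (0 < (height_weight U ([ffun=> 0] : height L))%:E)%E by rewrite lte_fin height_weight_gt0.
apply: lt_le_trans h _; apply: esum_ge; exists [set ([ffun=> 0] : height L)].
  by split; [exact: finite_set1 | move=> _ ->; rewrite /height_configs/= ffunE].
by rewrite fsbig_set1.
Qed.

Definition edge_dart_flow (m : edge L -> int) (e : dart L) : int :=
  if insub e is Some e' then m e' else
  if insub (drev e) is Some e' then - m e' else 0.

Lemma edge_dart_flow_edge m (e : edge L) : edge_dart_flow m (val e) = m e.
Proof. by rewrite /edge_dart_flow valK. Qed.

Lemma antisym_edge_dart_flow m : antisym (edge_dart_flow m).
Proof.
move=> e ee; rewrite /edge_dart_flow drevK//.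
have ue := uedge_drev ee.
have [ie|ie] := boolP (uedge e).
  rewrite insubN; last by rewrite -topredE/= ue ie.
  by rewrite (insubT (fun e => e \in @uedge L) ie).
have ie' : drev e \in @uedge L by rewrite -topredE/= ue.
by rewrite (insubN _ ie) (insubT (fun e => e \in @uedge L) ie') opprK.
Qed.

(** A current without source is the gradient of its potential, a height vanishing on the outer face.
    This bounds the spin partition function from above in terms of that of the heights. *)
Lemma sourced_sum_le_partition (x : vertex L) N : sourced_sum U x x N <= Zh.
Proof.
rewrite -lee_fin -height_partition_fin /sourced_sum.
pose D (m : current L N) := [forall v, divergence (cval m) v == (v == x)%:Z - (v == x)%:Z].
pose h (m : current L N) : height L := potential (edge_dart_flow (cval m)).
have out m : D m -> forall v, outflow (edge_dart_flow (cval m)) v = 0.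
  move=> /forallP dm v; rewrite outflow_uedge; last exact: antisym_edge_dart_flow.
  rewrite big_edge; under eq_bigr do rewrite edge_dart_flow_edge.
  by move: (dm v); rewrite subrr => /eqP.
have hE m (e : edge L) : D m -> grad (h m) (val e) = cval m e.
  move=> dm; have /andP[ee _] := valP e.
  by rewrite grad_potential ?edge_dart_flow_edge//; [exact: antisym_edge_dart_flow|exact: out].
rewrite -/(D _) -sumEFin big_mkcond -(@esum_fintype _ _ (fun m =>
  if D m then (current_weight U (cval m))%:E else 0%E)); last first.
  by move=> m; case: ifP => // _; rewrite lee_fin ltW// current_weight_gt0.
have -> : (\esum_(m in [set: current L N]) (if D m then (current_weight U (cval m))%:E else 0) =
    \esum_(m in [set m : current L N | D m]) (height_weight U (h m))%:E)%E.
  rewrite [RHS]esum_mkcond; apply: eq_esum => m _.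
  have -> : (m \in [set m | D m]) = D m by apply/idP/idP; rewrite inE.
  case: ifPn => // dm; congr EFin; rewrite height_weightE; apply: eq_bigr => e _.
  by rewrite -hE.
apply: (@le_esum_inj _ _ _ _ _ h (fun n => (height_weight U n)%:E)).
- move=> m m'; rewrite !inE => dm dm' hh; apply/ffunP => e; apply: val_inj.
  have := hE m e dm; rewrite hh hE// /cval.
  by case: (m e) => a ha; case: (m' e) => b hb /=; lia.
- by move=> m _; rewrite /height_configs /= /h ffunE.
- by move=> n; rewrite lee_fin ltW// height_weight_gt0.
Qed.

Lemma sourced_sum_ge0 (x y : vertex L) N : 0 <= sourced_sum U x y N :> R.
Proof. by apply: sumr_ge0 => m _; rewrite ltW// current_weight_gt0. Qed.

Lemma sourced_sum_ge_boltzmann0 (x : vertex L) N : W 0 ^+ #|edge L| <= sourced_sum U x x N.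
Proof.
pose m0 : current L N := [ffun=> inord N].
have m00 e : cval m0 e = 0 by rewrite /cval ffunE inordK ?subrr// ltnS -addnn leq_addr.
rewrite /sourced_sum (bigD1 m0) /=; last first.
  apply/forallP => v; rewrite subrr; apply/eqP; rewrite /divergence big1// => e _.
  by rewrite m00 mul0r.
rewrite -[leLHS]addr0; apply: lerD; last first.
  by apply: sumr_ge0 => m _; rewrite ltW// current_weight_gt0.
by rewrite /current_weight; under eq_bigr do rewrite m00; rewrite prodr_const.
Qed.

Let c0 : 0 < c2pi. Proof. by rewrite exprn_gt0// mulr_gt0// pi_gt0. Qed.

Lemma spin_integral_le_partition x : spin x x <= c2pi * Zh.
Proof.
apply/ler_addgt0Pr => e /(spin_integral_approx gaussU sumU x x)[N h].
have := h N (leqnn _); have := sourced_sum_le_partition x N.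
rewrite -(ler_pM2l c0) ler_norml.
by move: (c2pi * Zh) (c2pi * sourced_sum _ _ _ _) (spin x x) => a b t; lra.
Qed.

Lemma spin_integral_gt0 x : 0 < spin x x.
Proof.
have a0 : 0 < W 0 ^+ #|edge L| by rewrite exprn_gt0// boltzmann_gt0.
have e0 : 0 < c2pi * W 0 ^+ #|edge L| / 2 by rewrite divr_gt0// mulr_gt0.
have [N h] := spin_integral_approx gaussU sumU x x e0.
have := h N (leqnn _); have := sourced_sum_ge_boltzmann0 x N.
rewrite -(ler_pM2l c0) ler_norml; move: e0 {h a0}.
move: (W 0 ^+ _) (sourced_sum _ _ _ _) (spin x x) => w s t.
by move: (c2pi * w) (c2pi * s) => a b; lra.
Qed.

Lemma spin_expectationE x y :
  spin_expectation U (fun theta : vertex L -> R => cos (theta x - theta y)) =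
  spin x y / spin x x.
Proof.
congr (_ / spin_integral U _); apply/funext => theta; by rewrite subrr cos0.
Qed.

Lemma spin_expectation_ge0 x y :
  0 <= spin_expectation U (fun theta : vertex L -> R => cos (theta x - theta y)).
Proof.
rewrite spin_expectationE divr_ge0 ?(ltW (spin_integral_gt0 x))//.
apply/ler_addgt0Pr => e /(spin_integral_approx gaussU sumU x y)[N h].
have := h N (leqnn _); have := mulr_ge0 (ltW c0) (sourced_sum_ge0 x y N).
by rewrite ler_norml; move: (c2pi * _) (spin x y) => a t; lra.
Qed.

Lemma spin_expectation_le1 x y :
  spin_expectation U (fun theta : vertex L -> R => cos (theta x - theta y)) <= 1.
Proof.
rewrite spin_expectationE ler_pdivrMr ?spin_integral_gt0// mul1r.
exact: le_spin_integral.
Qed.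

(** The flow bound compares with the unnormalized spin integral; since the spin partition function
    is at most [c2pi * Zh], replacing the denominator goes in the right direction. *)
Lemma escape_le_spin (e0 : dart L) k0 y r :
    is_edge e0 -> ~~ interior e0.1 -> interior (dhead e0) -> ~~ interior y ->
  (\esum_(n in escape_event e0 k0 y r) (height_weight U n)%:E <=
   (spin_expectation U (fun theta : vertex L -> R => cos (theta e0.1 - theta y)) * Zh)%:E)%E.
Proof.
move=> h1 h2 h3 h4; set x := e0.1.
have aZ : spin x y / c2pi <= spin_expectation U
    (fun theta : vertex L -> R => cos (theta x - theta y)) * Zh.
  rewrite spin_expectationE -mulrA; apply: ler_wpM2l.
    have := spin_expectation_ge0 x y; rewrite spin_expectationE pmulr_lge0//.
    by rewrite invr_gt0 spin_integral_gt0.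
  rewrite [leRHS]mulrC ler_pdivlMr ?spin_integral_gt0// mulrC ler_pdivrMr//.
  by rewrite [leRHS]mulrC; exact: spin_integral_le_partition.
apply/lee_addgt0Pr => e e_gt0; rewrite -EFinD.
have ce0 : 0 < e * c2pi by rewrite mulr_gt0.
have [N0 h] := spin_integral_approx gaussU sumU x y ce0.
apply: (@escape_le_sourced_sum _ e0 h1 h2 h3 k0 y h4 _ _ convU gaussU sumU r N0).
  by apply: addr_ge0; [rewrite mulr_ge0 ?spin_expectation_ge0 ?(ltW height_partition_gt0)|exact: ltW].
move=> N /h{}h; apply: (@le_trans _ _ (spin x y / c2pi + e)); last by rewrite lerD2r.
rewrite -lerBlDr ler_pdivlMr// mulrBl [X in X - _]mulrC.
by move: h; rewrite ler_norml; move: (c2pi * _) (_ * c2pi) (spin x y) => a b t; lra.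
Qed.

End Duality.

Lemma esum_geometric_le (R : realType) (r : R) : 0 <= r < 1 ->
  (\esum_(i in [set: nat]) (r ^+ i)%:E <= ((1 - r)^-1)%:E)%E.
Proof.
move=> /andP[r0 r1]; rewrite -nneseries_esumT; last first.
  by move=> n; rewrite lee_fin exprn_ge0.
apply: lime_le; first by apply: is_cvg_nneseries => n _ _; rewrite lee_fin exprn_ge0.
apply: nearW => N; rewrite sumEFin lee_fin big_mkord.
rewrite -[leRHS]mul1r ler_pdivlMr ?subr_gt0// mulrC.
have -> : (1 - r) * \sum_(i < N) r ^+ i = 1 - r ^+ N.
  by rewrite -opprB mulNr -subrX1 opprB.
by rewrite gerBl exprn_ge0.
Qed.

(** * Tails of the gradient *)

Section Gradient.
Context {R : realType}.
Variable U : int -> R.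
Hypothesis convU : convex_interaction U.
Hypothesis gaussU : annealed_gaussian U.
Hypothesis sumU : summable_interaction U.
Local Notation W := (boltzmann U).

(** Summability excludes a constant [W], so there is a strict drop at some [j0]; by log-concavity
    the later ratios are no larger than this one. *)
Lemma boltzmann_decay : exists rho C : R, [/\ 0 < rho, rho < 1, 0 < C &
  forall j : nat, W j <= C * rho ^+ j].
Proof.
have W0 j : 0 < W j by exact: boltzmann_gt0.
have [j0 lt0] : exists j0 : nat, W j0.+1 < W j0.
  apply: contrapT => no; have const (j : nat) : W j = W 0.
    elim: j => // j IH; apply/eqP; rewrite -IH eq_le; apply/andP; split.
      by apply: boltzmann_mono => //; lia.
    by rewrite leNgt; apply/negP => lt; apply: no; exists j.
  have [M hM] := symmetric_sum_bounded sumU.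
  have h N : N.*2.+1%:R * W 0 <= M.
    apply: le_trans (hM N); rewrite /symmetric_sum mulr_natl.
    have -> : W 0 *+ N.*2.+1 = \sum_(k < N.*2.+1) W 0 by rewrite sumr_const card_ord.
    apply: ler_sum => k _; set z := (_ - _); have := const (absz z).
    by rewrite -[W `|z|%N]/(W (`|z|%N%:Z)) abszE (boltzmann_norm gaussU) => ->.
  have [N hN] : exists N : nat, M / W 0 < N%:R.
    by exists (Num.truncn (M / W 0)).+1; exact: truncnS_gt.
  have := h N; rewrite leNgt => /negP; apply; rewrite -ltr_pdivrMr//.
  by apply: lt_le_trans hN _; rewrite ler_nat; lia.
pose rho := W j0.+1 / W j0.
have rho0 : 0 < rho by rewrite divr_gt0.
have rho1 : rho < 1 by rewrite ltr_pdivrMr// mul1r.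
have ratio (i : nat) : W (j0 + i)%N <= W j0 * rho ^+ i.
  elim: i => [|i IH]; first by rewrite addn0 mulr1.
  have : W (j0 + i.+1)%N * W j0 <= W (j0 + i)%N * W j0.+1.
    have := @boltzmann_swap _ _ convU (j0 + i.+1)%:Z j0.+1%:Z 0 1.
    rewrite !subr0; move=> /(_ _)/le_trans h.
    have E1 : (j0.+1%:Z - 1) = j0%:Z by lia.
    have E2 : ((j0 + i.+1)%:Z - 1) = (j0 + i)%:Z by lia.
    by rewrite E1 E2 in h; apply: h => //; lia.
  rewrite -ler_pdivlMr// => /le_trans; apply.
  by rewrite -[leLHS]mulrA -/rho exprSr [leRHS]mulrA ler_pM2r.
have rhoj0 : 0 < rho ^+ j0 by rewrite exprn_gt0.
(* Dividing by [rho ^+ j0] absorbs the indices up to [j0], where only [W j <= W 0] is known. *)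
exists rho, (W 0 / rho ^+ j0); split => //; first by rewrite divr_gt0.
move=> j; rewrite mulrAC ler_pdivlMr//.
have [jj|jj] := leqP j0 j.
  rewrite -(subnKC jj); apply: (@le_trans _ _ (W j0 * rho ^+ (j - j0) * rho ^+ j0)).
    by rewrite ler_pM2r.
  rewrite -mulrA -exprD addnC; apply: ler_wpM2r; first by rewrite exprn_ge0// ltW.
  by apply: boltzmann_mono => //; lia.
apply: ler_pM; rewrite ?(ltW rhoj0) ?(ltW (W0 _))//.
  by apply: boltzmann_mono => //; lia.
by apply: ler_wiXn2l; rewrite ?(ltW rho0) ?(ltW rho1)// ltnW.
Qed.

Variable L : nat.
Local Notation Zh := (fine (@height_partition R U L)).

(** With the difference across [e] pinned, the weight [Z i] of all other edges decreases in [i] by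
    attraction with the left face as only high face. Comparison with difference 0 leaves the ratio
    of the factors of [e]. *)
Lemma gradient_weight_le (e : edge L) (j : nat) : (0 < j)%N ->
  (\esum_(n in [set n : height L | n None = 0%R /\ grad n (val e) = j])
     (height_weight U n)%:E <= (W j / W 0 * Zh)%:E)%E.
Proof.
move=> j0; set l := left_face (val e); set r := right_face (val e).
have W0 i : 0 < W i by exact: boltzmann_gt0.
have Zh0 : 0 < Zh by exact: height_partition_gt0.
have [lr|lr] := eqVneq l r.
  rewrite esum1; first by rewrite lee_fin; apply/ltW/mulr_gt0 => //; exact: divr_gt0.
  by move=> n [_]; rewrite /grad -/l -/r lr subrr; lia.
pose pr : pred (edge L) := fun e' => e' != e.
pose S : {set face L} := [set l; r]%SET.
pose v (i : nat) f : int := if f == l then i%:Z else 0.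
pose P (n : height L) : R :=
  \prod_(e' | pr e') W (n (left_face (val e')) - n (right_face (val e'))).
pose Z i := pinned_sum (fun e : edge L => left_face (val e))
  (fun e : edge L => right_face (val e)) pr W S (v i).
have P0 n : (0 <= (P n)%:E)%E by rewrite lee_fin prodr_ge0// => e' _; exact: ltW.
have lS : l \in S by rewrite !inE eqxx.
have rS : r \in S by rewrite !inE eqxx orbT.
have vl i : v i l = i by rewrite /v eqxx.
have vr i : v i r = 0 by rewrite /v eq_sym (negbTE lr).
have wE n : height_weight U n = W (grad n (val e)) * P n.
  by rewrite height_weightE (bigD1 e).
have PE (n n' : height L) (c : int) : (forall f, n' f = n f - c) -> P n' = P n.
  by move=> h; apply: eq_bigr => e' _; rewrite !h; congr W; ring.
have Zj : (\esum_(n in [set n : height L | n None = 0%R /\ grad n (val e) = j])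
     (height_weight U n)%:E <= (W j)%:E * Z j)%E.
  rewrite -esumZl ?(ltW (W0 _))//.
  pose phi (n : height L) : height L := [ffun f => n f - n r].
  rewrite (@eq_esum _ _ _ _ (fun n => (W j)%:E * (P (phi n))%:E)%E); last first.
    by move=> n [_ nj]; rewrite wE nj -EFinM (PE n (phi n) (n r))// => f; rewrite ffunE.
  apply: (@le_esum_inj _ _ _ _ _ phi (fun n => ((W j)%:E * (P n)%:E)%E)).
  - move=> n n'; rewrite !inE => -[n0 _] [n'0 _] /ffunP nn'; apply/ffunP => f.
    have := nn' None; have := nn' f; rewrite !ffunE n0 n'0; lia.
  - move=> n [n0 nj] f; rewrite !inE ffunE => /orP[]/eqP->; rewrite ?vl ?vr ?subrr//.
  - by move=> n; rewrite mule_ge0// lee_fin ltW.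
have Zle i : (Z i.+1 <= Z i)%E.
  apply: (@le_trans _ _ (pinned_sum (fun e : edge L => left_face (val e))
    (fun e : edge L => right_face (val e)) pr W S (fun f => v i.+1 f - (f \in [set l]%SET)%:Z))).
    apply: (@pinned_sum_attraction _ _ _ _ _ _ _ _ _ _ _ _ _ _ _ 0).
    - exact: W0.
    - exact: boltzmannN.
    - exact: boltzmann_mono.
    - exact: boltzmann_swap.
    - move=> u; apply: pinned_sum_lty => //; first by apply/set0Pn; exists l.
      by move=> e'; rewrite /pr negbK => /eqP ->.
    - by move=> f _; rewrite inE /v; case: (f == l).
  rewrite le_eqVlt; apply/orP; left; apply/eqP/eq_pinned_sum => f _.
  by rewrite inE /v; case: (f == l); lia.
have Z0j : (Z j <= Z 0%N)%E by elim: (j) => // i; exact: le_trans.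
have Z0 : ((W 0)%:E * Z 0%N <= Zh%:E)%E.
  rewrite -height_partition_fin// -esumZl ?(ltW (W0 _))//.
  pose phi (n : height L) : height L := [ffun f => n f - n None].
  rewrite (@eq_esum _ _ _ _ (fun n => (height_weight U (phi n))%:E)%E); last first.
    move=> n /= nv; rewrite -EFinM wE (PE n (phi n) (n None)) => [|f]; last by rewrite ffunE.
    have -> : grad (phi n) (val e) = 0; last by [].
    by rewrite /grad !ffunE (nv l lS) (nv r rS) vl vr; ring.
  apply: (@le_esum_inj _ _ _ _ _ phi (fun n => (height_weight U n)%:E)).
  - move=> n n'; rewrite !inE => nv nv' /ffunP nn'; apply/ffunP => f.
    have := nn' r; have := nn' f; rewrite !ffunE (nv r rS) (nv' r rS); lia.
  - by move=> n _; rewrite /height_configs /= ffunE subrr.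
  - by move=> n; rewrite lee_fin ltW// height_weight_gt0.
apply: le_trans Zj _; rewrite -mulrA EFinM; apply: lee_wpmul2l; first by rewrite lee_fin ltW.
apply: le_trans Z0j _.
have : (((W 0)^-1)%:E * ((W 0)%:E * Z 0%N) <= ((W 0)^-1)%:E * Zh%:E)%E.
  by apply: lee_wpmul2l => //; rewrite lee_fin invr_ge0 ltW.
by rewrite muleA -EFinM mulVf ?gt_eqF// mul1e -EFinM.
Qed.

Lemma gradient_tail (rho C : R) (e : edge L) (k : nat) :
    0 < rho -> rho < 1 -> 0 < C -> (forall j : nat, W j <= C * rho ^+ j) ->
  (\esum_(n in [set n : height L | n None = 0%R /\ (k%:Z < grad n (val e))%R])
     (height_weight U n)%:E <= (C / W 0 / (1 - rho) * rho ^+ k * Zh)%:E)%E.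
Proof.
move=> rho0 rho1 C0 decay; set A := [set n : height L | _].
have W0 i : 0 < W i by exact: boltzmann_gt0.
have Z0 : 0 < Zh by exact: height_partition_gt0.
rewrite (esum_fiber _ (fun n : height L => grad n (val e))); last first.
  by move=> n; rewrite lee_fin ltW// height_weight_gt0.
pose D : R := C / W 0 * rho ^+ k * Zh.
have D0 : 0 <= D by rewrite !mulr_ge0 ?invr_ge0 ?exprn_ge0// ltW.
apply: (@le_trans _ _ (\esum_(x in (fun n => grad n (val e)) @` A)
    (D%:E * (rho ^+ absz (x - k%:Z))%:E))%E).
  apply: le_esum => x [n [n0 kn] <-] /=; set a := grad n (val e) in kn *.
  have aE : a = (absz a)%:Z by lia.
  apply: (@le_trans _ _ (W (absz a) / W 0 * Zh)%:E).
    apply: le_trans (gradient_weight_le e _); last by lia.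
    apply: (@le_esum_inj _ _ _ _ _ id (fun n => (height_weight U n)%:E)).
    - by move=> ? ?.
    - by move=> m [[m0 _] /= ma]; split => //; rewrite ma.
    - by move=> m; rewrite lee_fin ltW// height_weight_gt0.
  rewrite -EFinM lee_fin /D [leRHS]mulrAC; apply: ler_wpM2r; first exact: ltW.
  rewrite -[leRHS]mulrA -exprD (_ : (k + _)%N = absz a); last by lia.
  by rewrite [leRHS]mulrAC; apply: ler_wpM2r; rewrite ?invr_ge0 ?(ltW (W0 _)).
apply: (@le_trans _ _ (\esum_(i in [set: nat]) (D%:E * (rho ^+ i)%:E))%E).
  apply: (@le_esum_inj _ _ _ _ _ (fun x : int => absz (x - k%:Z)) (fun i => (D%:E * (rho ^+ i)%:E)%E)) => //.
    move=> x x'; rewrite !inE => -[n [_ h] <-] [n' [_ h'] <-].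
    by move: (grad n _) (grad n' _) h h' => a a'; lia.
  by move=> i; rewrite -EFinM lee_fin mulr_ge0// exprn_ge0// ltW.
rewrite esumZl//; last by move=> i; rewrite lee_fin exprn_ge0// ltW.
apply: (@le_trans _ _ (D%:E * ((1 - rho)^-1)%:E)%E).
  by apply: lee_wpmul2l; rewrite ?lee_fin// esum_geometric_le// rho1 ltW.
by rewrite -EFinM lee_fin /D le_eqVlt; apply/orP; left; apply/eqP; ring.
Qed.

End Gradient.

(** * Rearranging sums over heights, levels and pairs of sites *)

Lemma exchange_esum (R : realType) (T T' : choiceType) (A : set T) (B : set T')
    (f : T -> T' -> \bar R) : (forall x y, (0 <= f x y)%E) ->
  (\esum_(x in A) \esum_(y in B) f x y = \esum_(y in B) \esum_(x in A) f x y)%E.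
Proof.
move=> f0; rewrite !esum_esum//.
apply: (@reindex_esum _ _ _ (B `*`` (fun=> A)) (A `*`` (fun=> B))
  (fun p => (p.2, p.1)) (fun p => f p.1 p.2)); split.
- by move=> [x y] /= [].
- by move=> [x y] [x' y'] _ _ /= [-> ->].
- by move=> [y x] /= [By Ax]; exists (x, y).
Qed.

Lemma esum_events_le (R : realType) (T : choiceType) (I : finType) (B : {set I})
    (H : set T) (w : T -> R) (F : T -> \bar R) (ev : I -> nat -> set T) :
    (forall n, 0 <= w n) ->
    (forall n, H n ->
      (F n <= \sum_(i in B) \esum_(j in [set: nat]) (`[< ev i j n >]%:R)%:E)%E) ->
  (\esum_(n in H) (F n * (w n)%:E) <=
   \sum_(i in B) \esum_(j in [set: nat]) \esum_(n in H `&` ev i j) (w n)%:E)%E.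
Proof.
move=> w0 hF; have w0' n : (0 <= (w n)%:E)%E by rewrite lee_fin.
have i0 i j n : (0 <= (`[< ev i j n >]%:R : R)%:E)%E by rewrite lee_fin.
pose f i n j : \bar R := ((w n)%:E * (`[< ev i j n >]%:R)%:E)%E.
have f0 i n j : (0 <= f i n j)%E by rewrite mule_ge0.
apply: (@le_trans _ _ (\esum_(n in H) \sum_(i in B) \esum_(j in [set: nat]) f i n j)%E).
  apply: le_esum => n Hn.
  apply: le_trans (lee_wpmul2r (w0' n) (hF n Hn)) _.
  rewrite ge0_sume_distrl => [|i _]; last exact: esum_ge0.
  by apply: lee_sum => i _; rewrite muleC -esumZl.
rewrite esum_sum => [|n i _ _]; last exact: esum_ge0.
apply: lee_sum => i _; rewrite exchange_esum//; apply: le_esum => j _.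
rewrite esum_mkcondr; apply: le_esum => n _; rewrite /f.
by case: asboolP => h; [rewrite (mem_set h) mule1|rewrite (memNset h) mule0].
Qed.

(** For each [i], the shift by [c i] is injective and non-negative where the event holds, so
    absolute levels can be replaced by relative ones in [nat]. *)
Lemma esum_card_le (R : realType) (I : finType) (B : {set I}) (A : set int)
    (N : int -> nat) (ev : I -> int -> bool) (c : I -> int) :
    (forall k, A k -> (N k <= #|[set i in B | ev i (k - c i)%R]%SET|)%N) ->
    (forall i j, ev i j -> 0 <= j) ->
  (\esum_(k in A) ((N k)%:R : R)%:E <=
   \sum_(i in B) \esum_(j in [set: nat]) (((ev i j%:Z)%:R : R)%:E))%E.
Proof.
move=> hN ev0.
apply: (@le_trans _ _ (\esum_(k in A) \sum_(i in B) ((ev i (k - c i))%:R : R)%:E)%E).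
  apply: le_esum => k /hN hk; rewrite sumEFin lee_fin -natr_sum ler_nat.
  apply: leq_trans hk _; rewrite -sum1_card big_mkcond [X in (_ <= X)%N]big_mkcond.
  by apply: leq_sum => i _; rewrite inE; case: (_ \in B); case: (ev _ _).
rewrite esum_sum => [|k i _ _]; last by rewrite lee_fin.
apply: lee_sum => i _.
rewrite (@eq_esum _ _ _ _ (fun k => if k \in [set k | ev i (k - c i)] then 1%E else 0%E));
  last first.
  move=> k _; case h : (ev i (k - c i)); first by rewrite mem_set.
  by rewrite memNset//= h.
rewrite -esum_mkcondr; pose g (j : nat) : \bar R := ((ev i j%:Z)%:R : R)%:E.
rewrite (@eq_esum _ _ _ _ (fun k => g (absz (k - c i)%R))); last first.
  move=> k [_ /= h]; rewrite /g; have := ev0 _ _ h; move: h.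
  by case: (k - c i) => // j /= ->.
apply: (@le_esum_inj _ _ _ _ _ (fun k => absz (k - c i)%R) g) => //.
- move=> k k'; rewrite !inE => -[_ /= /ev0 h] [_ /= /ev0 h'] hh; lia.
- by move=> j; rewrite lee_fin.
Qed.

Lemma sgz_half_pos (k : int) : (sgz (k%:~R + 1 / 2 : rat) = 1) <-> 0 <= k.
Proof.
split; last first.
  move=> k0; have h : 0 <= k%:~R :> rat by rewrite ler0z.
  by rewrite gtr0_sgz//; lra.
move=> h; rewrite leNgt; apply/negP => k0; move: h.
have : k%:~R <= -1 :> rat by rewrite -[-1]/((-1)%:~R) ler_int; lia.
by move=> h; rewrite ltr0_sgz//; lra.
Qed.

Lemma sgz_half_neg (k : int) : (sgz (k%:~R + 1 / 2 : rat) = -1) <-> k < 0.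
Proof.
split; last first.
  move=> k0; have : k%:~R <= -1 :> rat by rewrite -[-1]/((-1)%:~R) ler_int; lia.
  by move=> h; rewrite ltr0_sgz//; lra.
move=> h; rewrite ltNge; apply/negP => k0; move: h.
by rewrite (sgz_half_pos k).2.
Qed.

Lemma min_le_powR (R : realType) (a t s : R) : 0 <= a -> 0 <= t -> 0 <= s <= 1 ->
  Num.min a t <= a `^ (1 - s) * t `^ s.
Proof.
move=> a0 t0 /andP[s0 s1]; set m := Num.min a t.
have ma : m <= a by rewrite ge_min lexx.
have mt : m <= t by rewrite ge_min lexx orbT.
have : 0 <= m by rewrite le_min a0.
rewrite le_eqVlt => /predU1P[<-|m0]; first by rewrite mulr_ge0 ?powR_ge0.
have -> : m = m `^ (1 - s) * m `^ s.
  by rewrite -powRD ?subrK ?powRr1 ?(ltW m0)// (gt_eqF m0) implybT.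
by apply: ler_pM; rewrite ?powR_ge0// ge0_ler_powR ?nnegrE ?subr_ge0// ltW.
Qed.

Lemma powR_lt1 (R : realType) (x s : R) : 0 <= x -> x < 1 -> 0 < s -> x `^ s < 1.
Proof.
move=> x0 x1 s0; have := gt0_ltr_powR s0 (_ : x \in Num.nneg) (_ : 1 \in Num.nneg) x1.
by rewrite powR1 !nnegrE ler01 x0; exact.
Qed.

(** * Expected number of loops *)

Section Assembly.
Context {R : realType}.
Variable U : int -> R.
Hypothesis convU : convex_interaction U.
Hypothesis gaussU : annealed_gaussian U.
Hypothesis sumU : summable_interaction U.
Variable L : nat.
Hypothesis L_gt0 : (0 < L)%N.
Local Notation W := (boltzmann U).
Local Notation Zh := (fine (@height_partition R U L)).

Local Notation corr xy := (spin_expectation U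
  (fun theta : vertex L -> R => cos (theta xy.1 - theta xy.2))).

Let Zh0 : 0 < Zh. Proof. exact: height_partition_gt0. Qed.

Let loops (n : height L) : \bar R :=
  (total_loop_number R 1 1 (f0 L) n + total_loop_number R (-1) (-1) (f0 L) n)%E.

Let total_ge0 eta r (n : height L) : (0 <= total_loop_number R eta r (f0 L) n)%E.
Proof. by apply: esum_ge0 => k _; rewrite lee_fin. Qed.

Lemma total_loop_number_up (n : height L) : n None = 0 ->
  (total_loop_number R 1 1 (f0 L) n <=
   \sum_(xy in axis_pairs L) \esum_(j in [set: nat]) (`[< up_event xy j%:Z n >]%:R)%:E)%E.
Proof.
move=> n0; apply: (@esum_card_le _ _ _ _ _ (fun xy j => `[< up_event xy j n >])
   (fun xy => n (right_face (xy.2, 1)))) => [k /sgz_half_pos|xy j /asboolP].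
  exact: loop_number_up.
exact: escape_event_ge0.
Qed.

Lemma total_loop_number_right (n : height L) : n None = 0 ->
  (total_loop_number R (-1) (-1) (f0 L) n <=
   \sum_(xy in axis_pairs L) \esum_(j in [set: nat]) (`[< right_event xy j%:Z n >]%:R)%:E)%E.
Proof.
move=> n0; apply: (@esum_card_le _ _ _ _ _ (fun xy j => `[< right_event xy j n >])
   (fun xy => n (right_face (xy.1, 0)))) => [k /sgz_half_neg|xy j /asboolP].
  exact: loop_number_right.
exact: escape_event_ge0.
Qed.

Lemma height_le_loops (n : height L) : n None = 0 ->
  ((`|n (f0 L)|%:~R)%:E <= loops n)%E.
Proof.
move=> n0; have key (eta : int) (r : int) (phi : nat -> int) (m : nat) :
    `|n (f0 L)| = m -> injective phi ->
    (forall i : 'I_m, sgz ((phi i)%:~R + 1 / 2 : rat) = r /\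
       (0 < loop_number n ((phi i)%:~R + 1 / 2 : rat) eta (f0 L))%N) ->
    ((`|n (f0 L)|%:~R)%:E <= total_loop_number R eta r (f0 L) n)%E.
  move=> -> phi_inj h.
  pose g (k : int) : \bar R := (((loop_number n (k%:~R + 1 / 2) eta (f0 L))%:R : R)%:E).
  apply: (@le_trans _ _ (\esum_(i in [set: 'I_m]) g (phi i))%E).
    rewrite esum_fintype; last by move=> i; rewrite lee_fin.
    rewrite sumEFin lee_fin -natr_sum -[X in X <= _]/(m%:R) ler_nat.
    rewrite -[X in (X <= _)%N]card_ord -sum1_card.
    by apply: leq_sum => i _; have [] := h i.
  apply: (@le_esum_inj _ _ _ _ _ (fun i : 'I_m => phi i) g).
  - by move=> i i' _ _ /phi_inj/val_inj.
  - by move=> i _ /=; have [] := h i.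
  - by move=> k; rewrite lee_fin.
have [p0|p0] := leP 0 (n (f0 L)).
  apply: le_trans (_ : _ <= total_loop_number R 1 1 (f0 L) n)%E _; last exact: leeDl.
  apply: (key 1 1 (fun i => i%:Z) (absz (n (f0 L)))) => [|i i' []//|i]; first by rewrite abszE.
  split; first exact/sgz_half_pos.
  apply: (@loop_number_gt0 _ n i%:Z (f0 L) 1) => //; rewrite n0.
  by case: i => i hi /=; have -> : (i%:Z < n (f0 L)) by lia.
apply: le_trans (_ : _ <= total_loop_number R (-1) (-1) (f0 L) n)%E _; last exact: leeDr.
apply: (key (-1) (-1) (fun i => - i%:Z - 1) (absz (n (f0 L)))) => [|i i'|i]; first by rewrite abszE.
  lia.
split; first by apply/sgz_half_neg; lia.
apply: (@loop_number_gt0 _ n (- (i : nat)%:Z - 1) (f0 L) (-1)) => //; rewrite n0.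
case: i => i hi /=; have -> : (- i%:Z - 1 < n (f0 L)) = false by lia.
by have -> : (- i%:Z - 1 < 0) by lia.
Qed.

Let event_le (e : edge L) (k0 : nat) y r (rho C s : R) :
    0 < rho -> rho < 1 -> 0 < C -> (forall j : nat, W j <= C * rho ^+ j) -> 0 <= s <= 1 ->
    ~~ interior (val e).1 -> interior (dhead (val e)) -> ~~ interior y ->
  (\esum_(n in escape_event (val e) k0 y r) (height_weight U n)%:E <=
    (corr ((val e).1, y) `^ (1 - s) * ((C / W 0 / (1 - rho)) `^ s * (rho `^ s) ^+ k0) * Zh)%:E)%E.
Proof.
move=> rho0 rho1 C0 decay s01 h1 h2 h3; have /andP[ee _] := valP e.
have W0 : 0 < W 0 by exact: boltzmann_gt0.
set a := corr _; set C' := C / W 0 / (1 - rho).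
have C'0 : 0 <= C' by rewrite !divr_ge0// ?subr_ge0 ltW.
have a0 : 0 <= a by exact: spin_expectation_ge0.
have w0 (n : height L) : (0 <= (height_weight U n)%:E)%E by rewrite lee_fin ltW// height_weight_gt0.
have le1 : (\esum_(n in escape_event (val e) k0 y r) (height_weight U n)%:E <= (a * Zh)%:E)%E.
  exact: escape_le_spin.
have le2 : (\esum_(n in escape_event (val e) k0 y r) (height_weight U n)%:E <=
    (C' * rho ^+ k0 * Zh)%:E)%E.
  apply: le_trans (gradient_tail convU gaussU sumU e k0 rho0 rho1 C0 decay).
  apply: (@le_esum_inj _ _ _ _ _ id (fun n => (height_weight U n)%:E)) => //.
  move=> n [n0 _ /and3P[_ _]]; rewrite /level /grad => h _; split => //.
  by rewrite ltrBrDl.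
apply: (@le_trans _ _ (Num.min a (C' * rho ^+ k0) * Zh)%:E).
  by rewrite /Num.min; case: ifP.
rewrite lee_fin; apply: ler_wpM2r; first exact: ltW.
have -> : C' `^ s * (rho `^ s) ^+ k0 = (C' * rho ^+ k0) `^ s.
  rewrite powRM ?exprn_ge0 ?(ltW rho0)//; congr (_ * _).
  rewrite -(powR_mulrn k0 (ltW rho0)) -(powR_mulrn k0 (powR_ge0 rho s)) -!powRrM.
  by rewrite [s * _]mulrC.
by apply: min_le_powR => //; rewrite mulr_ge0// exprn_ge0// ltW.
Qed.

Lemma axis_pairs_up xy : xy \in axis_pairs L -> [/\ uedge (xy.2, 1), ~~ interior xy.2,
  interior (dhead (xy.2, 1)) & ~~ interior xy.1].
Proof.
case: xy => y x; rewrite inE => /and4P[/= y1 y2 x2 x1].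
have ee : is_edge (x, 1).
  rewrite is_edgeE; have := pos_in_box x; rewrite /in_box /=.
  by case: (pos x) x2 x1 => a b /=; lia.
split; rewrite /uedge ?ee//= /interior ?(pos_dhead ee)/=.
- by rewrite (eqP x2) andbF.
- by case: (pos x) x2 x1 => a b /=; lia.
- by rewrite (eqP y1).
Qed.

Lemma axis_pairs_right xy : xy \in axis_pairs L -> [/\ uedge (xy.1, 0), ~~ interior xy.1,
  interior (dhead (xy.1, 0)) & ~~ interior xy.2].
Proof.
case: xy => y x; rewrite inE => /and4P[/= y1 y2 x2 x1].
have ee : is_edge (y, 0).
  rewrite is_edgeE; have := pos_in_box y; rewrite /in_box /=.
  by case: (pos y) y1 y2 => a b /=; lia.
split; rewrite /uedge ?ee//= /interior ?(pos_dhead ee)/=.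
- by rewrite (eqP y1).
- by case: (pos y) y1 y2 => a b /=; lia.
- by rewrite (eqP x2) andbF.
Qed.

Lemma expected_loops_le (rho C s : R) :
    0 < rho -> rho < 1 -> 0 < C -> (forall j : nat, W j <= C * rho ^+ j) -> 0 < s <= 1 ->
  (height_expectation U loops <=
   (2 * ((C / W 0 / (1 - rho)) `^ s / (1 - rho `^ s)) *
    \sum_(xy in axis_pairs L) corr xy `^ (1 - s))%:E)%E.
Proof.
move=> rho0 rho1 C0 decay /andP[s0 s1]; set D := (C / _ / _) `^ s; set r := rho `^ s.
have s01 : 0 <= s <= 1 by rewrite ltW.
have r01 : 0 <= r < 1.
  by rewrite powR_ge0 /= powR_lt1// ltW.
have w0 (n : height L) : 0 <= height_weight U n by rewrite ltW// height_weight_gt0.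
have w0' (n : height L) : (0 <= (height_weight U n)%:E)%E by rewrite lee_fin.
pose B : R := D / (1 - r) * (\sum_(xy in axis_pairs L) corr xy `^ (1 - s)) * Zh.
have half (F : height L -> \bar R) (ev : vertex L * vertex L -> nat -> set (height L)) :
    (forall n : height L, n None = 0 ->
      (F n <= \sum_(xy in axis_pairs L) \esum_(j in [set: nat]) (`[< ev xy j n >]%:R)%:E)%E) ->
    (forall xy j, xy \in axis_pairs L ->
      (\esum_(n in ev xy j) (height_weight U n)%:E <=
       (corr xy `^ (1 - s) * (D * r ^+ j) * Zh)%:E)%E) ->
    (\esum_(n in @height_configs L) (F n * (height_weight U n)%:E) <= B%:E)%E.
  move=> hF hev; apply: le_trans (esum_events_le w0 hF) _.
  rewrite /B mulr_sumr mulr_suml -sumEFin; apply: lee_sum => xy xyA.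
  pose A := corr xy `^ (1 - s) * D * Zh.
  have A0 : 0 <= A by rewrite !mulr_ge0 ?powR_ge0// ltW.
  apply: (@le_trans _ _ (\esum_(j in [set: nat]) (A%:E * (r ^+ j)%:E))%E).
    apply: le_esum => j _; apply: (@le_trans _ _ (\esum_(n in ev xy j) (height_weight U n)%:E)%E).
      apply: (@le_esum_inj _ _ _ _ _ id (fun n => (height_weight U n)%:E)) => //.
      by move=> n [].
    apply: le_trans (hev _ _ xyA) _; rewrite -EFinM lee_fin /A le_eqVlt.
    by apply/orP; left; apply/eqP; ring.
  have /andP[r0 r1] := r01.
  rewrite esumZl//; last by move=> j; rewrite lee_fin exprn_ge0.
  apply: (@le_trans _ _ (A%:E * ((1 - r)^-1)%:E)%E).
    by apply: lee_wpmul2l; rewrite ?lee_fin// esum_geometric_le.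
  by rewrite -EFinM lee_fin /A le_eqVlt; apply/orP; left; apply/eqP; ring.
have up : (\esum_(n in @height_configs L)
    (total_loop_number R 1 1 (f0 L) n * (height_weight U n)%:E) <= B%:E)%E.
  apply: (half _ (fun xy j => up_event xy j%:Z)) => [n|xy j]; first exact: total_loop_number_up.
  move=> /axis_pairs_up[ue h1 h2 h3].
  pose e : edge L := exist _ (xy.2, 1) ue.
  have := @event_le e j xy.1 true rho C s rho0 rho1 C0 decay s01 h1 h2 h3.
  rewrite (_ : corr ((val e).1, xy.1) = corr xy)//.
  by congr (spin_expectation U _); apply/funext => theta /=; rewrite -cosN opprB.
have right : (\esum_(n in @height_configs L)
    (total_loop_number R (-1) (-1) (f0 L) n * (height_weight U n)%:E) <= B%:E)%E.
  apply: (half _ (fun xy j => right_event xy j%:Z)) => [n|xy j]; first exact: total_loop_number_right.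
  move=> /axis_pairs_right[ue h1 h2 h3].
  pose e : edge L := exist _ (xy.1, 0) ue.
  have := @event_le e j xy.2 false rho C s rho0 rho1 C0 decay s01 h1 h2 h3.
  by rewrite (_ : corr ((val e).1, xy.2) = corr xy).
rewrite /height_expectation lee_pdivrMr// -EFinM.
rewrite (@eq_esum _ _ _ _ (fun n => total_loop_number R 1 1 (f0 L) n * (height_weight U n)%:E +
  total_loop_number R (-1) (-1) (f0 L) n * (height_weight U n)%:E)%E); last first.
  by move=> n _; rewrite ge0_muleDl.
rewrite esumD; [|by move=> n _; exact: mule_ge0|by move=> n _; exact: mule_ge0].
apply: le_trans (leeD up right) _; rewrite -EFinD lee_fin /B le_eqVlt.
by apply/orP; left; apply/eqP; ring.
Qed.

Lemma height_le_expected_loops :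
  (height_expectation U (fun n : height L => (`|n (f0 L)|%:~R)%:E) <=
   height_expectation U loops)%E.
Proof.
apply: lee_wpmul2r; first by rewrite lee_fin invr_ge0 ltW.
apply: le_esum => n n0; apply: lee_wpmul2r; last exact: height_le_loops.
by rewrite lee_fin ltW// height_weight_gt0.
Qed.

End Assembly.

Theorem theorem10p4 (R : realType) (U : int -> R)
    (convU : convex_interaction U) (gaussU : annealed_gaussian U)
    (sumU : summable_interaction U) (eps : R) (eps_gt0 : 0 < eps) :
  exists2 C : R, 0 < C & forall L : nat, (1 <= L)%N ->
    let loops := height_expectation U (fun n : height L =>
      (total_loop_number R 1 1 (f0 L) n
       + total_loop_number R (-1) (-1) (f0 L) n)%E) in
    ((\sum_(j < 4) \sum_(xy in quadrant_pairs L j)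
        spin_expectation U (fun theta => cos (theta xy.1 - theta xy.2))
          `^ (1 - eps))%:E >= C%:E * loops)%E
    /\ (C%:E * loops >=
        C%:E * height_expectation U (fun n : height L => (`|n (f0 L)|%:~R)%:E))%E.
Proof.
have [rho [C [rho0 rho1 C0 decay]]] := boltzmann_decay convU gaussU sumU.
(* The cap 1/2 keeps [1 - s] positive for large [eps]; in particular a zero correlation has power 0
   and not 1. *)
pose s : R := Num.min eps (1 / 2).
have s0 : 0 < s by rewrite lt_min eps_gt0; lra.
have s2 : s <= 1 / 2 by rewrite ge_min lexx orbT.
have s_eps : s <= eps by rewrite ge_min lexx.
have s1 : 0 < s <= 1 by rewrite s0; lra.
pose K := 2 * ((C / boltzmann U 0 / (1 - rho)) `^ s / (1 - rho `^ s)).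
have K0 : 0 < K.
  rewrite mulr_gt0// divr_gt0//.
    by rewrite powR_gt0// !divr_gt0 ?boltzmann_gt0// subr_gt0.
  by rewrite subr_gt0 powR_lt1// ltW.
exists K^-1 => [|L L_gt0 loops]; first by rewrite invr_gt0.
have K0' : (0 <= (K^-1)%:E)%E by rewrite lee_fin invr_ge0 ltW.
split; last by apply: lee_wpmul2l => //; exact: height_le_expected_loops.
have := expected_loops_le convU gaussU sumU L_gt0 rho0 rho1 C0 decay s1.
move=> /(lee_wpmul2l K0') h; apply: (le_trans h).
(* Only the first quadrant is used; the other three contribute non-negative terms. *)
rewrite -EFinM -/K mulKf ?gt_eqF// lee_fin big_ord_recl /=.
rewrite -[leLHS]addr0; apply: lerD; last first.
  by apply: sumr_ge0 => j _; apply: sumr_ge0 => xy _; exact: powR_ge0.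
rewrite [leRHS](big_setID (axis_pairs L)) /=.
rewrite (finset.setIidPr (axis_pairs_quadrant L)) -[leLHS]addr0; apply: lerD; last first.
  by apply: sumr_ge0 => xy _; exact: powR_ge0.
apply: ler_sum => xy _; set a := spin_expectation _ _.
have a0 : 0 <= a by exact: spin_expectation_ge0.
have a1 : a <= 1 by exact: spin_expectation_le1.
(* Passing from [1 - s] to the smaller exponent [1 - eps] uses [a <= 1]; a zero correlation is
   treated apart, as monotonicity in the exponent needs a positive base. *)
move: a0; rewrite le_eqVlt => /predU1P[<-|a0].
  by rewrite powR0 ?powR_ge0// gt_eqF//; lra.
by apply: ger_powR; rewrite ?a0//; lra.
Qed.
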